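(* If $G$ is a diagonalizable subgroup of $\mathrm{Aut}\,\mathbf A^n$ of dimension $\ge n-1$, then the normalizer $N_{\mathrm{Aut}\,\mathbf A^n}(G)$ is an algebraic subgroup of $\mathrm{Aut}\,\mathbf A^n$.
   Context: $k$ is an algebraically closed field of characteristic $0$; $\mathbf A^n$ is affine space over $k$, and $\mathrm{Aut}\,\mathbf A^n$ is the group of its polynomial automorphisms. A subgroup of $\mathrm{Aut}\,\mathbf A^n$ is called algebraic if it is the image of an (affine) algebraic group under a homomorphism to $\mathrm{Aut}\,\mathbf A^n$ for which the action map on $\mathbf A^n$ is a morphism. A diagonalizable subgroup is an algebraic subgroup that is a diagonalizable algebraic group (not necessarily connected). *)

(* Defs.v *)
From HB Require Import structures.
From mathcomp Require Import all_boot all_order all_algebra.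
From mathcomp Require Import mpoly.
From mathcomp Require Import classical_sets.

Set Implicit Arguments.
Unset Strict Implicit.
Unset Printing Implicit Defensive.

Import GRing.Theory.
Local Open Scope classical_set_scope.
Local Open Scope ring_scope.

(* Points of A^m over k are row vectors 'rV[k]_m; varieties are identified
   with their sets of k-points, k being algebraically closed in all uses. *)

Section PolynomialMaps.
Variable k : fieldType.

Definition polymap (m n : nat) := n.-tuple {mpoly k[m]}.

Definition peval m n (f : polymap m n) (x : 'rV[k]_m) : 'rV[k]_n :=
  \row_i (tnth f i).@[fun j => x 0 j].

Definition pcomp m n p (f : polymap n p) (g : polymap m n) : polymap m p :=
  [tuple tnth f i \mPo g | i < p].

Definition pid n : polymap n n := [tuple 'X_i | i < n].

Lemma peval_comp m n p (f : polymap n p) (g : polymap m n) x :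
  peval (pcomp f g) x = peval f (peval g x).
Proof.
apply/rowP => i; rewrite !mxE tnth_mktuple comp_mpoly_meval.
by apply: meval_eq => j; rewrite mxE.
Qed.

Lemma peval_id n x : peval (pid n) x = x.
Proof. by apply/rowP => i; rewrite !mxE tnth_mktuple mevalXU. Qed.

Lemma pcomp1f m n (f : polymap m n) : pcomp (pid n) f = f.
Proof.
by apply: eq_from_tnth => i; rewrite !tnth_mktuple comp_mpolyXU -tnth_nth.
Qed.

Lemma pcompf1 m n (f : polymap m n) : pcomp f (pid m) = f.
Proof. by apply: eq_from_tnth => i; rewrite tnth_mktuple comp_mpoly_id. Qed.

Lemma pcompA m n p q (f : polymap p q) (g : polymap n p) (h : polymap m n) :
  pcomp f (pcomp g h) = pcomp (pcomp f g) h.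
Proof.
apply: eq_from_tnth => i; rewrite !tnth_mktuple.
move: (tnth f i) => P; rewrite [P]mpolyE raddf_sum.
rewrite [X in X \mPo h]raddf_sum [RHS]raddf_sum /=; apply: eq_bigr => M _.
rewrite !comp_mpolyZ !comp_mpolyX rmorph_prod /=; congr (_ *: _).
by apply: eq_bigr => j _; rewrite rmorphXn /= tnth_mktuple.
Qed.

End PolynomialMaps.

Section AffineAutomorphisms.
Variables (k : fieldType) (n : nat).

(* An automorphism is stored together with its (unique) inverse. *)
Definition polyAut_axiom (fg : polymap k n n * polymap k n n) :=
  (pcomp fg.1 fg.2 == pid k n) && (pcomp fg.2 fg.1 == pid k n).

Record polyAut := PolyAut {
  polyAut_val :> polymap k n n * polymap k n n;
  _ : polyAut_axiom polyAut_val }.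

HB.instance Definition _ := [isSub for polyAut_val].
HB.instance Definition _ := [Choice of polyAut by <:].

Definition aut_map (a : polyAut) : 'rV[k]_n -> 'rV[k]_n := peval (val a).1.

Fact polyAut_one_subproof : polyAut_axiom (pid k n, pid k n).
Proof. by rewrite /polyAut_axiom /= !pcompf1 eqxx. Qed.
Definition polyAut_one := PolyAut polyAut_one_subproof.

Fact polyAut_inv_subproof (a : polyAut) :
  polyAut_axiom ((val a).2, (val a).1).
Proof. by have:= valP a; rewrite /polyAut_axiom andbC. Qed.
Definition polyAut_inv a := PolyAut (polyAut_inv_subproof a).

Fact polyAut_mul_subproof (a b : polyAut) :
  polyAut_axiom (pcomp (val a).1 (val b).1, pcomp (val b).2 (val a).2).
Proof.
have /andP[/eqP a1 /eqP a2] := valP a; have /andP[/eqP b1 /eqP b2] := valP b.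
rewrite /polyAut_axiom /= pcompA -(pcompA (val a).1) b1 pcompf1 a1 eqxx.
by rewrite pcompA -(pcompA (val b).2) a2 pcompf1 b2 eqxx.
Qed.
Definition polyAut_mul a b := PolyAut (polyAut_mul_subproof a b).

Fact polyAut_mulA : associative polyAut_mul.
Proof. by move=> a b c; apply/val_inj; rewrite /= !pcompA. Qed.
Fact polyAut_mul1 : left_id polyAut_one polyAut_mul.
Proof.
by move=> a; apply/val_inj; rewrite /= pcomp1f pcompf1; case: (polyAut_val a).
Qed.
Fact polyAut_mulr1 : right_id polyAut_one polyAut_mul.
Proof.
by move=> a; apply/val_inj; rewrite /= pcomp1f pcompf1; case: (polyAut_val a).
Qed.
Fact polyAut_mulV : left_inverse polyAut_one polyAut_inv polyAut_mul.
Proof.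
by move=> a; apply/val_inj; have /andP[_ /eqP/= ->] := valP a.
Qed.
Fact polyAut_mulrV : right_inverse polyAut_one polyAut_inv polyAut_mul.
Proof.
by move=> a; apply/val_inj; have /andP[/eqP/= -> _] := valP a.
Qed.

(* Aut A^n, the product being composition: a * b is "b, then a". *)
HB.instance Definition _ := isGroup.Build polyAut
  polyAut_mulA polyAut_mul1 polyAut_mulr1 polyAut_mulV polyAut_mulrV.

Lemma aut_mapM (a b : polyAut) x :
  aut_map (a * b)%g x = aut_map a (aut_map b x).
Proof. exact: peval_comp. Qed.

Lemma aut_map1 x : aut_map 1%g x = x.
Proof. exact: peval_id. Qed.

End AffineAutomorphisms.

Section ZariskiTopology.
Variables (k : fieldType) (m : nat).
Implicit Types (Z Y A B : set 'rV[k]_m).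

Definition zero_locus (S : set {mpoly k[m]}) : set 'rV[k]_m :=
  [set x | forall p, S p -> p.@[fun i => x 0 i] = 0].

Definition zclosed Z := exists S, Z = zero_locus S.

Definition zirreducible Y :=
  Y !=set0 /\
  forall A B, zclosed A -> zclosed B -> Y `<=` A `|` B -> Y `<=` A \/ Y `<=` B.

Definition irreducible_chain Z (d : nat) (c : nat -> set 'rV[k]_m) :=
  (forall i, (i <= d)%N -> [/\ zclosed (c i), zirreducible (c i) & c i `<=` Z])
  /\ (forall i, (i < d)%N -> c i `<` c i.+1).

(* Krull dimension, for Z Zariski closed. *)
Definition has_dim Z (d : nat) :=
  (exists c, irreducible_chain Z d c) /\
  (forall e c, irreducible_chain Z e c -> (e <= d)%N).

End ZariskiTopology.

Definition regular (k : fieldType) m n (Z : set 'rV[k]_m)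
    (f : 'rV[k]_m -> 'rV[k]_n) :=
  exists P : polymap k m n, forall x, Z x -> f x = peval P x.

(* Regularity on the product Z x Z' inside A^(m + m'). *)
Definition regular2 (k : fieldType) m m' n (Z : set 'rV[k]_m)
    (Z' : set 'rV[k]_m') (f : 'rV[k]_m -> 'rV[k]_m' -> 'rV[k]_n) :=
  exists P : polymap k (m + m') n,
    forall x y, Z x -> Z' y -> f x y = peval P (row_mx x y).

(* Affine algebraic groups, embedded in some A^m; the values of the
   operations outside of the underlying closed set are irrelevant. *)
Record algGroup (k : fieldType) := AlgGroup {
  ag_dim : nat;
  ag_set : set 'rV[k]_ag_dim;
  ag_one : 'rV[k]_ag_dim;
  ag_mul : 'rV[k]_ag_dim -> 'rV[k]_ag_dim -> 'rV[k]_ag_dim;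
  ag_inv : 'rV[k]_ag_dim -> 'rV[k]_ag_dim;
  ag_closed : zclosed ag_set;
  ag_regular_mul : regular2 ag_set ag_set ag_mul;
  ag_regular_inv : regular ag_set ag_inv;
  ag_mem1 : ag_set ag_one;
  ag_memM : forall x y, ag_set x -> ag_set y -> ag_set (ag_mul x y);
  ag_memV : forall x, ag_set x -> ag_set (ag_inv x);
  ag_mulA : forall x y z, ag_set x -> ag_set y -> ag_set z ->
    ag_mul x (ag_mul y z) = ag_mul (ag_mul x y) z;
  ag_mul1 : forall x, ag_set x -> ag_mul ag_one x = x;
  ag_mulV : forall x, ag_set x -> ag_mul (ag_inv x) x = ag_one }.

Arguments ag_set {k} a.
Arguments ag_one {k} a.
Arguments ag_mul {k} a.
Arguments ag_inv {k} a.

Definition ag_isomorphic (k : fieldType) (H K : algGroup k) :=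
  exists (f : 'rV[k]_(ag_dim H) -> 'rV[k]_(ag_dim K))
         (g : 'rV[k]_(ag_dim K) -> 'rV[k]_(ag_dim H)),
  [/\ regular (ag_set H) f /\ regular (ag_set K) g,
      (forall x, ag_set H x -> ag_set K (f x) /\ g (f x) = x),
      (forall y, ag_set K y -> ag_set H (g y) /\ f (g y) = y) &
      (forall x y, ag_set H x -> ag_set H y ->
         f (ag_mul H x y) = ag_mul K (f x) (f y))].

Definition closed_subgroup (k : fieldType) (K : algGroup k)
    (T : set 'rV[k]_(ag_dim K)) :=
  [/\ zclosed T /\ T `<=` ag_set K, T (ag_one K),
      (forall x y, T x -> T y -> T (ag_mul K x y)) &
      (forall x, T x -> T (ag_inv K x))].

Section SubAlgGroup.
Variables (k : fieldType) (K : algGroup k) (T : set 'rV[k]_(ag_dim K)).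
Hypothesis hT : closed_subgroup T.

Let TK x : T x -> ag_set K x.
Proof. by case: hT => -[_ sTK] _ _ _; apply: sTK. Qed.

Definition subAlgGroup : algGroup k.
Proof.
refine (@AlgGroup k (ag_dim K) T (ag_one K) (ag_mul K) (ag_inv K)
  _ _ _ _ _ _ _ _ _).
- by case: hT => -[].
- have [P eP] := ag_regular_mul K.
  by exists P => x y /TK Kx /TK Ky; apply: eP.
- by have [P eP] := ag_regular_inv K; exists P => x /TK; apply: eP.
- by case: hT.
- by case: hT.
- by case: hT.
- by move=> x y z /TK Kx /TK Ky /TK Kz; apply: ag_mulA.
- by move=> x /TK; apply: ag_mul1.
- by move=> x /TK; apply: ag_mulV.
Defined.

End SubAlgGroup.

Section DiagGroup.
Variables (k : fieldType) (r : nat).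

(* The group D_r of invertible diagonal r x r matrices, as the closed set
   of the (t_1, .., t_r, s_1, .., s_r) with t_i s_i = 1 in A^(2r). *)
Definition diag_set : set 'rV[k]_(r + r) :=
  [set u | forall i, lsubmx u 0 i * rsubmx u 0 i = 1].

Definition diag_mul (u v : 'rV[k]_(r + r)) : 'rV[k]_(r + r) :=
  \row_i (u 0 i * v 0 i).

Definition diag_inv (u : 'rV[k]_(r + r)) : 'rV[k]_(r + r) :=
  row_mx (rsubmx u) (lsubmx u).

Definition diagGroup : algGroup k.
Proof.
refine (@AlgGroup k (r + r) diag_set (const_mx 1) diag_mul diag_inv
  _ _ _ _ _ _ _ _ _).
- exists [set p | exists i : 'I_r, p = 'X_(lshift r i) * 'X_(rshift r i) - 1].
  apply/seteqP; split => u /= Du.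
    move=> _ [i ->]; rewrite mevalB mevalM !mevalXU meval1 -(Du i).
    by rewrite !mxE subrr.
  move=> i; have /Du : exists j, 'X_(lshift r i) * 'X_(rshift r i) - 1
      = 'X_(lshift r j) * 'X_(rshift r j) - 1 :> {mpoly k[r + r]} by exists i.
  by rewrite mevalB mevalM !mevalXU meval1 !mxE => /subr0_eq.
- exists [tuple 'X_(lshift _ i) * 'X_(rshift _ i) | i < r + r] => u v _ _.
  apply/rowP => i; rewrite !mxE tnth_mktuple mevalM !mevalXU.
  by rewrite row_mxEl row_mxEr.
- exists [tuple match split i with
    | inl j => 'X_(rshift r j) | inr j => 'X_(lshift r j) end | i < r + r].
  move=> u _; apply/rowP => i; rewrite !mxE tnth_mktuple.
  by case: (split i) => j; rewrite mevalXU !mxE.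
- by move=> i; rewrite !mxE mulr1.
- by move=> u v Du Dv i; rewrite !mxE mulrACA; have:= Du i; have:= Dv i;
    rewrite !mxE => -> ->; rewrite mulr1.
- by move=> u Du i; rewrite row_mxKl row_mxKr mulrC.
- by move=> u v w _ _ _; apply/rowP => i; rewrite !mxE mulrA.
- by move=> u _; apply/rowP => i; rewrite !mxE mul1r.
- move=> u Du; apply/rowP => i; rewrite !mxE.
  case: (splitP i) => j ij; rewrite !mxE; have:= Du j; rewrite !mxE.
    by rewrite mulrC (_ : lshift r j = i) //; apply/val_inj.
  by rewrite (_ : rshift r j = i) //; apply/val_inj.
Defined.

End DiagGroup.

Definition diagonalizable (k : fieldType) (H : algGroup k) :=
  exists r (T : set 'rV[k]_(ag_dim (diagGroup k r))) (hT : closed_subgroup T),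
    ag_isomorphic H (subAlgGroup hT).

Section AlgebraicSubgroups.
Variables (k : fieldType) (n : nat).
Implicit Types (G : set (polyAut k n)) (H : algGroup k).

(* A group homomorphism H -> Aut A^n whose action map H x A^n -> A^n is a
   morphism. *)
Definition algebraic_action H (rho : 'rV[k]_(ag_dim H) -> polyAut k n) :=
  (forall x y, ag_set H x -> ag_set H y ->
     rho (ag_mul H x y) = (rho x * rho y)%g) /\
  regular2 (ag_set H) setT (fun x v => aut_map (rho x) v).

Definition algebraic_subgroup G :=
  exists H rho, @algebraic_action H rho /\ G = rho @` ag_set H.

(* H, via the isomorphism rho : H -> G, is G endowed with its structure of
   algebraic group.  In characteristic 0 this structure is unique: it is that
   of H' / ker rho' for any algebraic action rho' of H' with image G. *)
Definition algebraic_structure G H (rho : 'rV[k]_(ag_dim H) -> polyAut k n) :=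
  [/\ algebraic_action rho, G = rho @` ag_set H &
      (forall x y, ag_set H x -> ag_set H y -> rho x = rho y -> x = y)].

Definition diagonalizable_subgroup_of_dim G (d : nat) :=
  exists H rho,
    [/\ @algebraic_structure G H rho, diagonalizable H & has_dim (ag_set H) d].

Definition normalizer G : set (polyAut k n) :=
  [set a | [set (a * g * a^-1)%g | g in G] = G].

End AlgebraicSubgroups.

(* Main.v *)
(** Let A = k[x_1, .., x_n], graded by the characters of G; the degree of
    an element of A only matters here up to torsion.  An automorphism f
    normalizing G permutes the homogeneous elements, and since A is factorial
    with trivial units, it permutes the homogeneous primes.

    If every invariant of the identity component of G is constant, then
    by Dickson's lemma only finitely many monomials in homogeneous generators
    y_1, .., y_s of A have a given weight, and f permutes the finite set of
    the indecomposable weights, so that the degree of f is bounded.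

    Otherwise dim G >= n - 1 makes any two elements of the same weight
    algebraically dependent over the invariants.  A minimal nonconstant
    invariant t generates the ring of invariants: almost all t - l are prime,
    because in a factorization t - l = p q the weight of p takes finitely many
    values, and t - l = p q, t - l' = p' q' with p and p' of the same weight
    force p q' = c (t - m), whence m = l = l'.  A prime p of nonzero weight
    generates the space of its weight over k[t], hence divides some y_j.  So
    f permutes finitely many primes up to scalars, and maps t to a t + b: its
    degree is bounded again.

    Finally f normalizes G if and only if the coefficients of f and f^-1
    satisfy polynomial equations: an automorphism h is in G if and only if
    h^* y_j = d_j y_j, where the d_j satisfy all the multiplicative relations
    that hold between the weights of the y_j. *)

From HB Require Import structures.
From mathcomp Require Import all_boot all_order all_algebra.
From mathcomp Require Import mpoly ring.
From mathcomp Require Import boolp classical_sets.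
Require Import Defs.

Set Implicit Arguments.
Unset Strict Implicit.
Unset Printing Implicit Defensive.

(** * Factoriality of polynomial rings *)

Section Factoriality.
Import GRing.Theory.
Local Open Scope ring_scope.

(** The obstacle is to bound the degrees of all normalizing automorphisms at once: the normalizer
    then lives in a fixed affine space of coefficients, where its closedness is a matter of
    equations. As [G] may be disconnected, homogeneity is tested on powers [g ^+ j], which replaces
    a construction of the identity component. Weights lie in a group [L] mapping to the characters
    of [G], in the end the character lattice of a torus containing [G], so that distinct weights may
    agree on [G]. Equalities of weights are therefore stated through values on [G], and Dedekind's
    independence of characters replaces a direct sum of weight spaces. The dimension of [G] enters
    through [d] algebraically independent functions on it, read off a chain of irreducible closed
    subsets. *)

Definition rdvd (R : idomainType) (p a : R) := exists c, a = c * p.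

Definition rprime (R : idomainType) (p : R) :=
  [/\ p != 0, p \isn't a GRing.unit &
      forall a b, rdvd p (a * b) -> rdvd p a \/ rdvd p b].

Definition factorial_ring (R : idomainType) := forall a : R, a != 0 ->
  exists (u : R) (s : seq R), [/\ u \is a GRing.unit,
    forall p, p \in s -> rprime p & a = u * \prod_(p <- s) p].

Lemma rdvdD (R : idomainType) (p a b : R) :
  rdvd p a -> rdvd p b -> rdvd p (a + b).
Proof. by move=> [c ->] [d ->]; exists (c + d); rewrite mulrDl. Qed.

Lemma rdvdN (R : idomainType) (p a : R) : rdvd p a -> rdvd p (- a).
Proof. by move=> [c ->]; exists (- c); rewrite mulNr. Qed.

Lemma rdvd_mull (R : idomainType) (p a b : R) : rdvd p b -> rdvd p (a * b).
Proof. by move=> [c ->]; exists (a * c); rewrite mulrA. Qed.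

Lemma rdvd_mulr (R : idomainType) (p a b : R) : rdvd p a -> rdvd p (a * b).
Proof. by rewrite mulrC; apply: rdvd_mull. Qed.

Lemma rdvd0 (R : idomainType) (p : R) : rdvd p 0.
Proof. by exists 0; rewrite mul0r. Qed.

Lemma rdvdxx (R : idomainType) (p : R) : rdvd p p.
Proof. by exists 1; rewrite mul1r. Qed.

Lemma rdvd_sum (R : idomainType) (p : R) (I : Type) (r : seq I) (P : pred I) F :
  (forall i, P i -> rdvd p (F i)) -> rdvd p (\sum_(i <- r | P i) F i).
Proof. by move=> h; apply: big_ind => //; [exact: rdvd0|exact: rdvdD]. Qed.

Lemma rprime_prod (R : idomainType) (p : R) (I : Type) (s : seq I) (F : I ->
  R) :
  rprime p -> rdvd p (\prod_(i <- s) F i) -> exists i, rdvd p (F i).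
Proof.
move=> [p0 pU pP]; elim: s => [|i s IH].
  by rewrite big_nil => -[c c1]; case/negP: pU; apply/unitrP; exists c;
    rewrite [p * c]mulrC -c1.
by rewrite big_cons => /pP[|/IH//]; exists i.
Qed.

Lemma rprime_prod_seq (R : idomainType) (p : R) (I : eqType) (s : seq I) (F :
  I -> R) :
  rprime p -> rdvd p (\prod_(i <- s) F i) -> exists2 i, i \in s & rdvd p (F i).
Proof.
move=> [p0 pU pP]; elim: s => [|i s IH].
  by rewrite big_nil => -[c c1]; case/negP: pU; apply/unitrP; exists c;
    rewrite [p * c]mulrC -c1.
rewrite big_cons => /pP[pi|/IH[j js pj]]; first by exists i; rewrite ?inE ?eqxx.
by exists j; rewrite ?inE ?js ?orbT.
Qed.

Lemma rprime_exp (R : idomainType) (p a : R) m :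
  rprime p -> rdvd p (a ^+ m) -> rdvd p a.
Proof.
move=> [p0 pU pP]; elim: m => [[c c1]|m IH].
  by case/negP: pU; apply/unitrP; exists c; rewrite [p * c]mulrC -c1.
by rewrite exprS => /pP[|/IH].
Qed.

(** Gauss's lemma: modulo [p], the product of the first coefficients of [f] and [g] not divisible by
    [p] is a coefficient of [f * g]. *)
Lemma rprime_polyC (R : idomainType) (p : R) : rprime p -> rprime p%:P.
Proof.
move=> [p0 pU pP].
have dvdE (f : {poly R}) : rdvd p%:P f <-> forall i, rdvd p f`_i.
  split=> [[c ->] i|h]; first by exists c`_i; rewrite coefMC.
  have [c hc] := choice h; exists (\poly_(i < size f) c i); apply/polyP => i.
  rewrite coefMC coef_poly; case: ltnP => [_|sf]; first exact: hc.
  by rewrite nth_default // mul0r.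
split; first by rewrite polyC_eq0.
  apply/negP; rewrite poly_unitE coefC eqxx => /andP[_].
  by rewrite (negPf pU).
move=> f g pfg; apply: contrapT => /not_orP[/(contra_not (proj2 (dvdE _))) nf
  /(contra_not (proj2 (dvdE _))) ng].
have exi (h : {poly R}) : ~ (forall i, rdvd p h`_i) ->
    exists i, ~ rdvd p h`_i /\ forall j, (j < i)%N -> rdvd p h`_j.
  move=> /existsNP[i0 hi0].
  have ex : exists i, `[< ~ rdvd p h`_i >] by exists i0; apply/asboolP.
  case: (ex_minnP ex) => i /asboolP hi min; exists i; split=> // j ji.
  apply: contrapT => /asboolP/min; by rewrite leqNgt ji.
have [i [fi fmin]] := exi _ nf; have [j [gj gmin]] := exi _ ng.
have /dvdE/(_ (i + j)%N) := pfg.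
have ii : (i < (i + j).+1)%N by rewrite ltnS leq_addr.
rewrite coefM (bigD1 (Ordinal ii)) //= addKn => H.
have : rdvd p (f`_i * g`_j).
  rewrite -[_ * _](addrK (\sum_(i0 < (i + j).+1 | i0 != Ordinal ii) f`_i0 *
    g`_(i + j - i0))).
  apply: rdvdD => //; apply/rdvdN/rdvd_sum => l li.
  have [lti|gti|eqi] := ltngtP l i; first exact/rdvd_mulr/fmin.
    by apply/rdvd_mull/gmin; rewrite ltn_subLR ?ltn_add2r // -ltnS.
  by case/eqP: li; apply/val_inj.
by move=> /pP[].
Qed.

(** The prime factors of [c] are cancelled one by one: each stays prime in [{poly R}] and does not
    divide [g], so it divides [q]. *)
Lemma rdvd_cancel (R : idomainType) (c : R) (f g q : {poly R}) :
  factorial_ring R -> (forall p, rprime p -> ~ rdvd p%:P g) ->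
  c != 0 -> c *: f = q * g -> rdvd g f.
Proof.
move=> ufd ng /ufd[u [s [uU sP ->]]]; rewrite -scalerA => e.
have {e} : (\prod_(p <- s) p) *: f = (u^-1 *: q) * g.
  by rewrite -scalerAl -e (scalerA u^-1) mulVr ?scale1r.
move: (u^-1 *: q) => {}q; elim: s sP q => [|p s IH] sP q.
  by rewrite big_nil scale1r => ->; exists q.
rewrite big_cons -scalerA -mul_polyC => e.
have pp : rprime p by apply: sP; rewrite inE eqxx.
have [p0 _ pP] := rprime_polyC pp.
have /pP[[q' eq]|/ng//] : rdvd p%:P (q * g) by rewrite -e;
  apply/rdvd_mulr/rdvdxx.
apply: (IH _ q') => [r rs|]; first by apply: sP; rewrite inE rs orbT.
by apply: (mulfI p0); rewrite e eq mulrAC mulrC.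
Qed.

Lemma rprime_assoc (R : idomainType) (p q : R) : rprime p -> rprime q ->
  rdvd p q -> exists2 e, e \is a GRing.unit & q = e * p.
Proof.
move=> [p0 pU pP] [q0 qU qP] [d qd]; exists d => //.
have /qP[[e de]|[e pe]] : rdvd q (d * p) by rewrite -qd; apply: rdvdxx.
  case/negP: pU; apply/unitrP; exists e.
  have : e * p = 1 by apply: (mulIf q0); rewrite mul1r mulrAC -de.
  by rewrite [p * e]mulrC.
apply/unitrP; exists e; have : e * d = 1.
  by apply: (mulIf p0); rewrite mul1r -mulrA -qd.
by rewrite [d * e]mulrC.
Qed.

Lemma rprime_unit (R : idomainType) (p u a : R) : rprime p ->
  u \is a GRing.unit -> rdvd p (u * a) -> rdvd p a.
Proof.
move=> _ uU [c e]; exists (u^-1 * c).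
by rewrite -mulrA -e mulrA mulVr // mul1r.
Qed.

(** A prime dividing [g] divides its leading coefficient, whose number of prime factors drops when
    the prime is divided out. *)
Lemma factorial_primitive (R : idomainType) (g : {poly R}) :
  factorial_ring R -> g != 0 -> exists r g', [/\ r != 0, g = r *: g' &
    forall p, rprime p -> ~ rdvd p%:P g'].
Proof.
move=> ufd g0; have lg0 : lead_coef g != 0 by rewrite lead_coef_eq0.
have [u [s [uU sP]]] := ufd _ lg0.
have [m] := ubnP (size s).
elim: m s sP u uU g g0 {lg0} => // m IH s sP u uU g g0 sm lg.
have [h|/existsNP[p /not_implyP[pp /contrapT[h gh]]]] :=
    pselect (forall p, rprime p -> ~ rdvd p%:P g).
  by exists 1, g; rewrite oner_neq0 scale1r.
have [p0 pU pP] := pp.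
have h0 : h != 0 by apply: contraNneq g0 => h0; rewrite gh h0 mul0r.
have lh : lead_coef h * p = u * \prod_(q <- s) q.
  by rewrite -lg gh lead_coefM lead_coefC.
have [|q qs pq] := @rprime_prod_seq _ p _ s id pp.
  by apply: rprime_unit pp uU _; rewrite -lh; apply/rdvd_mull/rdvdxx.
have [e eU qe] := rprime_assoc pp (sP _ qs) pq.
have [||||r [h' [r0 hr np]]] := IH (rem q s) _ (u * e) _ h h0.
- by move=> x /mem_rem/sP.
- by rewrite unitrM uU.
- by rewrite size_rem //; case: (s) qs sm => // ? ?.
- apply: (mulIf p0); rewrite lh (perm_big _ (perm_to_rem qs)) big_cons /= qe.
  by rewrite -!mulrA; congr (_ * (_ * _)); rewrite mulrC.
exists (p * r), h'; split=> //; first by rewrite mulf_neq0.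
by rewrite gh mulrC mul_polyC hr scalerA.
Qed.

(* A factor of [f] which is primitive and of minimal degree is prime: its
   pseudo-gcd with any [a] is of degree 0, or is associate to it over the
   fraction field. *)
Lemma factorial_poly (R : idomainType) :
  factorial_ring R -> factorial_ring {poly R}.
Proof.
move=> ufd f; have [m] := ubnP (size f); elim: m f => // m IH f sf f0.
have [sf1|sf1] := leqP (size f) 1.
  rewrite (size1_polyC sf1).
  have : f`_0 != 0 by apply: contraNneq f0 => e; rewrite (size1_polyC sf1) e.
  move=> /ufd[u [s [uU sP ->]]]; exists u%:P, [seq p%:P | p <- s]; split.
  - by rewrite poly_unitE size_polyC coefC eqxx uU andbT eqb1;
    apply: contraTneq uU => ->; rewrite unitr0.
  - by move=> _ /mapP[p ps ->]; apply/rprime_polyC/sP.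
  - by rewrite big_map polyCM rmorph_prod.
(* Here [%|] is divisibility up to a scalar, that is over the fraction field; [1 < d] excludes
   constants. *)
pose P d := `[< exists g : {poly R}, [/\ g %| f, size g = d & (1 < d)%N] >].
have exP : exists d, P d.
  by exists (size f); apply/asboolP; exists f; rewrite Pdiv.Idomain.dvdpp.
case: (ex_minnP exP) => d /asboolP[g [gf gd d1]] dmin {exP}.
have g0 : g != 0 by rewrite -size_poly_gt0 gd ltnW.
have [r [g' [r0 eg np]]] := factorial_primitive ufd g0.
have gg' : g %= g' by rewrite eg Pdiv.Idomain.eqp_scale.
have g'f : g' %| f by rewrite -(Pdiv.Idomain.eqp_dvdl _ gg').
have sg' : size g' = d by rewrite -(Pdiv.Idomain.eqp_size gg').
have g'0 : g' != 0 by rewrite -size_poly_gt0 sg' ltnW.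
have true_dvd a : g' %| a -> rdvd g' a.
  by case/Pdiv.Idomain.dvdpP => -[c q] /= c0; apply: rdvd_cancel.
have [h fh] := true_dvd _ g'f.
have h0 : h != 0 by apply: contraNneq f0 => h0; rewrite fh h0 mul0r.
have [|//|u [s [uU sP hs]]] := IH h.
  rewrite -ltnS; apply: leq_trans sf; rewrite fh size_mul // sg' ltnS.
  by case: d d1 {gd dmin sg'} => [|[|d]] // _; rewrite !addnS /= ltnS leq_addr.
exists u, (g' :: s); split=> // [p|]; last first.
  by rewrite fh hs big_cons mulrC mulrCA.
rewrite inE => /predU1P[->|]; last exact: sP.
split=> // [|a b g'ab].
  by rewrite poly_unitE sg'; apply/negP => /andP[/eqP d1']; rewrite d1' in d1.
have dg' : gcdp g' a %| g' := Pdiv.Idomain.dvdp_gcdl _ _.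
have dne0 : gcdp g' a != 0 by rewrite Pdiv.Idomain.gcdp_eq0 (negPf g'0).
have := dne0; rewrite -size_poly_gt0 leq_eqVlt => /predU1P[/esym sd|sd].
  right; apply: true_dvd; rewrite -(@Pdiv.Idomain.Gauss_dvdpr _ _ a)
    ?Pdiv.Idomain.coprimep_def ?sd //.
  by have [c ->] := g'ab; apply: Pdiv.Idomain.dvdp_mulIr.
left; apply: true_dvd.
have dd : (d <= size (gcdp g' a))%N.
  apply: dmin; apply/asboolP; exists (gcdp g' a); split=> //.
  exact: Pdiv.Idomain.dvdp_trans dg' g'f.
have /Pdiv.Idomain.eqp_dvdl <- : gcdp g' a %= g'.
  rewrite -(Pdiv.Idomain.dvdp_size_eqp dg') eqn_leq sg' dd andbT -sg'.
  exact: Pdiv.Idomain.dvdp_leq.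
exact: Pdiv.Idomain.dvdp_gcdr.
Qed.

Lemma factorial_iso (R S : idomainType) (f : {rmorphism R ->
  S}) (g : {rmorphism S -> R}) :
  cancel f g -> cancel g f -> factorial_ring R -> factorial_ring S.
Proof.
move=> fK gK ufd a a0.
have dvdg p b : rdvd p b -> rdvd (g p) (g b).
  by move=> [c ->]; exists (g c); rewrite rmorphM.
have dvdf p b : rdvd p b -> rdvd (f p) (f b).
  by move=> [c ->]; exists (f c); rewrite rmorphM.
have /ufd[u [s [uU sP e]]] : g a != 0.
  by apply: contraNneq a0 => /(congr1 f); rewrite gK rmorph0 => ->.
exists (f u), [seq f p | p <- s]; split; first exact: rmorph_unit.
  move=> _ /mapP[p /sP[p0 pU pP] ->]; split.
  - by apply/negP => /eqP/(congr1 g)/eqP; rewrite fK rmorph0 (negPf p0).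
  - by apply: contraNN pU => /(rmorph_unit g); rewrite fK.
  move=> b c /dvdg; rewrite fK rmorphM => /pP[] /dvdf; rewrite gK;
    [by left|by right].
by rewrite big_map -rmorph_prod -rmorphM -e gK.
Qed.

Section Mmulti.
Variables (n : nat) (R : idomainType).

(** Inverse of [muni]: the isomorphism of k[n][X] with k[n+1] that carries inductions on the number
    of variables. *)
Definition mmultim (p : {poly {mpoly R[n]}}) : {mpoly R[n.+1]} :=
  (mpwiden p).['X_ord_max].

Lemma mmultimM : {morph mmultim : p q / p * q}.
Proof. by move=> p q; rewrite /mmultim rmorphM hornerM. Qed.

Lemma mmultimB : {morph mmultim : p q / p - q}.
Proof. by move=> p q; rewrite /mmultim rmorphB hornerD hornerN. Qed.

Lemma mmultim1 : mmultim 1 = 1.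
Proof. by rewrite /mmultim rmorph1 hornerC. Qed.

HB.instance Definition _ := GRing.isZmodMorphism.Build _ _ mmultim mmultimB.
HB.instance Definition _ :=
  GRing.isMonoidMorphism.Build _ _ mmultim (mmultim1, mmultimM).

Lemma mmultimC c : mmultim c%:P = mwiden c.
Proof. by rewrite /mmultim mpwidenC hornerC. Qed.

Lemma mmultimX : mmultim 'X = 'X_ord_max.
Proof. by rewrite /mmultim mpwidenX hornerX. Qed.

Lemma mnm_widen_split (m : 'X_{1..n.+1}) :
  m = (mnmwiden [multinom m (widen_ord (leqnSn n) i) | i < n] + U_(ord_max) *+
    m ord_max)%MM.
Proof.
apply/mnmP => i; rewrite mnmDE mulmnE mnm1E.
have [j ->|->] := unliftP ord_max i.
  have -> : lift ord_max j = widen_ord (leqnSn n) j.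
    by apply/val_inj; rewrite /= /bump leqNgt ltn_ord.
  rewrite mnmwiden_widen mnmE (_ : _ == _ = false) ?addn0 //.
  by apply/negP => /eqP/(congr1 val)/= e; have := ltn_ord j; rewrite -e ltnn.
by rewrite mnmwiden_ordmax eqxx mul1n.
Qed.

Lemma muniK : cancel (@muni n R) mmultim.
Proof.
move=> p; rewrite muniE rmorph_sum /= [RHS]mpolyE; apply: eq_bigr => m _.
rewrite -mul_polyC mmultimM mmultimC rmorphXn /= mmultimX mwidenZ mwidenX.
by rewrite mpolyXn -scalerAl -mpolyXD -mnm_widen_split.
Qed.

Lemma muniXmax : muni ('X_ord_max : {mpoly R[n.+1]}) = 'X.
Proof.
rewrite muniE msuppX big_seq1 mcoeffX eqxx scale1r mnm1E eqxx.
rewrite [[multinom _ | _ < _]](_ : _ = 0%MM) ?mpolyX0 ?scale1r //.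
apply/mnmP => i; rewrite mnmE mnm1E mnm0E.
by case: eqP => // /(congr1 val)/= e; have := ltn_ord i; rewrite -e ltnn.
Qed.

Lemma muni_widen (c : {mpoly R[n]}) : muni (mwiden c) = c%:P.
Proof.
elim/mpolyind: c => [|c m p _ _ IH]; first by rewrite !rmorph0.
rewrite !rmorphD /= IH; congr (_ + _).
rewrite mwidenZ mwidenX muniZ muniE msuppX big_seq1 mcoeffX eqxx scale1r.
rewrite mnmwiden_ordmax expr0 -!mul_polyC mulr1 -mul_mpolyC rmorphM /=.
congr (_ * 'X_[_]%:P); apply/mnmP => i.
by rewrite mnmE -[RHS]mnmwiden_widen.
Qed.

Lemma mmultimK : cancel mmultim (@muni n R).
Proof.
elim/poly_ind => [|p c IH]; first by rewrite !rmorph0.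
rewrite !rmorphD !rmorphM /= IH mmultimX mmultimC.
by rewrite muniXmax muni_widen.
Qed.

Lemma meval_muni (v : 'I_n.+1 -> R) (p : {mpoly R[n.+1]}) :
  p.@[v] = (map_poly (meval (fun i =>
    v (widen_ord (leqnSn n) i))) (muni p)).[v ord_max].
Proof.
rewrite muniE rmorph_sum /= horner_sum mevalE; apply: eq_bigr => m _.
rewrite map_polyZ hornerZ /= mevalZ mevalX map_polyXn hornerXn -mulrA;
  congr (_ * _).
by rewrite big_ord_recr /=; congr (_ * _); apply: eq_bigr => i _; rewrite mnmE.
Qed.

End Mmulti.

Lemma mpoly_factorial (k : fieldType) (n : nat) : factorial_ring {mpoly k[n]}.
Proof.
elim: n => [|n IH].
  move=> a a0; exists a, [::]; split=> //; last by rewrite big_nil mulr1.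
  have := a0; rewrite (nvar0_mpolyC a) mpolyC_eq0 => c0.
  by apply/unitrP; exists (a@_0)^-1%:MP; rewrite -!mpolyCM mulVf // mulfV.
exact: factorial_iso (@mmultimK n k) (@muniK n k) (factorial_poly IH).
Qed.

End Factoriality.

(** * Values, units and composition of polynomials *)

Section Polynomials.
Import GRing.Theory.
Local Open Scope ring_scope.

Lemma pchar0_natf_eq0 (k : fieldType) (char0 : [pchar k] =i pred0) m :
  (m%:R == 0 :> k) = (m == 0)%N.
Proof. by have /pcharf0P -> := char0. Qed.

Lemma pchar0_natf_inj (k : fieldType) (char0 : [pchar k] =i pred0) :
  injective (fun m => m%:R : k).
Proof.
move=> i j; wlog ij : i j / (i <= j)%N => [H e|/eqP].
  by case: (leqP i j) => [/H|/ltnW/H h]; [exact|exact/esym/h].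
rewrite eq_sym -subr_eq0 -natrB // pchar0_natf_eq0 // subn_eq0 => ji.
by apply/eqP; rewrite eqn_leq ij ji.
Qed.

Lemma poly_nonroot (k : fieldType) (char0 : [pchar k] =i pred0) (p : {poly k}) :
  p != 0 -> exists x, p.[x] != 0.
Proof.
move=> p0; apply: contrapT => /forallNP h.
suff : (size [seq i%:R : k | i <- iota 0 (size p)] < size p)%N.
  by rewrite size_map size_iota ltnn.
apply: max_poly_roots => //.
  by apply/allP => _ /mapP[i _ ->]; apply/eqP; have /negP := h i%:R;
    rewrite negbK => /eqP.
by rewrite map_inj_uniq ?iota_uniq //; apply: pchar0_natf_inj.
Qed.

(** By induction some point does not annihilate the leading coefficient in the last variable; one
    coordinate then remains to be chosen. *)
Lemma mpoly_nonroot (k : fieldType) (char0 : [pchar k] =i pred0) n (p :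
  {mpoly k[n]}) :
  p != 0 -> exists v, p.@[v] != 0.
Proof.
elim: n p => [|n IH] p p0.
  exists (fun=> 0); have := p0; rewrite (nvar0_mpolyC p) mevalC.
  by rewrite mpolyC_eq0.
have q0 : muni p != 0.
  by apply: contraNneq p0 => /(congr1 (@mmultim _ _));
    rewrite muniK rmorph0 => ->.
have [w hw] : exists w, (lead_coef (muni p)).@[w] != 0 by apply: IH;
  rewrite lead_coef_eq0.
have r0 : map_poly (meval w) (muni p) != 0.
  by apply: contraNneq hw => /(congr1 (fun q : {poly _} =>
    q`_(size (muni p)).-1)); rewrite coef_map coef0 => ->.
have [x hx] := poly_nonroot char0 r0.
exists (fun i => if unlift ord_max i is Some j then w j else x).
rewrite meval_muni unlift_none.
rewrite (_ : map_poly _ _ = map_poly (meval w) (muni p)) //.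
apply/polyP => i; rewrite !coef_map /=; apply: meval_eq => j.
have -> : widen_ord (leqnSn n) j = lift ord_max j.
  by apply/val_inj; rewrite /= /bump leqNgt ltn_ord.
by rewrite liftK.
Qed.

Lemma mpoly_eq_eval (k : fieldType) (char0 : [pchar k] =i pred0) n (p q :
  {mpoly k[n]}) :
  (forall v : 'rV[k]_n, p.@[fun i => v 0 i] = q.@[fun i => v 0 i]) -> p = q.
Proof.
move=> h; apply/eqP; rewrite -subr_eq0;
  apply/negP => /negP/(mpoly_nonroot char0)[v].
rewrite mevalB; have := h (\row_i v i).
rewrite !(meval_eq (v2 := v)) => [->|i|i]; rewrite ?mxE //.
by rewrite subrr eqxx.
Qed.

Lemma mpoly_unitP (k : fieldType) n (p : {mpoly k[n]}) :
  reflect (exists2 c, c != 0 & p = c%:MP) (p \is a GRing.unit).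
Proof.
apply: (iffP idP) => [/unitrP[q [qp _]]|[c c0 ->]]; last first.
  by apply/unitrP; exists c^-1%:MP; rewrite -!mpolyCM mulVf // mulfV.
apply/msize_poly1P; have := msize1 n k; rewrite -qp.
have p0 : p != 0 by apply: contra_eq_neq qp => ->;
  rewrite mulr0 eq_sym oner_neq0.
have q0 : q != 0 by apply: contra_eq_neq qp => ->;
  rewrite mul0r eq_sym oner_neq0.
rewrite msizeM //; move: (msize_poly_eq0 p) (msize_poly_eq0 q);
  rewrite (negPf p0) (negPf q0).
by case: (msize p) => // -[|a]; case: (msize q) => // b _ _; rewrite !addnS.
Qed.

Lemma comp_mpolyA (k : fieldType) m n p (a : {mpoly k[p]}) (f :
  polymap k n p) (g : polymap k m n) :
  (a \mPo f) \mPo g = a \mPo (pcomp f g).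
Proof.
have := @pcompA k m n p 1 [tuple a] f g => /(congr1 (fun t => tnth t ord0)).
by rewrite !tnth_mktuple => ->.
Qed.

End Polynomials.

(** * Dickson's lemma *)

Section Dickson.

(** The next index is one where [h] attains its minimum beyond the current index. *)
Lemma nondecreasing_subseq (h : nat -> nat) :
  exists phi : nat -> nat, (forall i, phi i < phi i.+1) /\
    (forall i j, i <= j -> h (phi i) <= h (phi j)).
Proof.
have ex x : exists i, x < i /\ forall j, x < j -> h i <= h j.
  have exP : exists m, `[< exists2 i, x < i & h i = m >].
    by exists (h x.+1); apply/asboolP; exists x.+1.
  case: (ex_minnP exP) => m /asboolP[i xi <-] min.
  by exists i; split=> // j xj; apply: min; apply/asboolP; exists j.
have [nx hnx] := choice ex.
pose phi i := iter i.+1 nx 0.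
have inc i : phi i < phi i.+1 by have [] := hnx (phi i).
exists phi; split=> //; apply: (@homo_leq _ (h \o phi) leq) => [x|x z w|i] //=;
  first exact: leq_trans.
have [lt min] := hnx (iter i nx 0); apply: min.
exact: ltn_trans lt (inc i).
Qed.

(** Subsequences are extracted for one coordinate after the other; extracting further preserves the
    monotonicity already gained. *)
Lemma dickson (s : nat) (g : nat -> 'X_{1..s}) :
  exists phi : nat -> nat, (forall i, phi i < phi i.+1) /\
    (forall i j, i <= j -> (g (phi i) <= g (phi j))%MM).
Proof.
suff H (cs : seq 'I_s) : exists phi : nat ->
  nat, (forall i, phi i < phi i.+1) /\
    (forall c, c \in cs -> forall i j, i <= j -> g (phi i) c <= g (phi j) c).
  have [phi [h1 h2]] := H (enum 'I_s); exists phi; split=> // i j ij.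
  by apply/mnm_lepP => c; apply: h2 => //; rewrite mem_enum.
elim: cs => [|c cs [phi [h1 h2]]]; first by exists id.
have [psi [h3 h4]] := nondecreasing_subseq (fun i => g (phi i) c).
have mono (f : nat -> nat) : (forall i, f i < f i.+1) -> {homo f : i j / i < j}.
  by move=> hf; apply: homo_ltn => //; apply: ltn_trans.
have le_psi i j : i <= j -> psi i <= psi j.
  by rewrite leq_eqVlt => /predU1P[->//|/(mono _ h3)/ltnW].
exists (phi \o psi); split=> [i|d]; first exact/(mono _ h1)/h3.
rewrite inE => /predU1P[->|dc] i j ij; first exact: h4.
by apply: h2 => //; apply: le_psi.
Qed.

End Dickson.

(** * The action of automorphisms on polynomials *)

Section Action.
Import GRing.Theory.
Local Open Scope ring_scope.
Variables (k : fieldType) (n : nat).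
Implicit Types (f g h : polyAut k n) (a b : {mpoly k[n]}).

(** The comorphism of [f]; it is a right action, see [actM]. *)
Definition act f a := a \mPo (val f).1.

HB.instance Definition _ f :=
  GRing.LRMorphism.copy (act f) (comp_mpoly ((val f).1 : n.-tuple _)).

Lemma actE f a : act f a = a \mPo (val f).1.
Proof. by []. Qed.

Lemma actM f g a : act (f * g)%g a = act g (act f a).
Proof. by rewrite /act comp_mpolyA. Qed.

Lemma act1 a : act 1%g a = a.
Proof. by rewrite /act comp_mpoly_id. Qed.

Lemma actZ f c a : act f (c *: a) = c *: act f a.
Proof. exact: linearZ. Qed.

Lemma actD f a b : act f (a + b) = act f a + act f b.
Proof. exact: rmorphD. Qed.

Lemma act_mul f a b : act f (a * b) = act f a * act f b.
Proof. exact: rmorphM. Qed.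

Lemma actC f c : act f c%:MP = c%:MP.
Proof. exact: comp_mpolyC. Qed.

Lemma actK f : cancel (act f) (act f^-1%g).
Proof. by move=> a; rewrite -actM mulgV act1. Qed.

Lemma actKV f : cancel (act f^-1%g) (act f).
Proof. by move=> a; rewrite -actM mulVg act1. Qed.

Lemma act_eq0 f a : (act f a == 0) = (a == 0).
Proof. exact: raddf_eq0 (can_inj (actK f)). Qed.

Lemma act_rdvd f a b : rdvd a b <-> rdvd (act f a) (act f b).
Proof.
split=> [[c ->]|[c e]]; first by exists (act f c); rewrite rmorphM.
by exists (act f^-1%g c); rewrite -(actK f b) e rmorphM /= actK.
Qed.

Lemma act_prime f a : rprime a -> rprime (act f a).
Proof.
move=> [a0 aU aP]; split; first by rewrite act_eq0.
  by apply: contraNN aU => /(rmorph_unit (act f^-1%g)); rewrite /= actK.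
move=> b c; rewrite -(actKV f b) -(actKV f c) -rmorphM -!act_rdvd; exact: aP.
Qed.

End Action.

Opaque act.

(** * Homogeneous polynomials and the degree of the normalizer *)

Section Grading.
Import Order.TTheory GRing.Theory.
Local Open Scope ring_scope.

(** Independence of characters with vector coefficients. The [chi i] differ from [chi0] but may
    coincide with each other. Replacing [g] by [g * h] and subtracting [chi i h] times the relation
    removes [chi i]. *)
Lemma dedekind (k : fieldType) (V : lmodType k) (U : groupType) (G : set U)
    (I : eqType) (s : seq I) (chi : I -> U -> k) (v : I -> V) chi0 v0 :
  G 1%g -> (forall g h, G g -> G h -> G (g * h)%g) -> chi0 1%g = 1 ->
  (forall g h, G g -> G h -> chi0 (g * h)%g = chi0 g * chi0 h) ->
  (forall i g h, G g -> G h -> chi i (g * h)%g = chi i g * chi i h) ->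
  (forall i, i \in s -> exists2 g, G g & chi i g != chi0 g) ->
  (forall g, G g -> chi0 g *: v0 = \sum_(i <- s) chi i g *: v i) ->
  v0 = 0.
Proof.
move=> G1 GM c1 c0M cM; elim: s v v0 => [|i s IH] v v0 ne e.
  by have := e _ G1; rewrite c1 scale1r big_nil.
have [|h Gh ch] := ne i; first by rewrite inE eqxx.
have /eqP : (chi0 h - chi i h) *: v0 = 0; last first.
  by rewrite scaler_eq0 subr_eq0 eq_sym (negPf ch) => /eqP.
apply: (IH (fun l => (chi l h - chi i h) *: v l)) => [l ls|g Gg].
  by apply: ne; rewrite inE ls orbT.
have := e _ (GM _ _ Gg Gh); have := e _ Gg; rewrite !big_cons => eg.
rewrite c0M // cM // => egh.
transitivity (chi i g * chi i h *: v i + \sum_(l <- s) chi l (g * h)%g *: v l -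
  chi i h *: (chi i g *: v i + \sum_(l <- s) chi l g *: v l)).
  by rewrite -egh -eg scalerBl scalerBr !scalerA [chi0 g * chi i h]mulrC.
rewrite scalerDr !scalerA [chi i h * _]mulrC opprD addrACA subrr add0r.
rewrite scaler_sumr -sumrB; apply: eq_bigr => l _.
by rewrite cM // !scalerA -scalerBl mulrBr [chi i h * _]mulrC.
Qed.

Variables (k : closedFieldType) (n : nat) (G : set (polyAut k n)).
Hypothesis char0 : [pchar k] =i pred0.
Variables (L : zmodType) (ch : L -> polyAut k n -> k).
Variables (s : nat) (y : polymap k n s) (M : 'I_s -> L).
Hypothesis G1 : G 1%g.
Hypothesis GM : forall g h, G g -> G h -> G (g * h)%g.
Hypothesis GC : forall g h, G g -> G h -> (g * h)%g = (h * g)%g.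
Hypothesis ch0 : forall g, G g -> ch 0 g = 1.
Hypothesis chD : forall v w g, G g -> ch (v + w) g = ch v g * ch w g.
Hypothesis chM : forall v g h, G g -> G h -> ch v (g * h)%g = ch v g * ch v h.
Hypothesis y0 : forall j, tnth y j != 0.
Hypothesis yhom : forall j g, G g -> act g (tnth y j) = ch (M j) g *: tnth y j.
Hypothesis ygen : forall a : {mpoly k[n]}, exists P : {mpoly k[s]},
  a = P \mPo y.

Implicit Types (a b p : {mpoly k[n]}) (v w : L).

Lemma GX g m : G g -> G (g ^+ m)%g.
Proof. by move=> Gg; elim: m => // m IH; rewrite expgS; apply: GM. Qed.

Lemma chX v g m : G g -> ch v (g ^+ m)%g = ch v g ^+ m.
Proof.
move=> Gg; elim: m => [|m IH].
  rewrite expg0 expr0; have := chM v G1 G1; rewrite mulg1 => e.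
  have : ch v 1%g * ch (- v) 1%g = 1 by rewrite -chD // subrr ch0.
  move=> e1; have c0 : ch v 1%g != 0.
    by apply: contra_eq_neq e1 => ->; rewrite mul0r eq_sym oner_neq0.
  by apply: (mulfI c0); rewrite -e mulr1.
by rewrite expgS exprS chM ?IH //; apply: GX.
Qed.

Lemma ch1 v : ch v 1%g = 1.
Proof. by have := chX v 0 G1; rewrite expg0 expr0. Qed.

Lemma ch_neq0 v g : G g -> ch v g != 0.
Proof.
move=> Gg; have : ch v g * ch (- v) g = 1 by rewrite -chD // subrr ch0.
by apply: contra_eq_neq => ->; rewrite mul0r eq_sym oner_neq0.
Qed.

Lemma chN v g : G g -> ch (- v) g = (ch v g)^-1.
Proof.
move=> Gg; apply: (mulfI (ch_neq0 v Gg)).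
by rewrite -chD // subrr ch0 // mulfV // ch_neq0.
Qed.

Lemma chMn v g m : G g -> ch (v *+ m) g = ch v g ^+ m.
Proof.
move=> Gg; elim: m => [|m IH]; first by rewrite mulr0n ch0.
by rewrite mulrS chD // IH exprS.
Qed.

Lemma ch_sum (I : Type) (r : seq I) (P : pred I) (F : I -> L) g :
  G g -> ch (\sum_(i <- r | P i) F i) g = \prod_(i <- r | P i) ch (F i) g.
Proof.
by move=> Gg; apply: (big_ind2 (fun v c => ch v g = c)) => // [|v c w d <- <-];
  [exact: ch0|exact: chD].
Qed.

(** Since distinct weights may give one character of [G], independence only says that each class of
    terms has sum 0. *)
Lemma dedekind_class (V : lmodType k) (I : eqType) (r : seq I) (v : I ->
  L) (b : I -> V) :
  (forall g, G g -> \sum_(i <- r) ch (v i) g *: b i = 0) ->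
  forall w, \sum_(i <- r | `[< forall g, G g -> ch (v i) g = ch w g >]) b i = 0.
Proof.
move=> h w; pose p i := `[< forall g, G g -> ch (v i) g = ch w g >].
apply: (@dedekind k V _ G _ [seq i <- r | ~~ p i] (fun i => ch (v i)) (fun i =>
  - b i) (ch w)) => //.
- exact: ch1.
- by move=> g f; apply: chM.
- by move=> i g f; apply: chM.
- move=> i; rewrite mem_filter => /andP[/asboolPn np _].
  apply: contrapT => ne; apply: np => g Gg; apply: contrapT => /eqP neg.
  by apply: ne; exists g.
move=> g Gg; rewrite big_filter; have := h g Gg; rewrite (bigID p) /= => /eqP.
rewrite addr_eq0 => /eqP e; rewrite scaler_sumr.
transitivity (\sum_(i <- r | p i) ch (v i) g *: b i).
  by apply: eq_bigr => i /asboolP ->.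
by rewrite e -sumrN; apply: eq_bigr => i _; rewrite scalerN.
Qed.

Definition wt (m : 'X_{1..s}) : L := \sum_i M i *+ m i.
Definition ym (m : 'X_{1..s}) : {mpoly k[n]} := 'X_[m] \mPo y.

Lemma wtD m m' : wt (m + m')%MM = wt m + wt m'.
Proof.
by rewrite /wt -big_split; apply: eq_bigr => i _; rewrite mnmDE mulrnDr.
Qed.

Lemma wtMn m j : wt (m *+ j)%MM = wt m *+ j.
Proof.
by rewrite /wt -sumrMnl; apply: eq_bigr => i _; rewrite mulmnE mulrnA.
Qed.

Lemma wt1 i : wt U_(i)%MM = M i.
Proof.
rewrite /wt (bigD1 i) //= mnm1E eqxx mulr1n big1 ?addr0 // => j ji.
by rewrite mnm1E eq_sym (negPf ji).
Qed.

Lemma wt_0 : wt 0%MM = 0.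
Proof. by rewrite /wt big1 // => i _; rewrite mnm0E. Qed.

Lemma ymE m : ym m = \prod_i tnth y i ^+ m i.
Proof. by rewrite /ym comp_mpolyX. Qed.

Lemma ym_neq0 m : ym m != 0.
Proof. by rewrite ymE; apply/prodf_neq0 => i _; apply: expf_neq0. Qed.

Lemma act_ym m g : G g -> act g (ym m) = ch (wt m) g *: ym m.
Proof.
move=> Gg; rewrite ymE rmorph_prod /= ch_sum // -scaler_prod;
  apply: eq_bigr => i _.
by rewrite rmorphXn /= yhom // exprZn chMn.
Qed.

Lemma compyE (P : {mpoly k[s]}) : P \mPo y = \sum_(m <- msupp P) P@_m *: ym m.
Proof.
rewrite {1}[P]mpolyE raddf_sum; apply: eq_bigr => m _.
by rewrite /= comp_mpolyZ.
Qed.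

(* Passing to powers of [g] ignores the torsion of the group of characters: for
   [0 < j], [hom j v a] says that [a] has weight [v] modulo torsion. *)
Definition hom j v a := forall g, G g -> act (g ^+ j)%g a = ch v g ^+ j *: a.

Definition qhom v a := exists2 j, (0 < j)%N & hom j v a.

Lemma hom_ym j m : hom j (wt m) (ym m).
Proof. by move=> g Gg; rewrite act_ym ?chX //; apply: GX. Qed.

Lemma hom_mul j i v a : hom j v a -> hom (j * i) v a.
Proof.
move=> h g Gg; rewrite mulnC expgnA exprM h ?chX //; exact: GX.
Qed.

Lemma homM j v w a b : hom j v a -> hom j w b -> hom j (v + w) (a * b).
Proof.
move=> ha hb g Gg; rewrite rmorphM /= ha // hb // chD // exprMn.
by rewrite -scalerAl -scalerAr scalerA.
Qed.

Lemma homX j v a i : hom j v a -> hom j (v *+ i) (a ^+ i).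
Proof.
move=> ha; elim: i => [|i IH]; last by rewrite mulrS exprS; apply: homM.
by move=> g Gg; rewrite mulr0n ch0 // expr1n scale1r rmorph1.
Qed.

Lemma homZ j v a c : hom j v a -> hom j v (c *: a).
Proof. by move=> h g Gg; rewrite actZ h // !scalerA mulrC. Qed.

Lemma homD j v a b : hom j v a -> hom j v b -> hom j v (a + b).
Proof. by move=> ha hb g Gg; rewrite linearD /= ha // hb // scalerDr. Qed.

Lemma hom_same j v w a : (forall g, G g -> ch v g ^+ j = ch w g ^+ j) ->
  hom j v a -> hom j w a.
Proof. by move=> e h g Gg; rewrite h // e. Qed.

(** The difference of the two sides is a sum of terms with characters other than [chi0], while [G]
    acts on it through [chi0]; so it vanishes by [dedekind]. *)
Lemma dedekind_ym (P : {mpoly k[s]}) j chi0 a :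
  chi0 1%g = 1 -> (forall g h, G g -> G h ->
    chi0 (g * h)%g = chi0 g * chi0 h) ->
  a = P \mPo y -> (forall g, G g -> act (g ^+ j)%g a = chi0 g *: a) ->
  a = \sum_(m <- msupp P | `[< forall g, G g ->
    ch (wt m) g ^+ j = chi0 g >]) P@_m *: ym m.
Proof.
move=> c1 cM ea ha; apply/eqP; rewrite -subr_eq0; apply/eqP.
pose b m := `[< forall g, G g -> ch (wt m) g ^+ j = chi0 g >].
set S := \sum_(_ <- _ | _) _.
have eS : a - S = \sum_(m <- [seq m <- msupp P | ~~ b m]) P@_m *: ym m.
  by rewrite ea compyE (bigID b) /= addrAC subrr add0r big_filter.
have cGj m g : G g -> act (g ^+ j)%g (ym m) =
  ch (wt m) g ^+ j *: ym m by apply: hom_ym.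
have aS g : G g -> act (g ^+ j)%g S = chi0 g *: S.
  move=> Gg; rewrite raddf_sum scaler_sumr; apply: eq_bigr => m /asboolP h.
  by rewrite /= actZ cGj // h // !scalerA mulrC.
apply: (@dedekind k _ _ G _ [seq m <- msupp P | ~~ b m]
  (fun m g => ch (wt m) g ^+ j) (fun m => P@_m *: ym m) chi0) => //.
- by move=> m g h Gg Gh; rewrite chM // exprMn.
- move=> m; rewrite mem_filter => /andP[/asboolPn nb _].
  apply: contrapT => ne; apply: nb => g Gg; apply: contrapT => /eqP neg.
  by apply: ne; exists g.
move=> g Gg; rewrite scalerBr -aS // -ha // -linearB /= eS raddf_sum.
by apply: eq_bigr => m _; rewrite /= actZ cGj // !scalerA mulrC.
Qed.

Lemma hom_ym_sum (P : {mpoly k[s]}) j v : hom j v (P \mPo y) ->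
  P \mPo y = \sum_(m <- msupp P | `[< forall g, G g ->
    ch (wt m) g ^+ j = ch v g ^+ j >]) P@_m *: ym m.
Proof.
move=> h; apply: (dedekind_ym (chi0 := fun g => ch v g ^+ j)) => //.
  by rewrite ch1 expr1n.
by move=> g f Gg Gf; rewrite chM // exprMn.
Qed.

(** Ensures that no character outside [L] is ever needed. Commutativity of [G] makes [c]
    multiplicative; if no monomial had this weight, [dedekind_ym] would give [a = 0]. *)
Lemma semi_hom j a (c : polyAut k n -> k) : a != 0 ->
  (forall g, G g -> act (g ^+ j)%g a = c g *: a) ->
  exists m, forall g, G g -> ch (wt m) g ^+ j = c g.
Proof.
move=> a0 h; have [P eP] := ygen a.
have inj c1 c2 : c1 *: a = c2 *: a -> c1 = c2.
  by move=> /eqP; rewrite -subr_eq0 -scalerBl scaler_eq0 (negPf a0) orbF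
    subr_eq0 => /eqP.
have c1 : c 1%g = 1 by apply: inj; rewrite -h // expg1n act1 scale1r.
have cM g f : G g -> G f -> c (g * f)%g = c g * c f.
  move=> Gg Gf; apply: inj; rewrite -h; last exact: GM.
  rewrite expgMn; last exact: GC.
  by rewrite actM h // actZ h // scalerA.
apply: contrapT => /forallNP ne; move: a0; rewrite (dedekind_ym c1 cM eP h).
by rewrite big1 ?eqxx // => m /asboolP /ne.
Qed.

Lemma act_exp g a c i : act g a = c *: a -> act (g ^+ i)%g a = c ^+ i *: a.
Proof.
move=> h; elim: i => [|i IH]; first by rewrite expg0 act1 scale1r.
by rewrite expgS actM h actZ IH scalerA exprS.
Qed.

Lemma rprime_dvd_index (a p : {mpoly k[n]}) (t : seq {mpoly k[n]}) u :
  u \is a GRing.unit -> (forall q, q \in t -> rprime q) ->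
    a = u * \prod_(q <- t) q ->
  rprime p -> rdvd p a -> exists l : 'I_(size t), exists2 e, e != 0 &
    nth 0 t l = e *: p.
Proof.
move=> uU tP -> pp /(rprime_unit pp uU)/(rprime_prod_seq pp)[q qt pq].
have [e /mpoly_unitP[c c0 ->] qe] := rprime_assoc pp (tP _ qt) pq.
have it : (index q t < size t)%N by rewrite index_mem.
by exists (Ordinal it), c => //=; rewrite nth_index // qe mul_mpolyC.
Qed.

(* The [g ^+ (j * i)] permute the finitely many prime factors of [a], so that
   two of them map [p] to the same factor. *)
Lemma prime_factor_hom a p j v : rprime p -> rdvd p a -> a != 0 -> (0 < j)%N ->
  hom j v a -> exists N m, [/\ (0 < N)%N, (j %| N)%N & hom N (wt m) p].
Proof.
move=> pp pa a0 j0 ha.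
have [u [t [uU tP ea]]] := mpoly_factorial a0.
(* The two colliding exponents depend on [g], but their difference is at most [size t] and divides
   the factorial, so that one [N] serves all [g]. *)
set N := (j * (size t)`!)%N.
have step g : exists c, G g -> act (g ^+ N)%g p = c *: p.
  have [Gg|nG] := pselect (G g); last by exists 0.
  have dvd i : rdvd (act (g ^+ (j * i))%g p) a.
    have /(act_rdvd (g ^+ (j * i))%g) := pa;
      rewrite (hom_mul i ha) // -mul_mpolyC.
    apply: rprime_unit; first exact: act_prime.
    by apply/mpoly_unitP; eexists; last by []; rewrite expf_neq0 // ch_neq0.
  have ex (i : 'I_(size t).+1) := rprime_dvd_index uU tP ea (act_prime _ pp)
    (dvd i).
  have [F hF] := choice ex.
  have : ~ injective F.
    by move=> /leq_card; rewrite !card_ord ltnn.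
  move=> /existsNP[i1 /existsNP[i2 /not_implyP[e12 n12]]].
  wlog lt12 : i1 i2 e12 n12 / (i1 < i2)%N.
    move=> H; case: (ltngtP i1 i2) => [|l|e]; first exact: H.
      by apply: H (esym e12) _ l => /esym.
    by case: n12; apply/val_inj.
  have [c1 c10 h1] := hF i1; have [c2 c20 h2] := hF i2.
  have [q eq] : exists q, (size t)`! = ((i2 - i1) * q)%N.
    have : (i2 - i1 %| (size t)`!)%N.
      apply: dvdn_fact; rewrite subn_gt0 lt12 /=.
      by apply: leq_trans (leq_subr _ _) _; rewrite -ltnS.
    by move=> /dvdnP[q ->]; exists q; rewrite mulnC.
  exists ((c2^-1 * c1) ^+ q) => _; rewrite /N eq mulnA expgnA; apply: act_exp.
  apply: (can_inj (actK (g ^+ (j * i1))%g)).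
  rewrite actZ -actM -expgnDr -mulnDr subnK; last exact: ltnW.
  rewrite -scalerA -h1 e12 h2 (scalerA c2^-1) (mulVf c20); exact/esym/scale1r.
have [c hc] := choice step.
have [p0 _ _] := pp.
have [m hm] := semi_hom p0 hc.
exists N, m; split=> [||g Gg]; first by rewrite muln_gt0 j0 fact_gt0.
  exact: dvdn_mulr.
by rewrite hc // hm.
Qed.

(** For diagonalizable [G] these are the invariants of the identity component: it lies in every
    group of [j]-th powers, and equals it when [j] is a multiple of the number of components. *)
Definition qinv a := qhom 0 a.

Lemma hom0P j a : hom j 0 a <-> forall g, G g -> act (g ^+ j)%g a = a.
Proof.
split=> h g Gg; first by rewrite h // ch0 // expr1n scale1r.
by rewrite h // ch0 // expr1n scale1r.
Qed.

Lemma homC j c : hom j 0 c%:MP.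
Proof. by apply/hom0P => g _; rewrite actC. Qed.

Lemma homV j v w q a : a != 0 -> hom j v (q * a) -> hom j w a ->
  hom j (v - w) q.
Proof.
move=> a0 hqa ha g Gg; apply: (mulIf a0);
  apply: (scalerI (expf_neq0 j (ch_neq0 w Gg))).
rewrite scalerAr -ha // -rmorphM /= hqa // -scalerAl !scalerA; congr (_ *: _).
by rewrite -exprMn -chD // addrC subrK.
Qed.

Lemma hom_common a b v w : qhom v a -> qhom w b ->
  exists j, [/\ (0 < j)%N, hom j v a & hom j w b].
Proof.
move=> [i i0 ha] [j j0 hb]; exists (i * j)%N; split;
  first by rewrite muln_gt0 i0.
  exact: hom_mul.
by rewrite mulnC; apply: hom_mul.
Qed.

Lemma qinvD a b : qinv a -> qinv b -> qinv (a + b).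
Proof. by move=> ha hb; have [j [j0 h1 h2]] := hom_common ha hb;
  exists j => //; apply: homD. Qed.

Lemma qhomM v w a b : qhom v a -> qhom w b -> qhom (v + w) (a * b).
Proof. by move=> ha hb; have [j [j0 h1 h2]] := hom_common ha hb;
  exists j => //; apply: homM. Qed.

Lemma qhomV v w q a : a != 0 -> qhom v (q * a) -> qhom w a -> qhom (v - w) q.
Proof.
by move=> a0 ha hb; have [j [j0 h1 h2]] := hom_common ha hb; exists j => //;
  apply: homV h1 h2.
Qed.

Lemma qinvC c : qinv c%:MP.
Proof. by exists 1%N => //; apply: homC. Qed.

Lemma qinvZ c a : qinv a -> qinv (c *: a).
Proof. by move=> [j j0 h]; exists j => //; apply: homZ. Qed.

Lemma qinvB a b : qinv a -> qinv b -> qinv (a - b).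
Proof. by move=> ha hb; rewrite -[- b]scaleN1r; apply/qinvD/qinvZ. Qed.

(** Nonconstancy is expressed throughout by [mlead a != 0%MM], which allows induction along the
    monomial order. *)
Lemma lead_const a : mlead a = 0%MM -> a = (a@_0)%:MP.
Proof.
move=> la; have [->|a0] := eqVneq a 0; first by rewrite mcoeff0 mpolyC0.
by apply: msize1_polyC; rewrite -mlead_deg // la mdeg0.
Qed.

Lemma lead_const_neq a c : mlead a != 0%MM -> a != c%:MP.
Proof. by apply: contraNneq => ->; rewrite mleadC. Qed.

Lemma lead_subC a c : mlead a != 0%MM -> mlead (a - c%:MP) = mlead a.
Proof.
move=> a0; rewrite mleadDl // mleadN mleadC lt_neqAle le0x.
by rewrite eq_sym a0.
Qed.

Lemma lead_lt a m : (mlead a <= m)%O -> a@_m = 0 -> m != 0%MM ->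
  (mlead a < m)%O.
Proof.
move=> le am m0; rewrite lt_neqAle le andbT; apply/eqP => e.
move/eqP: am; rewrite -e mleadc_eq0 => /eqP a0.
by move: m0; rewrite -e a0 mlead0 eqxx.
Qed.

Lemma cofactor_prime (a : {mpoly k[n]}) : a != 0 -> a \isn't a GRing.unit ->
  ~ rprime a ->
  exists p q, [/\ rprime p, q \isn't a GRing.unit & a = q * p].
Proof.
move=> a0 aU na; have [u [[|p t] [uU tP e]]] := mpoly_factorial a0.
  by move: aU; rewrite e big_nil mulr1 uU.
have pp : rprime p by apply: tP; rewrite inE eqxx.
exists p, (u * \prod_(q <- t) q); split=> //; last first.
  by rewrite e big_cons mulrCA mulrC.
apply/negP => qU; apply: na; have [p0 pU pP] := pp; split=> // b c.
have ea : a = (u * \prod_(q <- t) q) * p by rewrite e big_cons mulrCA mulrC.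
move: (u * _) qU ea => d dU -> [x e1].
have /pP : rdvd p (b * c) by rewrite e1 mulrA; apply/rdvd_mull/rdvdxx.
case=> -[z ->]; [left|right]; exists (z * d^-1); by rewrite mulrA mulrVK.
Qed.

(** Fix an expression in [y] of each monomial of degree less than [D]: the monomials occurring there
    suffice. The list does not depend on [j], which matters since each prime comes with its own
    exponent. *)
Lemma finite_wt D : exists Ms : seq 'X_{1..s}, forall a j v,
  a != 0 -> (msize a <= D)%N -> hom j v a ->
  exists2 m, m \in Ms & forall g, G g -> ch (wt m) g ^+ j = ch v g ^+ j.
Proof.
have [P hP] := choice (fun m : 'X_{1..n} => ygen 'X_[m]).
exists (flatten [seq msupp (P (m : 'X_{1..n})) | m : 'X_{1..n < D}]) =>
  a j v a0 aD ha.
set Q := \sum_(m : 'X_{1..n < D}) a@_m *: P m.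
have aQ : a = Q \mPo y.
  rewrite (mpolywE aD) raddf_sum; apply: eq_bigr => m _.
  by rewrite /= comp_mpolyZ -hP.
move: ha; rewrite aQ => /hom_ym_sum; rewrite -aQ => ea.
have [m mQ /asboolP hm] : exists2 m, m \in msupp Q &
    `[< forall g, G g -> ch (wt m) g ^+ j = ch v g ^+ j >].
  apply: contrapT => ne; case/eqP: a0;
    rewrite ea big_seq_cond big1 // => m /andP[mQ hm].
  by case: ne; exists m.
exists m => //; have /flatten_mapP[m' _ m'Q] := msupp_sum_le mQ.
apply/flatten_mapP; exists m'; first by rewrite mem_enum.
by apply: msuppZ_le m'Q.
Qed.

(** Two-sided form of the normalizer condition, symmetric in [f] and its inverse; see
    [normalizerP]. *)
Definition normalizes f := forall g, G g ->
  G (f * g * f^-1)%g /\ G (f^-1 * g * f)%g.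

Lemma normalizesV f : normalizes f -> normalizes f^-1%g.
Proof. by move=> nf g Gg; rewrite invgK; have [? ?] := nf g Gg. Qed.

Lemma conjg_expg (U : groupType) (f g : U) j :
  (f * g ^+ j = (f * g * f^-1) ^+ j * f)%g.
Proof.
elim: j => [|i IH]; first by rewrite !expg0 mulg1 mul1g.
by rewrite !expgSr -(mulgA _ (f * g * f^-1)%g f) mulgVK 2!mulgA IH.
Qed.

(** [f] conjugates the character of [a], and [semi_hom] finds a weight for the result. *)
Lemma act_hom f j v a : normalizes f -> a != 0 -> hom j v a ->
  exists2 m, hom j (wt m) (act f a) &
   forall g, G g -> ch (wt m) g ^+ j = ch v (f * g * f^-1)%g ^+ j.
Proof.
move=> nf a0 ha.
have e g : G g -> act (g ^+ j)%g (act f a) =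
  ch v (f * g * f^-1)%g ^+ j *: act f a.
  move=> Gg; have [Gfg _] := nf g Gg.
  by rewrite -actM conjg_expg actM ha // actZ.
have fa0 : act f a != 0 by rewrite act_eq0.
have [m hm] := semi_hom fa0 e.
by exists m => // g Gg; rewrite e // hm.
Qed.

Lemma act_qinv f b : normalizes f -> qinv b -> qinv (act f b).
Proof.
move=> nf [j j0 hb]; have [->|b0] := eqVneq b 0.
  by rewrite rmorph0 -mpolyC0; apply: qinvC.
have [m hm e] := act_hom nf b0 hb; exists j => //.
apply: hom_same hm => g Gg; rewrite e // !ch0 //; by have [] := nf g Gg.
Qed.

Definition bounded_degree a := exists K, forall f, normalizes f ->
  (msize (act f a) <= K)%N.

Lemma bounded_degreeD a b : bounded_degree a -> bounded_degree b ->
  bounded_degree (a + b).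
Proof.
move=> [K hK] [K' hK']; exists (maxn K K') => f nf; rewrite actD.
apply: leq_trans (msizeD_le _ _) _.
have ha := hK f nf; have hb := hK' f nf.
rewrite geq_max; apply/andP; split.
  exact: leq_trans ha (leq_maxl _ _).
exact: leq_trans hb (leq_maxr _ _).
Qed.

Lemma bounded_degreeM a b : bounded_degree a -> bounded_degree b ->
  bounded_degree (a * b).
Proof.
move=> [K hK] [K' hK']; exists (K + K')%N => f nf; rewrite act_mul.
have [->|a0] := eqVneq (act f a) 0; first by rewrite mul0r msize0.
have [->|b0] := eqVneq (act f b) 0; first by rewrite mulr0 msize0.
have e := msizeM a0 b0; have ha := hK f nf; have hb := hK' f nf.
rewrite e; apply: leq_trans (leq_pred _) _; exact: leq_add ha hb.
Qed.

Lemma bounded_degreeC c : bounded_degree c%:MP.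
Proof. by exists 1%N => f _; rewrite actC msizeC leq_b1. Qed.

Lemma bounded_degree_prod (I : eqType) (r : seq I) (F : I -> {mpoly k[n]}) :
  (forall i, i \in r -> bounded_degree (F i)) ->
    bounded_degree (\prod_(i <- r) F i).
Proof.
move=> h; rewrite big_seq_cond; apply: big_ind => [||i /andP[/h]//].
  by have := bounded_degreeC 1; rewrite mpolyC1.
exact: bounded_degreeM.
Qed.

Lemma bounded_degree_gen : (forall l, bounded_degree (tnth y l)) ->
  forall a, bounded_degree a.
Proof.
move=> hy a; have [P ->] := ygen a; rewrite compyE; apply: big_ind => [||m _].
- by rewrite -mpolyC0; apply: bounded_degreeC.
- exact: bounded_degreeD.
rewrite -mul_mpolyC; apply: bounded_degreeM; first exact: bounded_degreeC.
rewrite ymE; apply: bounded_degree_prod => i _; elim: (m i) => [|e IH].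
  by have := bounded_degreeC 1; rewrite mpolyC1.
rewrite exprS; exact: bounded_degreeM (hy i) IH.
Qed.

(** * Bounded degree in the presence of a nonconstant invariant *)

Section NonconstantInvariant.
(** A homogeneous relation of degree [D] between [a] and [c] over k[t], with [F] its
    dehomogenization; it is supplied by [homogeneous_dependence]. *)
Hypothesis dep : forall a c t v j, (0 < j)%N -> hom j v a -> hom j v c ->
  hom j 0 t ->
  exists D (F : {poly {poly k}}), [/\ F != 0, (size F <= D.+1)%N &
    \sum_(i < size F) horner_alg t F`_i * a ^+ i * c ^+ (D - i) = 0].
Variable t : {mpoly k[n]}.
Hypothesis tinv : qinv t.
Hypothesis tlead : mlead t != 0%MM.
Hypothesis tmin : forall b, qinv b -> mlead b != 0%MM -> (mlead t <= mlead b)%O.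

Lemma minimal_invariant_neq0 : t != 0.
Proof. by apply: contraNneq tlead => ->; rewrite mlead0. Qed.

Lemma fiber_neq0 l : t - l%:MP != 0.
Proof. by rewrite subr_eq0; apply: lead_const_neq. Qed.

Lemma lead_nonunit (a : {mpoly k[n]}) : a != 0 -> a \isn't a GRing.unit ->
  mlead a != 0%MM.
Proof.
move=> a0; apply: contraNneq => la; apply/mpoly_unitP.
have ea := lead_const la; exists a@_0 => //.
by apply: contraNneq a0 => e; rewrite ea e mpolyC0.
Qed.

Lemma lead_unit (a : {mpoly k[n]}) : mlead a != 0%MM -> a \isn't a GRing.unit.
Proof. by apply: contraNN => /mpoly_unitP[c _ ->]; rewrite mleadC. Qed.

(** Cancelling the leading term leaves an invariant below [t], which is constant by minimality. *)
Lemma qinv_lead_eq b : qinv b -> mlead b = mlead t ->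
  exists c c', c != 0 /\ b = c *: t + c'%:MP.
Proof.
move=> ib lb; set m := mlead t in lb.
have tm : t@_m != 0 by rewrite mleadc_eq0 minimal_invariant_neq0.
have bm : b@_m != 0.
  by rewrite -lb mleadc_eq0; apply: contraNneq tlead => b0;
    rewrite -/m -lb b0 mlead0.
set c := b@_m / t@_m; have c0 : c != 0 by rewrite mulf_neq0 // invr_neq0.
exists c, (b - c *: t)@_0; split=> //.
have ibt : qinv (b - c *: t) by apply: qinvB (qinvZ _ _).
rewrite -lead_const; first by rewrite addrC subrK.
apply/eqP; apply: contraT => /(tmin ibt); rewrite leNgt lead_lt //.
  by apply: le_trans (mleadB_le _ _) _; rewrite mleadZ // leUx lb !lexx.
by rewrite mcoeffB mcoeffZ divfK // subrr.
Qed.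

Lemma unit_dvd_const (q : {mpoly k[n]}) c : q \isn't a GRing.unit ->
  rdvd q c%:MP -> c = 0.
Proof.
move=> qU [x e]; apply/eqP; apply: contraNT qU => c0; apply/unitrP.
exists (c^-1%:MP * x); have : c^-1%:MP * x * q = 1.
  by rewrite -mulrA -e -mpolyCM mulVf.
by rewrite [q * _]mulrC.
Qed.

(* The index [wt m] of [p], hence that of [q], takes finitely many values on
   the factorizations [t - l = q * p]. *)
Lemma exists_prime_fiber : exists l, rprime (t - l%:MP).
Proof.
apply: contrapT => /forallNP np.
have [Ms hMs] := finite_wt (msize t).
(* In characteristic 0 these constants are distinct; one more of them than weights in [Ms] forces
   two factorizations to share a weight. *)
pose l (i : nat) : k := i%:R.
have lt i : mlead (t - (l i)%:MP) = mlead t by apply: lead_subC.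
have ex (i : 'I_(size Ms).+1) : exists x :
  'I_(size Ms) * {mpoly k[n]} * {mpoly k[n]},
  [/\ t - (l i)%:MP = x.2 * x.1.2, rprime x.1.2, x.2 \isn't a GRing.unit &
    qhom (wt (nth 0%MM Ms x.1.1)) x.1.2].
  have [|p [q [pp qU e]]] := cofactor_prime (fiber_neq0 (l i)) _ (np (l i)).
    by apply: lead_unit; rewrite lt.
  have [j j0 hj] : qinv (t - (l i)%:MP) by apply: qinvB tinv (qinvC _).
  have [|N [m [N0 _ hm]]] := prime_factor_hom pp _ (fiber_neq0 (l i)) j0 hj.
    by rewrite e; apply/rdvd_mull/rdvdxx.
  have [p0 pU pP] := pp.
  have q0 : q != 0 by apply: contraNneq (fiber_neq0 (l i)) => q0;
    rewrite e q0 mul0r.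
  have [|m' m's hm'] := hMs p N (wt m) p0 _ hm.
    rewrite -!mlead_deg ?minimal_invariant_neq0 // ltnS; apply: lemc_mdeg.
    by rewrite -(lt i) e mleadM // lemc_addl.
  have it : (index m' Ms < size Ms)%N by rewrite index_mem.
  exists (Ordinal it, p, q) => /=; split=> //; exists N => //.
  by rewrite nth_index //; apply: hom_same hm => g /hm' ->.
have [F hF] := choice ex.
have : ~ injective (fun i => (F i).1.1) by move=> /leq_card;
  rewrite !card_ord ltnn.
move=> /existsNP[i /existsNP[i' /not_implyP[e12 n12]]].
have li : l i <> l i' by move=> /(pchar0_natf_inj char0) e; apply/n12/val_inj.
have [e1 p1 q1 h1] := hF i; have [e2 p2 q2 h2] := hF i'.
move: h2; rewrite -e12; move: (wt _) h1 => v h1 h2.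
move: (F i).1.2 (F i).2 (F i').1.2 (F i').2 e1 p1 q1 h1 e2 p2 q2 h2 =>
  p q p' q' e1 p1 q1 h1 e2 p2 q2 h2.
have [p0 pU pP] := p1; have [p0' pU' pP'] := p2.
have q0 : q != 0 by apply: contraNneq (fiber_neq0 (l i)) => q0;
  rewrite e1 q0 mul0r.
have q0' : q' != 0 by apply: contraNneq (fiber_neq0 (l i')) => q0';
  rewrite e2 q0' mul0r.
have hq : qhom (- v) q.
  rewrite -sub0r; apply: qhomV p0 _ h1; rewrite -e1;
    exact: qinvB tinv (qinvC _).
have hq' : qhom (- v) q'.
  rewrite -sub0r; apply: qhomV p0' _ h2; rewrite -e2;
    exact: qinvB tinv (qinvC _).
have iqp : qinv (q' * p) by rewrite /qinv -(addNr v); apply: qhomM.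
have iqp' : qinv (q * p') by rewrite /qinv -(addNr v); apply: qhomM.
have lead_ne a b : a != 0 -> b != 0 -> b \isn't a GRing.unit ->
  mlead (a * b) != 0%MM.
  by move=> a0 b0 bU; apply: lead_nonunit;
    rewrite ?mulf_neq0 // unitrM negb_and bU orbT.
have m1 := tmin iqp (lead_ne _ _ q0' p0 pU).
have m2 := tmin iqp' (lead_ne _ _ q0 p0' pU').
(* The invariants [q' * p] and [q * p'] multiply to (t - l)(t - l'), and neither leading monomial is
   below that of [t]. *)
have lqp : mlead (q' * p) = mlead t.
  apply/le_anti; rewrite m1 andbT leNgt; apply/negP => lt1.
  have := ltmc_le_add lt1 m2.
  rewrite -{1}(lt i) -(lt i') e1 e2 !mleadM //.
  rewrite (_ : (_ + _ + _ = mlead q' + mlead p + (mlead q + mlead p'))%MM)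
    ?ltxx //.
  by apply/mnmP => x; rewrite !mnmDE addnACA [RHS]addnACA; congr (_ + _)%N;
    apply: addnC.
have [c [c' [c0 eqp]]] := qinv_lead_eq iqp lqp.
(* A nonunit dividing both [t - la] and [c t + c'] divides the constant [c' + c la], which must be
   0. Applied to [p] and to [q'], this yields equal constants. *)
have dvd_t (q3 : {mpoly k[n]}) la : q3 \isn't a GRing.unit ->
  rdvd q3 (t - la%:MP) ->
    rdvd q3 (q' * p) -> c' = - (c * la).
  move=> qU hd; rewrite eqp => hd'; apply/eqP; rewrite -subr_eq0 opprK;
    apply/eqP.
  apply: unit_dvd_const qU _.
  have -> : (c' + c * la)%:MP = c *: t + c'%:MP + - (c%:MP * (t - la%:MP)).
    rewrite mulrBr mul_mpolyC mpolyCD mpolyCM; ring.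
  by apply/rdvdD/rdvdN/rdvd_mull.
have E1 := dvd_t p (l i) pU _ _; have E2 := dvd_t q' (l i') q2 _ _.
apply: li; apply: (mulfI c0); apply: oppr_inj.
rewrite -E1 -?E2 //; rewrite ?e1 ?e2.
- exact/rdvd_mulr/rdvdxx.
- exact/rdvd_mulr/rdvdxx.
- exact/rdvd_mull/rdvdxx.
- exact/rdvd_mull/rdvdxx.
Qed.

Lemma horner_alg_sub (g : {poly k}) l : exists g', horner_alg t g =
  (t - l%:MP) * horner_alg t g' + g.[l]%:MP.
Proof.
have [g' e] : exists g', g - g.[l]%:P = g' * ('X - l%:P).
  by apply/factor_theorem; rewrite rootE hornerD hornerN hornerC subrr.
exists g'; rewrite -[LHS](subrK g.[l]%:MP); congr (_ + _).
rewrite -alg_mpolyC -(horner_algC t) -rmorphB /= e rmorphM /= mulrC.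
by rewrite rmorphB /= horner_algX horner_algC alg_mpolyC.
Qed.

Lemma horner_alg_prod b (g : {poly k}) : exists r : seq k,
  horner_alg b g = lead_coef g *: \prod_(z <- r) (b - z%:MP).
Proof.
have [r e] := closed_field_poly_normal g; exists r.
rewrite {1}e -mul_polyC rmorphM /= horner_algC rmorph_prod /= alg_mpolyC
  mul_mpolyC; congr (_ *: _); apply: eq_bigr => z _.
by rewrite rmorphB /= horner_algX horner_algC alg_mpolyC.
Qed.

(** [g] splits over the closed field [k], so that [p] divides one linear factor. *)
Lemma prime_dvd_horner (p : {mpoly k[n]}) b (g : {poly k}) : rprime p ->
  g != 0 ->
  rdvd p (horner_alg b g) -> exists z, rdvd p (b - z%:MP).
Proof.
move=> pp g0; have [r ->] := horner_alg_prod b g; rewrite -mul_mpolyC.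
move/(rprime_unit pp) => h; have : rdvd p (\prod_(z <- r) (b - z%:MP)).
  by apply: h; apply/mpoly_unitP; exists (lead_coef g); rewrite ?lead_coef_eq0.
by move/(rprime_prod pp) => [z hz]; exists z.
Qed.

(* Divides a relation by the largest power of [t - l] dividing it. *)
Lemma relation_reduce l D b c (F : {poly {poly k}}) : F != 0 ->
  (size F <= D.+1)%N ->
  \sum_(i < size F) horner_alg t F`_i * b ^+ i * c ^+ (D - i) = 0 ->
  exists F' : {poly {poly k}}, [/\ (size F' <= D.+1)%N,
    \sum_(i < size F') horner_alg t F'`_i * b ^+ i * c ^+ (D - i) = 0 &
    exists i, (F'`_i).[l] != 0].
Proof.
(* Dividing every coefficient by ['X - l%:P] lowers the degree of the leading one. *)
have [m] := ubnP (size (lead_coef F)); elim: m F => // m IH F sF F0 sD e.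
have [ex|/forallNP nex] := pselect (exists i, (F`_i).[l] != 0);
  first by exists F.
have r0 i : (F`_i).[l] = 0 by apply/eqP; have /negP := nex i; rewrite negbK.
have ex i : exists g, F`_i = g * ('X - l%:P).
  by apply/factor_theorem; rewrite rootE r0 eqxx.
have [f hf] := choice ex.
pose F' := \poly_(i < size F) f i.
have X0 : 'X - l%:P != 0 :> {poly k} by rewrite polyXsubC_eq0.
have sF' : size F' = size F.
  rewrite size_poly_eq //; apply: contraNneq F0 => f0.
  by rewrite -lead_coef_eq0 lead_coefE hf f0 mul0r.
have lF : lead_coef F = lead_coef F' * ('X - l%:P).
  rewrite !lead_coefE sF' hf coef_poly prednK ?leqnn //.
  by rewrite lt0n size_poly_eq0.
have F'0 : F' != 0 by rewrite -size_poly_eq0 sF' size_poly_eq0.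
apply: (IH F') => //; last 2 first.
- by rewrite sF'.
- apply: (mulfI (fiber_neq0 l)); rewrite mulr0 -[RHS]e sF' mulr_sumr.
  apply: eq_bigr => i _; rewrite hf coef_poly ltn_ord rmorphM rmorphB /=.
  by rewrite horner_algX horner_algC alg_mpolyC !mulrA; congr (_ * _ * _);
    rewrite mulrC.
move: sF; rewrite lF size_mul ?polyXsubC_eq0 ?lead_coef_eq0 // size_XsubC addn2
  /=.
by rewrite ltnS.
Qed.

(** Induction on the leading monomial. Modulo a prime [t - l], the reduced relation between [b] and
    1 becomes a nonzero polynomial over [k] vanishing at [b], so [t - l] divides some [b - z]. The
    quotient is an invariant with a smaller leading monomial. *)
Lemma qinv_poly b : qinv b -> exists g, b = horner_alg t g.
Proof.
have [l pt] := exists_prime_fiber.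
move: {2}(mlead b) (erefl (mlead b)) => m.
elim/(well_founded_ind (@ltom_wf n)): m b => m IH b eb ib.
have [j [j0 hb ht]] := hom_common ib tinv.
have [D [F [F0 sF e]]] := dep j0 hb (homC j 1) ht.
have [F' [sF' e' [i hi]]] := relation_reduce l F0 sF e.
pose H := map_poly (horner^~ l) F'.
have H0 : H != 0.
  apply: contraNneq hi => /(congr1 (fun q : {poly _} => q`_i)).
  by rewrite coef_map_id0 ?horner0 // coef0 => ->.
have [z [b' hz]] : exists z, rdvd (t - l%:MP) (b - z%:MP).
  apply: prime_dvd_horner pt H0 _.
  have : horner_alg b H - \sum_(i < size F') horner_alg t F'`_i * b ^+ i *
    1%:MP ^+ (D - i) =
      \sum_(i < size F') ((F'`_i).[l]%:MP - horner_alg t F'`_i) * b ^+ i.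
    rewrite /H [map_poly _ _](_ : _ = \poly_(i < size F') (F'`_i).[l]);
      last by [].
    rewrite poly_def linear_sum -sumrB; apply: eq_bigr => i' _.
    rewrite -mul_polyC rmorphM /= horner_algC alg_mpolyC rmorphXn /=
      horner_algX.
    by rewrite expr1n mulr1 mulrBl.
  rewrite e' subr0 => ->; apply: rdvd_sum => i' _; apply: rdvd_mulr.
  have [g' ->] := horner_alg_sub (F'`_i') l.
  by rewrite opprD addrCA subrr addr0; apply/rdvdN/rdvd_mulr/rdvdxx.
have eb' : b = b' * (t - l%:MP) + z%:MP by rewrite -hz subrK.
have [b'0|b'0] := eqVneq b' 0.
  by exists z%:P; rewrite eb' b'0 mul0r add0r horner_algC alg_mpolyC.
have ib' : qinv b'.
  rewrite /qinv -(subr0 0); apply: qhomV (fiber_neq0 l) _ (qinvB tinv (qinvC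
    l)).
  by rewrite -hz; apply: qinvB ib (qinvC z).
have [|g eg] := IH (mlead b') _ b' erefl ib'.
  rewrite -eb.
  have lb : (mlead (b - z%:MP) <= mlead b)%O.
    by apply: le_trans (mleadB_le _ _) _; rewrite leUx lexx mleadC le0x.
  apply: lt_le_trans lb; rewrite hz mleadM ?fiber_neq0 // lead_subC //.
  rewrite -{1}[mlead b']addm0 ltmc_add2r lt_neqAle le0x eq_sym andbT.
  by [].
exists (g * ('X - l%:P) + z%:P); rewrite eb' eg rmorphD rmorphM rmorphB /=.
by rewrite horner_algX !horner_algC !alg_mpolyC.
Qed.

(* If [p] does not divide [c], the relation between [c] and [p] shows that [p]
   divides some [t - z], say [t - z = q * p]; then [q] divides both the
   invariant [c * q] and [t - z]. *)
Lemma prime_rank_one p c v : rprime p -> ~ qinv p -> qhom v p -> qhom v c ->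
  exists g, c = horner_alg t g * p.
Proof.
move=> pp np hp hc; have [p0 pU pP] := pp.
suff [[q cq]|[z [q ez]]] : rdvd p c \/ exists z, rdvd p (t - z%:MP).
- have [g eg] : exists g, q = horner_alg t g.
    by apply: qinv_poly; rewrite /qinv -(subrr v); apply: qhomV p0 _ hp;
      rewrite -cq.
  by exists g; rewrite cq eg.
- have q0 : q != 0 by apply: contraNneq (fiber_neq0 z) => q0;
  rewrite ez q0 mul0r.
  have iz : qinv (t - z%:MP) := qinvB tinv (qinvC z).
  have hq : qhom (- v) q by rewrite -sub0r; apply: qhomV p0 _ hp; rewrite -ez.
  have qU : q \isn't a GRing.unit.
    apply/negP => /mpoly_unitP[x x0 qx]; apply: np.
    have -> : p = x^-1 *: (t - z%:MP) by rewrite ez qx mul_mpolyC scalerA mulVf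
      ?scale1r.
    exact: qinvZ.
  have [g eg] : exists g, c * q = horner_alg t g.
    by apply: qinv_poly; rewrite /qinv -(subrr v); apply: qhomM.
  have [g' eg'] := horner_alg_sub g z.
  have gz : g.[z] = 0.
    apply: unit_dvd_const qU _; rewrite -(addKr ((t - z%:MP) * horner_alg t g')
      g.[z]%:MP) -eg' -eg addrC.
    by apply: rdvdD (rdvd_mull _ (rdvdxx _)) _; rewrite ez;
      apply/rdvdN/rdvd_mulr/rdvd_mulr/rdvdxx.
  exists g'; apply: (mulIf q0); rewrite eg eg' gz mpolyC0 addr0 ez.
  by rewrite mulrC mulrA mulrAC.
have [j [j0 hpj hcj]] := hom_common hp hc; have [i i0 ti] := tinv.
have [||||D [F [F0 sF e]]] := @dep c p t v (j * i) _ _ _ _.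
- by rewrite muln_gt0 j0.
- exact: hom_mul.
- exact: hom_mul.
- by rewrite mulnC; apply: hom_mul.
have sF0 : (0 < size F)%N by rewrite lt0n size_poly_eq0.
(* Dividing by a power of [p] leaves the top power of [c] as the only term without a factor [p]. *)
have e' : \sum_(i < size F) horner_alg t F`_i * c ^+ i * p ^+ ((size F).-1 - i)
  = 0.
  apply: (mulfI (expf_neq0 (D - (size F).-1) p0));
    rewrite mulr0 -[RHS]e mulr_sumr.
  apply: eq_bigr => l _; rewrite mulrCA -exprD addnBA ?subnK //;
    last by rewrite -ltnS prednK.
  by rewrite -ltnS prednK.
have lF0 : F`_(size F).-1 != 0 by rewrite -lead_coefE lead_coef_eq0.
have : rdvd p (horner_alg t F`_(size F).-1 * c ^+ (size F).-1).
  move: e' sF0; case: (size F) => [|d] // e' _.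
  move: e'; rewrite big_ord_recr /= subnn expr0 mulr1 => /eqP.
  rewrite addrC addr_eq0 => /eqP ->; apply/rdvdN/rdvd_sum => l _.
  have -> : (d - l = (d - l).-1.+1)%N by rewrite prednK // subn_gt0.
  by rewrite exprS mulrA; apply/rdvd_mulr/rdvd_mull/rdvdxx.
by case/pP=> [/(prime_dvd_horner pp lF0)|/(rprime_exp pp)]; [right|left].
Qed.

Lemma prime_dvd_gen p v : rprime p -> ~ qinv p -> qhom v p ->
  exists l, rdvd p (tnth y l).
Proof.
move=> pp np hp; have [p0 pU pP] := pp; have [j j0 hpj] := hp.
have [P eP] := ygen p; move: (hpj); rewrite eP => /hom_ym_sum;
  rewrite -eP => ep.
have [m hm] : exists m, forall g, G g -> ch (wt m) g ^+ j = ch v g ^+ j.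
  apply: contrapT => /forallNP ne; case/eqP: p0;
    rewrite ep big1 // => m /asboolP /ne.
  by [].
have hym : qhom v (ym m) by exists j => //; apply: hom_same hm _; apply: hom_ym.
have [g eg] := prime_rank_one pp np hp hym.
have : rdvd p (ym m) by rewrite eg; apply/rdvd_mull/rdvdxx.
by rewrite ymE => /(rprime_prod pp)[l /(rprime_exp pp)]; exists l.
Qed.

Lemma horner_alg_inj g g' : horner_alg t g = horner_alg t g' -> g = g'.
Proof.
move=> /eqP; rewrite -subr_eq0 -rmorphB /= => /eqP e.
apply/eqP; rewrite -subr_eq0; apply/negP => /negP g0.
have [r er] := horner_alg_prod t (g - g').
move: e; rewrite er => /eqP; rewrite scaler_eq0 lead_coef_eq0 (negPf g0) /=.
by apply/negP; rewrite prodf_seq_neq0; apply/allP => z _; rewrite fiber_neq0.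
Qed.

Lemma horner_alg_comp b g g' : horner_alg b (g \Po g') =
  horner_alg (horner_alg b g') g.
Proof.
elim/poly_ind: g => [|q c IH]; first by rewrite comp_poly0 !rmorph0.
rewrite comp_polyD comp_polyM comp_polyX comp_polyC !rmorphD !rmorphM /= IH.
by rewrite !horner_algX !horner_algC.
Qed.

Lemma act_horner f b g : act f (horner_alg b g) = horner_alg (act f b) g.
Proof.
elim/poly_ind: g => [|q c IH]; first by rewrite !rmorph0.
rewrite !rmorphD !rmorphM /= IH !horner_algX !horner_algC !alg_mpolyC.
by rewrite actC.
Qed.

(** [f] and its inverse map k[t] to itself by substitutions whose composite is ['X], so both have
    degree 1. *)
Lemma act_minimal_invariant f : normalizes f ->
  exists c d, act f t = c *: t + d%:MP.
Proof.
move=> nf.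
have [g1 e1] := qinv_poly (act_qinv nf tinv).
have [g2 e2] := qinv_poly (act_qinv (normalizesV nf) tinv).
have : g1 \Po g2 = 'X.
  apply: horner_alg_inj; rewrite horner_algX horner_alg_comp -e2 -act_horner
    -e1.
  by rewrite actK.
move/(congr1 (fun p : {poly k} => (size p).-1)).
rewrite size_comp_poly size_polyX /= => /eqP;
  rewrite muln_eq1 => /andP[/eqP s1 _].
have {s1} s1 : (size g1 <= 2)%N by case: (size g1) s1 => [|[|[|]]].
exists g1`_1, g1`_0; rewrite e1.
have {1}-> : g1 = g1`_1 *: 'X + (g1`_0)%:P.
  apply/polyP => -[|[|i]]; rewrite coefD coefZ coefX coefC ?mulr0 ?add0r ?mulr1
    ?addr0 //.
  by rewrite nth_default // (leq_trans s1).
by rewrite -mul_polyC rmorphD rmorphM /= horner_algX !horner_algC !alg_mpolyC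
  mul_mpolyC.
Qed.

Lemma bounded_degree_t : bounded_degree t.
Proof.
exists (msize t) => f /act_minimal_invariant[a [b ->]].
apply: leq_trans (msizeD_le _ _) _; rewrite geq_max msizeZ_le msizeC.
by apply: leq_trans (leq_b1 _) _; rewrite -mlead_deg // minimal_invariant_neq0.
Qed.

Lemma bounded_degree_inv b : qinv b -> bounded_degree b.
Proof.
move=> /qinv_poly[g ->]; elim/poly_ind: g => [|q c IH].
  by rewrite rmorph0 -mpolyC0; apply: bounded_degreeC.
rewrite rmorphD rmorphM /= horner_algX horner_algC alg_mpolyC.
by apply/bounded_degreeD/bounded_degreeC/bounded_degreeM/bounded_degree_t.
Qed.

Lemma msize_rdvd (p a : {mpoly k[n]}) : a != 0 -> rdvd p a ->
  (msize p <= msize a)%N.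
Proof.
move=> a0 [c e]; have c0 : c != 0 by apply: contraNneq a0 => c0;
  rewrite e c0 mul0r.
have p0 : p != 0 by apply: contraNneq a0 => p0; rewrite e p0 mulr0.
rewrite e msizeM // (mpolySpred _ c0) /=; exact: leq_addl.
Qed.

Lemma bounded_degree_prime p v : rprime p -> qhom v p -> bounded_degree p.
Proof.
move=> pp hp; have [/bounded_degree_inv//|np] := pselect (qinv p).
exists (\sum_l msize (tnth y l))%N => f nf.
have [p0 _ _] := pp; have [j j0 hj] := hp.
have [m hm _] := act_hom nf p0 hj.
have [|||l hl] := @prime_dvd_gen (act f p) (wt m).
- exact: act_prime.
- by move=> /(act_qinv (normalizesV nf)); rewrite actK.
- by exists j.
rewrite (bigD1 l) //=; apply: leq_trans (leq_addr _ _).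
exact: msize_rdvd.
Qed.

Lemma bounded_degree_nonconstant : forall a, bounded_degree a.
Proof.
apply: bounded_degree_gen => l; have [u [r [/mpoly_unitP[c c0 ->] rP e]]] :=
  mpoly_factorial (y0 l).
have hl : hom 1 (M l) (tnth y l) by move=> g Gg; rewrite expg1 expr1;
  apply: yhom.
rewrite e; apply: bounded_degreeM; first exact: bounded_degreeC.
apply: bounded_degree_prod => p pr; have pp := rP p pr.
have [|N [m [N0 _ hm]]] := prime_factor_hom pp _ (y0 l) (ltnSn 0) hl.
  by rewrite e (big_rem p) //=; apply/rdvd_mull/rdvd_mulr/rdvdxx.
by apply: bounded_degree_prime pp _; exists N => //; apply: hm.
Qed.

End NonconstantInvariant.

(** * Bounded degree when all invariants are constant *)

Section ConstantInvariants.
Hypothesis qinv_const : forall b, qinv b -> mlead b = 0%MM.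
Hypothesis ylead : forall l, mlead (tnth y l) != 0%MM.
Implicit Types m : 'X_{1..s}.

Definition eqwt m m' := forall g, G g -> ch (wt m) g = ch (wt m') g.

Lemma mlead_ym m : mlead (ym m) = 0%MM -> m = 0%MM.
Proof.
move=> e; apply/mnmP => i; rewrite mnm0E; apply/eqP; rewrite -leqn0 leqNgt;
  apply/negP => mi.
move: e; rewrite ymE (bigD1 i) //= -(prednK mi) exprS -mulrA mleadM ?y0 //.
  by move/eqP; rewrite mnmD_eq0 (negPf (ylead i)).
by rewrite mulf_neq0 ?expf_neq0 //; apply/prodf_neq0 => j _; apply: expf_neq0.
Qed.

(** Otherwise Dickson's lemma gives two monomials of this weight, one properly dividing the other;
    their quotient is a nonconstant monomial giving an invariant. *)
Lemma eqwt_bounded m0 : exists N, forall m, eqwt m m0 -> (mdeg m <= N)%N.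
Proof.
apply: contrapT => /forallNP h.
have ex N : exists m, eqwt m m0 /\ (N < mdeg m)%N.
  have /existsNP[m /not_implyP[em /negP]] := h N; rewrite -ltnNge => Nm.
  by exists m.
have [g hg] := choice ex; have [phi [inc le]] := dickson g.
have phi_ge i : (i <= phi i)%N by elim: i => // i IH;
  apply: leq_ltn_trans IH (inc i).
(* [g N] has degree more than [N] and [i <= phi i], so the index [mdeg a] makes [b] of larger degree
   than [a]. *)
set a := g (phi 0); set b := g (phi (mdeg a)).
have ab : (a <= b)%MM by apply: le.
have lt : (mdeg a < mdeg b)%N by apply: leq_ltn_trans (phi_ge _) (proj2 (hg _)).
have e : b = (b - a + a)%MM by rewrite submK.
have /qinv_const/mlead_ym ba0 : qinv (ym (b - a)%MM).
  exists 1%N => //; apply: hom_same (hom_ym 1 _) => f Gf; rewrite !expr1 ch0 //.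
  apply: (mulIf (ch_neq0 (wt a) Gf)); rewrite mul1r -chD // -wtD -e.
  by rewrite (proj1 (hg _)) // (proj1 (hg _)).
by move: lt; rewrite e ba0 add0m ltnn.
Qed.

(* The weight of [y_l] is not the product of two weights of nonconstant
   homogeneous polynomials. *)
Definition atom l := forall m, eqwt m U_(l)%MM -> (mdeg m <= 1)%N.

(** Take [m] of maximal degree in its weight: a variable of [m] that is not an atom could be
    replaced by a monomial of the same weight and larger degree. *)
Lemma atomic_decomposition l : exists m, eqwt m U_(l)%MM /\ forall i,
  (0 < m i)%N -> atom i.
Proof.
have [N hN] := eqwt_bounded U_(l)%MM.
pose P d := `[< exists2 m, eqwt m U_(l)%MM & mdeg m = d >].
have exP : exists d, P d by exists 1%N; apply/asboolP; exists U_(l)%MM => //;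
  apply: mdeg1.
have bP d : P d -> (d <= N)%N by move=> /asboolP[m em <-]; apply: hN.
case: (ex_maxnP exP bP) => d /asboolP[m em <-] dmax.
exists m; split=> // i mi m' em'.
have e : m = (m - U_(i) + U_(i))%MM by rewrite submK // lep1mP -lt0n.
have : (mdeg (m - U_(i) + m')%MM <= mdeg m)%N.
  apply: dmax; apply/asboolP; exists (m - U_(i) + m')%MM => // g Gg.
  by rewrite -em // [in RHS]e !wtD !chD // em'.
by rewrite {2}e !mdegD leq_add2l mdeg1.
Qed.

(** The degree is positive because a constant image would make [tnth y l] constant. *)
Lemma act_gen_wt f l : normalizes f -> exists m, (0 < mdeg m)%N /\
  forall g, G g -> ch (wt m) g = ch (M l) (f * g * f^-1)%g.
Proof.
move=> nf; have hl : hom 1 (M l) (tnth y l) by move=> g Gg;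
  rewrite expg1 expr1; apply: yhom.
have [m hm e] := act_hom nf (y0 l) hl; exists m; split; last first.
  by move=> g Gg; have := e _ Gg; rewrite !expr1.
rewrite lt0n mdeg_eq0; apply: contraTneq isT => m0.
have /qinv_const/lead_const : qinv (act f (tnth y l)) by exists 1%N => //;
  rewrite -wt_0 -m0.
move=> /(congr1 (act f^-1%g)); rewrite actK actC => e'.
by have := ylead l; rewrite e' mleadC eqxx.
Qed.

Definition mnm_ext (mu : 'I_s -> 'X_{1..s}) m : 'X_{1..s} :=
  (\sum_i mu i *+ m i)%MM.

Lemma ch_mnm_ext f mu : normalizes f ->
  (forall l g, G g -> ch (wt (mu l)) g = ch (M l) (f * g * f^-1)%g) ->
  forall m g, G g -> ch (wt (mnm_ext mu m)) g = ch (wt m) (f * g * f^-1)%g.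
Proof.
move=> nf h m g Gg; have [Gfg _] := nf g Gg.
rewrite /mnm_ext (big_morph wt wtD wt_0) ch_sum // ch_sum //;
  apply: eq_bigr => i _.
by rewrite wtMn !chMn // h.
Qed.

Lemma mdeg_mnm_ext mu m : (forall l, 0 < mdeg (mu l))%N ->
  (mdeg m <= mdeg (mnm_ext mu m))%N.
Proof.
move=> h; rewrite mdeg_sum mdegE; apply: leq_sum => i _; rewrite mdegMn.
exact: leq_pmull.
Qed.

Lemma mdeg_mnm_ext_le mu m : (forall l, 0 < m l -> mdeg (mu l) <= 1)%N ->
  (mdeg (mnm_ext mu m) <= mdeg m)%N.
Proof.
move=> h; rewrite mdeg_sum [leqRHS]mdegE; apply: leq_sum => i _; rewrite mdegMn.
case: (posnP (m i)) => [->|/h mi]; first by rewrite muln0.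
by rewrite -[leqRHS]mul1n leq_mul2r mi orbT.
Qed.

(** Transport by the inverse of [f] does not lower the degree of [m] and brings it back to the
    weight of the atom [l], where degrees are at most 1. *)
Lemma act_atom f l m : normalizes f -> atom l ->
  (forall g, G g -> ch (wt m) g = ch (M l) (f * g * f^-1)%g) -> (mdeg m <= 1)%N.
Proof.
move=> nf al hm; have nf' := normalizesV nf.
have [mu hmu] := choice (fun l => act_gen_wt l nf').
apply: leq_trans (al (mnm_ext mu m) _); first by apply: mdeg_mnm_ext => i;
  have [] := hmu i.
move=> g Gg; rewrite (ch_mnm_ext nf') // => [|i]; last by have [] := hmu i.
have [Gg' _] := nf' g Gg.
by rewrite wt1 hm // invgK !mulgA mulgV mul1g mulgK.
Qed.

(** The weight of [y_l] is a sum of atoms, and [f] sends it to the weight of a monomial [m1] no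
    longer than this sum. As [m1] depends on [f], the bound is the maximum over all monomials of
    degree at most [mdeg m0]. *)
Lemma bounded_degree_constant : forall a, bounded_degree a.
Proof.
apply: bounded_degree_gen => l; have [m0 [em0 atoms]] := atomic_decomposition l.
have [B hB] := choice eqwt_bounded.
pose N1 := (\max_(m : 'X_{1..s < (mdeg m0).+1}) B m)%N.
exists (\max_(m : 'X_{1..s < N1.+1}) msize (ym m))%N => f nf.
have [mu hmu] := choice (fun l => act_gen_wt l nf).
set m1 := mnm_ext mu m0.
have hmu2 i g : G g -> ch (wt (mu i)) g =
  ch (M i) (f * g * f^-1)%g by have [_] := hmu i; apply.
have m1_le : (mdeg m1 <= mdeg m0)%N.
  apply: mdeg_mnm_ext_le => i /atoms ai; exact: act_atom nf ai (hmu2 i).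
have hl : hom 1 (M l) (tnth y l) by move=> g Gg; rewrite expg1 expr1;
  apply: yhom.
have [m hm e] := act_hom nf (y0 l) hl.
have emm1 : eqwt m m1.
  move=> g Gg; have [Gfg _] := nf g Gg; have := e g Gg; rewrite !expr1 => ->.
  by rewrite (ch_mnm_ext nf hmu2) // em0 // wt1.
have [P eP] := ygen (act f (tnth y l)).
move: hm; rewrite eP => /hom_ym_sum ->.
apply: leq_trans (msize_sum _ _ _) _; apply/bigmax_leqP_seq => m2 _ /asboolP h2.
apply: leq_trans (msizeZ_le _ _) _.
have b2 : (mdeg m2 <= N1)%N.
  have b1 : (mdeg m2 <= B m1)%N.
    by apply: hB => g Gg; rewrite -emm1 //; have := h2 g Gg; rewrite !expr1.
  apply: leq_trans b1 _.
  have lt1 : (mdeg m1 < (mdeg m0).+1)%N by [].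
  exact: (leq_bigmax (BMultinom lt1)).
have lt2 : (mdeg m2 < N1.+1)%N by [].
exact: (leq_bigmax (F := fun m : 'X_{1..s < N1.+1} =>
  msize (ym m)) (BMultinom lt2)).
Qed.

End ConstantInvariants.

Theorem normalizer_bounded :
  (forall a c t v j, (0 < j)%N -> hom j v a -> hom j v c -> hom j 0 t ->
     exists D (F : {poly {poly k}}), [/\ F != 0, (size F <= D.+1)%N &
       \sum_(i < size F) horner_alg t F`_i * a ^+ i * c ^+ (D - i) = 0]) ->
  (forall l, mlead (tnth y l) != 0%MM) -> forall a, bounded_degree a.
Proof.
move=> dep ylead.
have [[b ib lb]|h] := pselect (exists2 b, qinv b & mlead b != 0%MM); last first.
  apply: bounded_degree_constant => // b ib; apply/eqP/negP => /negP lb.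
  by apply: h; exists b.
(* Well-foundedness of the monomial order provides a nonconstant invariant with minimal leading
   monomial. *)
move: {2}(mlead b) (erefl (mlead b)) => m.
elim/(well_founded_ind (@ltom_wf n)): m b ib lb => m IH b ib lb e.
have [[b' ib' [lb' lt]]|h] := pselect (exists2 b', qinv b' &
  mlead b' != 0%MM /\ (mlead b' < m)%O).
  exact: IH lt b' ib' lb' erefl.
apply: (bounded_degree_nonconstant dep ib lb) => b' ib' lb'; rewrite leNgt;
  apply/negP => lt.
by apply: h; exists b' => //; split=> //; rewrite -e.
Qed.

End Grading.

(** * Extension of characters and Krull dimension *)

Section LinearSystem.
Import Order.TTheory GRing.Theory.
Local Open Scope ring_scope.

Lemma linear_system (k : fieldType) (I J : finType) (A : I -> J -> k) :
  (#|J| < #|I|)%N -> exists2 c : I -> k, (exists i, c i != 0) &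
    forall j, \sum_i c i * A i j = 0.
Proof.
move=> JI; pose B : 'M[k]_(#|I|, #|J|) :=
  \matrix_(i, j) A (enum_val i) (enum_val j).
have K0 : kermx B != 0.
  rewrite kermx_eq0 -row_leq_rank -ltnNge; apply: leq_ltn_trans JI;
    exact: rank_leq_col.
have [i hi] : exists i, row i (kermx B) != 0.
  apply: contrapT => /forallNP h; case/eqP: K0; apply/row_matrixP => i.
  by rewrite row0; apply/eqP; have /negP := h i; rewrite negbK.
have [l hl] : exists l, row i (kermx B) 0 l != 0.
  apply: contrapT => /forallNP h; case/eqP: hi; apply/rowP => l.
  by rewrite [RHS]mxE; apply/eqP; have /negP := h l; rewrite negbK.
exists (fun x => row i (kermx B) 0 (enum_rank x)).
  by exists (enum_val l); rewrite enum_valK.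
move=> j; have := mulmx_ker B => /(congr1 (fun X => row i X)).
rewrite row_mul row0 => /rowP/(_ (enum_rank j)); rewrite mxE [RHS]mxE => e.
rewrite -[RHS]e (reindex (@enum_val I I)) /=; last by apply: onW_bij;
  apply: enum_val_bij.
by apply: eq_bigr => x _; rewrite enum_valK /B !mxE enum_rankK.
Qed.

End LinearSystem.

(** * Extension of homomorphisms to the units of a closed field *)

Section GraphExtension.
Import Order.TTheory GRing.Theory Num.Theory.
Local Open Scope ring_scope.
Variables (k : closedFieldType) (Z : zmodType).
Implicit Types (R : Z -> k -> Prop).

(* The graph of a homomorphism from a subgroup of [Z] to the units of [k]. *)
Definition char_graph R := [/\ R 0 1,
  forall v w a b, R v a -> R w b -> R (v + w) (a * b),
  forall v a, R v a -> R (- v) a^-1,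
  forall v a, R v a -> a != 0 & forall a, R 0 a -> a = 1].

Lemma char_graphMz R v a (z : int) : char_graph R -> R v a ->
  R (v *~ z) (a ^ z).
Proof.
move=> [R0 RD RN Rn _] Ra.
have RM m : R (v *+ m) (a ^+ m).
  by elim: m => [|m IH]; rewrite ?mulr0n ?expr0 // mulrS exprS; apply: RD.
case: z => m; first exact: RM.
by rewrite NegzE mulrNz -invr_expz; apply/RN/RM.
Qed.

Lemma char_graph_fun R v a b : char_graph R -> R v a -> R v b -> a = b.
Proof.
move=> [R0 RD RN Rn Rf] Ra Rb; have := RD _ _ _ _ Ra (RN _ _ Rb).
by rewrite subrr => /Rf e; rewrite -[LHS](mulfVK (Rn _ _ Rb)) e mul1r.
Qed.

(** Compatibility with the values already taken at multiples of [e] is what makes the extended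
    relation single-valued. *)
Lemma char_graph_adjoin R (e : Z) (z : k) : char_graph R -> z != 0 ->
  (forall m : int, forall a, R (e *~ m) a -> a = z ^ m) ->
  char_graph (fun v a => exists w b (m : int), [/\ R w b, v = w + e *~ m &
    a = b * z ^ m]).
Proof.
move=> [R0 RD RN Rn Rf] z0 ze; split.
- by exists 0, 1, 0; rewrite mulr0z addr0 expr0z mulr1.
- move=> _ _ _ _ [w [b [m [Rb -> ->]]]] [w' [b' [m' [Rb' -> ->]]]].
  exists (w + w'), (b * b'), (m + m'); split; first exact: RD.
    by rewrite mulrzDr addrACA.
  by rewrite expfzDr // mulrACA.
- move=> _ _ [w [b [m [Rb -> ->]]]]; exists (- w), b^-1, (- m); split;
  first exact: RN.
    by rewrite mulrNz opprD.
  by rewrite invfM invr_expz.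
- by move=> _ _ [w [b [m [Rb _ ->]]]];
  rewrite mulf_neq0 ?expfz_neq0 // (Rn _ _ Rb).
move=> _ [w [b [m [Rb /esym/eqP + ->]]]]; rewrite addrC addr_eq0 => /eqP em.
have := ze (- m) b; rewrite mulrNz em opprK => /(_ Rb) ->.
by rewrite -expfzDr // addNr expr0z.
Qed.

(** The value at [e] is a root of the value at its least positive multiple in the domain, and it
    exists because [k] is closed; if there is no such multiple, 1 will do. *)
Lemma char_graph_step R (e : Z) : char_graph R -> exists R', [/\ char_graph R',
  (forall v a, R v a -> R' v a) & exists z, R' e z].
Proof.
move=> gR; have [R0 RD RN Rn Rf] := gR.
suff [z z0 ze] : exists2 z : k, z != 0 &
  forall m : int, forall a, R (e *~ m) a -> a = z ^ m.
  eexists; split; first exact: char_graph_adjoin gR z0 ze.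
    by move=> v a Ra; exists v, a, 0; rewrite mulr0z addr0 expr0z mulr1.
  by exists z, 0, 1, 1; rewrite mulr1z add0r mul1r expr1z.
have [[m0 m00 [a0 Ra0]]|none] := pselect (exists2 m : nat, (0 < m)%N &
  exists a, R (e *+ m) a); last first.
  exists 1; first exact: oner_neq0.
  move=> m a Ra; rewrite exp1rz; have [m0|m0] := eqVneq m 0.
    by apply: Rf; move: Ra; rewrite m0 mulr0z.
  case: none; exists `|m|%N; first by rewrite absz_gt0.
  case: (intP m) m0 Ra => // p _ Ra; first by exists a.
  by exists a^-1; rewrite abszN; move: (RN _ _ Ra); rewrite mulrNz opprK.
pose P m := (0 < m)%N && `[< exists a, R (e *+ m) a >].
have exP : exists m, P m by exists m0; rewrite /P m00; apply/asboolP; exists a0.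
case: (ex_minnP exP) => c /andP[c0 /asboolP[w Rw]] cmin.
have [z zc] : exists z : k, z ^+ c = w.
  have : size ('X^c - w%:P) != 1%N by rewrite size_XnsubC // eqSS -lt0n.
  move/closed_rootP => [z]; rewrite /root !hornerE subr_eq0 => /eqP <-.
  by exists z.
have z0 : z != 0.
  by apply: contraNneq (Rn _ _ Rw) => z0; rewrite -zc z0 expr0n eqn0Ngt c0.
(* A nonzero remainder of [m] modulo [c] would be a smaller positive multiple of [e] in the
   domain. *)
exists z => // m a Ra; have := divz_eq m c.
have mc : (0 <= (m %% c)%Z) by rewrite modz_ge0 // -lt0n.
have mc' : ((m %% c)%Z < c) by rewrite ltz_pmod.
case er : (m %% c)%Z mc mc' => [p|p] // _ pc em.
have p0 : p = 0%N.
  apply/eqP; rewrite -leqn0 leqNgt; apply/negP => p0.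
  have : (c <= p)%N.
    apply: cmin; rewrite /P p0; apply/asboolP.
    exists (a * (w ^ (m %/ c)%Z)^-1).
    have -> : e *+ p = e *~ m + - ((e *+ c) *~ (m %/ c)%Z).
      rewrite {1}em mulrzDr [e *+ c]pmulrn -mulrzA [_ * (m %/ c)%Z]mulrC.
      by rewrite addrAC subrr add0r.
    by apply: RD Ra (RN _ _ (char_graphMz _ gR Rw)).
  by rewrite leqNgt -ltz_nat pc.
apply: (char_graph_fun gR Ra).
rewrite em p0 addr0 mulrC mulrzA -exprz_exp -exprnP zc.
by have := char_graphMz (m %/ c)%Z gR Rw; rewrite pmulrn.
Qed.

Lemma char_graph_extend R (es : seq Z) : char_graph R ->
  exists R', [/\ char_graph R',
  (forall v a, R v a -> R' v a) & forall e, e \in es -> exists z, R' e z].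
Proof.
move=> gR; elim: es => [|e es [R1 [g1 s1 d1]]]; first by exists R.
have [R2 [g2 s2 d2]] := char_graph_step e g1.
exists R2; split=> // [v a /s1/s2//|f];
  rewrite inE => /predU1P[->//|/d1[z /s2 h]].
by exists z.
Qed.

End GraphExtension.

(** * Independent functions from chains of closed sets *)

Section KrullDimension.
Import Order.TTheory GRing.Theory.
Local Open Scope ring_scope.
Local Open Scope classical_set_scope.
Variables (k : fieldType) (m : nat).

Definition alg_indep_on (Z : set 'rV[k]_m) i (q : 'I_i -> {mpoly k[m]}) :=
  forall F : {mpoly k[i]}, F != 0 ->
    exists2 x, Z x & F.@[fun j => (q j).@[fun l => x 0 l]] != 0.

Lemma zclosed_zeros (p : {mpoly k[m]}) :
  zclosed [set x : 'rV[k]_m | p.@[fun l => x 0 l] = 0].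
Proof.
exists [set p]; apply/seteqP; split => x /=; first by move=> h _ ->.
by apply.
Qed.

(** View [F] as a polynomial in the last variable. If its constant term is nonzero, [F] is nonzero
    at a point of [Y], where [q0] vanishes. Otherwise a factor [q0] splits off, and irreducibility
    of [Z] allows both factors to be nonzero at one point. *)
Lemma alg_indep_on_adjoin (Y Z : set 'rV[k]_m) i (q : 'I_i ->
  {mpoly k[m]}) (q0 : {mpoly k[m]}) :
  zirreducible Z -> Y `<=` Z -> alg_indep_on Y q ->
  (forall x, Y x -> q0.@[fun l => x 0 l] = 0) ->
  ~ (forall x, Z x -> q0.@[fun l => x 0 l] = 0) ->
  alg_indep_on Z (fun j => if unlift ord_max j is Some j' then q j' else q0).
Proof.
move=> [_ irrZ] YZ hq q0Y q0Z F F0.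
pose q1 := fun j : 'I_i.+1 => if unlift ord_max j is Some j' then q j' else q0.
rewrite -/q1.
have evE (P : {poly {mpoly k[i]}}) x :
    (mmultim P).@[fun j => (q1 j).@[fun l => x 0 l]] =
    (map_poly (meval (fun j => (q j).@[fun l => x 0 l])) P).[q0.@[fun l =>
      x 0 l]].
  rewrite meval_muni mmultimK /q1 unlift_none; congr (_.[_]).
  apply/polyP => l; rewrite !coef_map /=; apply: meval_eq => j.
  have -> : widen_ord (leqnSn i) j = lift ord_max j.
    by apply/val_inj; rewrite /= /bump leqNgt ltn_ord.
  by rewrite liftK.
rewrite -(muniK F); have P0 : muni F != 0.
  by apply: contraNneq F0 => e; rewrite -(muniK F) e rmorph0.
move: (muni F) P0 => {F F0} P; elim/poly_ind: P => [|P c IH];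
  first by rewrite eqxx.
move=> P0; have [c0|c0] := eqVneq c 0; last first.
  have [x Yx hx] := hq _ c0; exists x; first exact: YZ.
  by rewrite evE rmorphD rmorphM /= map_polyX map_polyC !hornerE q0Y // mulr0
    add0r.
move: P0; rewrite c0 addr0 mulf_eq0 negb_or => /andP[/IH[x1 Zx1 hx1] _].
apply: contrapT => ne; pose R := mmultim P \mPo [tuple q1 j | j < i.+1].
have RE x : R.@[fun l => x 0 l] = (mmultim P).@[fun j => (q1 j).@[fun l =>
  x 0 l]].
  by rewrite comp_mpoly_meval; apply: meval_eq => j; rewrite tnth_mktuple.
have [|h|h] := irrZ _ _ (zclosed_zeros q0) (zclosed_zeros R).
- move=> x Zx; apply: contrapT => /not_orP[/= h0 hR]; apply: ne; exists x => //.
  by rewrite rmorphM /= mevalM mmultimX mevalXU -RE mulf_neq0 //;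
    [exact/eqP|rewrite /q1 unlift_none; exact/eqP].
- by apply: q0Z => x /h.
- by have := h x1 Zx1; rewrite /= RE => /eqP; rewrite (negPf hx1).
Qed.

(** Each strict inclusion contributes an equation of the smaller set that is not satisfied on the
    larger one. *)
Lemma chain_alg_indep (Z : set 'rV[k]_m) d c : irreducible_chain Z d c ->
  exists q : 'I_d -> {mpoly k[m]}, alg_indep_on Z q.
Proof.
move=> [hc inc]; suff H i : (i <= d)%N -> exists q : 'I_i ->
  {mpoly k[m]}, alg_indep_on (c i) q.
  have [q hq] := H d (leqnn d); exists q => F /hq[x cx hx]; exists x => //.
  by have [_ _] := hc d (leqnn d); apply.
elim: i => [_|i IH id].
  exists (fun=> 0) => F F0; have [_ [[x cx] _] _] := hc 0 (leq0n d);
    exists x => //.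
  by move: F0; rewrite (nvar0_mpolyC F) mevalC mpolyC_eq0.
have [q hq] := IH (ltnW id); have [[S eS] _ _] := hc i (ltnW id).
have [_ irr _] := hc _ id; have [sub ni] := inc i id.
have [p [Sp np]] : exists p, S p /\ ~ (forall x, c i.+1 x ->
  p.@[fun l => x 0 l] = 0).
  apply: contrapT => /forallNP h; apply: ni; rewrite eS => x cx p Sp.
  have /not_andP[//|/contrapT] := h p; exact.
eexists; apply: alg_indep_on_adjoin irr sub hq _ np.
by move=> x; rewrite eS; apply.
Qed.

End KrullDimension.

(** * Algebraic dependence of polynomials of the same weight *)

Section Counting.
Import Order.TTheory GRing.Theory.
Local Open Scope ring_scope.

Lemma sum_by_key (V : nmodType) (I K : eqType) (s : seq I) (key : I ->
  K) (F : I -> V) :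
  \sum_(x <- s) F x =
  \sum_(c <- undup [seq key x | x <- s]) \sum_(x <- s | key x == c) F x.
Proof.
rewrite (exchange_big_dep xpredT) //= big_seq [RHS]big_seq;
  apply: eq_bigr => x xs.
rewrite big_mkcond (bigD1_seq (key x)) ?undup_uniq ?mem_undup ?map_f //= eqxx.
by rewrite big1 ?addr0 // => c; rewrite eq_sym => /negPf ->.
Qed.

Section Degree.
Variables (k : fieldType) (n : nat).
Implicit Types p q : {mpoly k[n]}.

Definition mdg p := (msize p).-1.

Lemma mdgM p q : (mdg (p * q) <= mdg p + mdg q)%N.
Proof.
have [->|p0] := eqVneq p 0; first by rewrite mul0r /mdg msize0.
have [->|q0] := eqVneq q 0; first by rewrite mulr0 /mdg msize0.
by rewrite /mdg msizeM // (mpolySpred _ p0) (mpolySpred _ q0) /= addnS.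
Qed.

Lemma mdgX p i : (mdg (p ^+ i) <= i * mdg p)%N.
Proof.
elim: i => [|i IH]; first by rewrite expr0 /mdg msize1.
by rewrite exprS mulSn; apply: leq_trans (mdgM _ _) _; rewrite leq_add2l.
Qed.

Lemma mdg_prod (I : Type) (r : seq I) (F : I -> {mpoly k[n]}) :
  (mdg (\prod_(i <- r) F i) <= \sum_(i <- r) mdg (F i))%N.
Proof.
elim: r => [|i r IH]; first by rewrite !big_nil /mdg msize1.
by rewrite !big_cons; apply: leq_trans (mdgM _ _) _; rewrite leq_add2l.
Qed.

Lemma mdeg_msupp p m : m \in msupp p -> (mdeg m <= mdg p)%N.
Proof.
move=> mp; have := msize_mdeg_lt mp; rewrite /mdg.
by case: (msize p).
Qed.

End Degree.

(** The left-hand side will count equations and the right-hand side unknowns. Since [n <= d.+1], the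
    former is at most [N * N.+1 ^ d.+1] for [N := A * C.+1 ^ n]. *)
Lemma exponent_exists (A C n d : nat) : (n <= d.+1)%N ->
  exists N, (A * (N.+1 * C).+1 ^ n < N.+1 ^ d * (N.+1 * N.+1))%N.
Proof.
move=> nd; pose N := (A * C.+1 ^ n)%N; exists N.
have le1 : ((N.+1 * C).+1 <= N.+1 * C.+1)%N by rewrite mulnS addSn ltnS
  leq_addl.
apply: (@leq_ltn_trans (A * (N.+1 * C.+1) ^ n)%N).
  rewrite leq_mul2l; apply/orP; right.
  by case: (n) => // n'; rewrite leq_exp2r.
rewrite expnMn mulnCA mulnC -/N; have e1 :
  (N.+1 ^ n <= N.+1 ^ d.+1)%N by rewrite leq_pexp2l.
apply: (@leq_ltn_trans (N * N.+1 ^ d.+1)%N); first by rewrite leq_mul2l e1 orbT.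
rewrite expnS mulnA mulnC ltn_pmul2l ?expn_gt0 // ltn_pmul2r //.
Qed.

Variables (k : closedFieldType) (n : nat) (G : set (polyAut k n)).
Variables (L : zmodType) (ch : L -> polyAut k n -> k).
Variables (s : nat) (y : polymap k n s) (M : 'I_s -> L).
Hypothesis G1 : G 1%g.
Hypothesis GM : forall g h, G g -> G h -> G (g * h)%g.
Hypothesis ch0 : forall g, G g -> ch 0 g = 1.
Hypothesis chD : forall v w g, G g -> ch (v + w) g = ch v g * ch w g.
Hypothesis chM : forall v g h, G g -> G h -> ch v (g * h)%g = ch v g * ch v h.
Hypothesis y0 : forall j, tnth y j != 0.
Hypothesis yhom : forall j g, G g -> act g (tnth y j) = ch (M j) g *: tnth y j.

Local Notation hom := (hom G ch).
Local Notation wt := (wt M).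
Local Notation ym := (ym y).

Lemma monomials_indep N (t a c : {mpoly k[n]}) (e : 'I_N.+1 -> 'I_N.+1 -> k) :
  (forall F : {poly {poly k}}, F != 0 -> (size F <= N.+2)%N ->
    \sum_(i < size F) horner_alg t F`_i * a ^+ i * c ^+ (N.+1 - i) <> 0) ->
  \sum_i \sum_l e i l *: (t ^+ l * a ^+ i * c ^+ (N.+1 - i)) = 0 ->
  forall i l, e i l = 0.
Proof.
move=> h e0; pose f i := \poly_(l < N.+1) e (inord i) (inord l).
pose F : {poly {poly k}} := \poly_(i < N.+1) f i.
have sF : (size F <= N.+1)%N := size_poly _ _.
have F0 : F = 0.
  apply/eqP; apply: contraT => F0; case: (h F F0 (leqW sF)).
  rewrite (big_ord_widen N.+1 (fun i =>
    horner_alg t F`_i * a ^+ i * c ^+ (N.+1 - i))) //.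
  rewrite big_mkcond -[RHS]e0; apply: eq_bigr => i _ /=.
  transitivity (horner_alg t F`_i * a ^+ i * c ^+ (N.+1 - i)).
    by case: ltnP => // /(nth_default 0) ->; rewrite rmorph0 !mul0r.
  rewrite coef_poly ltn_ord /f poly_def rmorph_sum !mulr_suml;
    apply: eq_bigr => l _ /=.
  rewrite -mul_polyC rmorphM /= horner_algC alg_mpolyC rmorphXn /= horner_algX
    !inord_val.
  by rewrite mul_mpolyC -!scalerAl.
move=> i l; have := congr1 (fun q : {poly {poly k}} => (q`_i)`_l) F0.
by rewrite /= coef_poly ltn_ord coef_poly ltn_ord !inord_val !coef0.
Qed.

Lemma sum_key_eq0 (V : lmodType k) (I K : eqType) (r : seq I) (key : I ->
  K) (b : I -> V) (h : K -> k) :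
  (forall c, \sum_(x <- r | key x == c) b x = 0) ->
    \sum_(x <- r) h (key x) *: b x = 0.
Proof.
move=> e; rewrite (sum_by_key _ key) big1_seq // => c _.
under eq_bigr => x /eqP -> do over.
by rewrite -scaler_sumr e scaler0.
Qed.

Section Relation.
Variables (j : nat) (j0 : (0 < j)%N).

(** Homogeneity modulo torsion sees only [j]-th powers of characters, so the quotient and the
    remainder of the exponents by [j] are treated apart. *)
Definition mrem (m : 'X_{1..s}) : {ffun 'I_s ->
  'I_j} := [ffun i => Ordinal (ltn_pmod (m i) j0)].
Definition mquo (m : 'X_{1..s}) : 'X_{1..s} := [multinom m i %/ j | i < s].
Definition mremv (r : {ffun 'I_s -> 'I_j}) : 'X_{1..s} :=
  [multinom nat_of_ord (r i) | i < s].

Lemma mrem_mquo m : m = (mquo m *+ j + mremv (mrem m))%MM.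
Proof. by apply/mnmP => i; rewrite mnmDE mulmnE !mnmE ffunE /= -divn_eq. Qed.

Lemma mdeg_mquo m : (mdeg (mquo m) <= mdeg m)%N.
Proof. by rewrite !mdegE; apply: leq_sum => i _; rewrite mnmE leq_div. Qed.

Variable B : nat.

Definition eqj (q q' : 'X_{1..s}) := `[< forall g, G g ->
  ch (wt q) g ^+ j = ch (wt q') g ^+ j >].

(* Representative of the class of [q] for [eqj]. *)
Definition can (q : 'X_{1..s}) : 'X_{1..s} :=
  if [pick q' : 'X_{1..s < B.+1} | eqj q q'] is Some q' then q' else q.

Lemma eqjP q q' : reflect (forall g, G g ->
  ch (wt q) g ^+ j = ch (wt q') g ^+ j) (eqj q q').
Proof. exact: asboolP. Qed.

Lemma canP q : eqj q (can q).
Proof. by rewrite /can; case: pickP => // _; apply/eqjP. Qed.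

Lemma mdeg_can q : (mdeg q <= B)%N -> (mdeg (can q) <= B)%N.
Proof. by rewrite /can; case: pickP => // q' _ _; rewrite -ltnS bmdeg. Qed.

Lemma can_eq q q' : (mdeg q <= B)%N -> eqj q q' -> can q = can q'.
Proof.
move=> qB /eqjP e; rewrite /can; have qB' : (mdeg q < B.+1)%N by [].
have ee : (fun x : 'X_{1..s < B.+1} => eqj q x) =1 (fun x => eqj q' x).
  by move=> x; apply/eqjP/eqjP => h g Gg; rewrite -h // e.
rewrite (eq_pick ee); case: pickP => // none.
by have := none (BMultinom qB'); rewrite /= => /eqjP []; move=> g Gg; rewrite e.
Qed.

Lemma ch_split m g : G g ->
  ch (wt m) g = ch (wt (mremv (mrem m))) g * ch (wt (can (mquo m))) g ^+ j.
Proof.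
move=> Gg; rewrite {1}(mrem_mquo m) wtD wtMn chD // (chMn ch0 chD) // mulrC.
by have /eqjP -> := canP (mquo m).
Qed.

End Relation.

(* Were the [t ^ l * a ^ i * c ^ (N - i)] independent, their products with the
   monomials in the [phi i] of degrees at most [N] would give [N ^ (d + 2)]
   independent elements in a space of dimension [O(N ^ n)].  The factor
   [j ^ s] comes from writing the exponents of the monomials in the weights
   modulo [j]. *)
Lemma homogeneous_dependence d (E : nat) (Gam : 'I_d -> {mpoly k[s]})
    (phi : 'I_d -> polyAut k n -> k) :
  (n <= d.+1)%N ->
  (forall i g, G g -> (\prod_j ch (M j) g) ^+ E * phi i g = (Gam i).@[fun j =>
    ch (M j) g]) ->
  (forall F : {mpoly k[d]}, F != 0 ->
    exists2 g, G g & F.@[fun i => phi i g] != 0) ->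
  forall a c t v j, (0 < j)%N -> hom j v a -> hom j v c -> hom j 0 t ->
    exists D (F : {poly {poly k}}), [/\ F != 0, (size F <= D.+1)%N &
      \sum_(i < size F) horner_alg t F`_i * a ^+ i * c ^+ (D - i) = 0].
Proof.
move=> nd hGam hphi a c t v j j0 ha hc ht; apply: contrapT => no.
pose C1 := (E * d * s + \sum_i mdg (Gam i))%N.
pose Y := (\sum_l mdg (tnth y l))%N.
pose C2 := (C1 * Y + (mdg t + mdg a + mdg c))%N.
have [N hN] := exponent_exists (j ^ s) C2 nd.
pose B := (N.+1 * C1)%N; pose Kd := (N.+1 * C2)%N.
pose al := {ffun 'I_d -> 'I_N.+1}.
(* Represents the monomial [x] in the [phi i]; the first factor brings all of them to the same
   denominator, so that linear combinations can be compared, see [ch_Ga]. *)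
pose Ga (x : al) : {mpoly k[s]} :=
  (\prod_l 'X_l) ^+ (E * (d * N.+1 - \sum_i x i)) * \prod_i Gam i ^+ x i.
pose Z (i l : nat) := t ^+ l * a ^+ i * c ^+ (N.+1 - i).
have Zindep := @monomials_indep N t a c _ (fun F F0 sF e =>
  no (ex_intro _ N.+1 (ex_intro _ F (And3 F0 sF e)))).
have sumx (x : al) : (\sum_i x i <= d * N.+1)%N.
  apply: (@leq_trans (\sum_(i < d) N.+1));
    last by rewrite sum_nat_const card_ord.
  by apply: leq_sum => i _; apply: ltnW.
have Gam_deg x m : m \in msupp (Ga x) -> (mdeg m <= B)%N.
  move=> /mdeg_msupp h; apply: leq_trans h _; apply: leq_trans (mdgM _ _) _.
  rewrite /B /C1 mulnDr; apply: leq_add.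
    have h1 : (mdg (\prod_l ('X_l : {mpoly k[s]})) <= s)%N.
      apply: leq_trans (mdg_prod _ _) _; rewrite (eq_bigr (fun=> 1%N)).
        by rewrite sum_nat_const card_ord muln1.
      by move=> l _; rewrite /mdg msizeX mdeg1.
    apply: leq_trans (mdgX _ _) _.
    apply: leq_trans (leq_mul (leq_mul (leqnn E) (leq_subr _ _)) h1) _.
    by rewrite !mulnA [(E * d * N.+1)%N]mulnC !mulnA.
  apply: leq_trans (mdg_prod _ _) _; rewrite big_distrr /=;
    apply: leq_sum => i _.
  by apply: leq_trans (mdgX _ _) _; rewrite leq_mul2r ltnW ?orbT.
have ch_Ga x g : G g -> (Ga x).@[fun l => ch (M l) g] =
    (\prod_l ch (M l) g) ^+ (E * (d * N.+1)) * \prod_i phi i g ^+ x i.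
  move=> Gg; rewrite mevalM rmorphXn rmorph_prod /=.
  have -> : \prod_l ('X_l).@[fun l => ch (M l) g] = \prod_l ch (M l) g.
    by apply: eq_bigr => l _; rewrite mevalXU.
  rewrite rmorph_prod /=; set X0 := \prod_(_ | _) ch _ g.
  have -> : \prod_i (Gam i ^+ x i).@[fun l =>
    ch (M l) g] = X0 ^+ (E * \sum_i x i) * \prod_i phi i g ^+ x i.
    rewrite exprM -prodrXr -big_split /=; apply: eq_bigr => i _.
    by rewrite rmorphXn /= -hGam // exprMn.
  by rewrite mulrA -exprD -mulnDr subnK.
have ym_deg q : (mdg (ym q) <= mdeg q * Y)%N.
  rewrite ymE; apply: leq_trans (mdg_prod _ _) _.
  rewrite mdegE big_distrl /=; apply: leq_sum => i _;
    apply: leq_trans (mdgX _ _) _.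
  by rewrite leq_mul2l /Y (bigD1 i) //= leq_addr orbT.
have Z_deg (i l : 'I_N.+1) : (mdg (Z i l) <= N.+1 * (mdg t + mdg a + mdg c))%N.
  rewrite /Z !mulnDr; apply: leq_trans (mdgM _ _) _; apply: leq_add; last first.
    by apply: leq_trans (mdgX _ _) _; rewrite leq_mul2r leq_subr orbT.
  apply: leq_trans (mdgM _ _) _; apply: leq_add; apply: leq_trans (mdgX _ _) _.
    by rewrite leq_mul2r ltnW ?orbT.
  by rewrite leq_mul2r ltnW ?orbT.
pose I : finType := (al * ('I_N.+1 * 'I_N.+1))%type.
pose J : finType := ({ffun 'I_s -> 'I_j} * {ffun 'I_n -> 'I_Kd.+1})%type.
pose cn m := can j B (mquo j m).
(* Trades the quotient part of a monomial in the characters for an element of k[n]. Quotients with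
   equal [j]-th powers of characters give the same element. *)
pose term (x : I) m := (Ga x.1)@_m *: (ym (cn m) * Z x.2.1 x.2.2).
pose mon (f : {ffun 'I_n -> 'I_Kd.+1}) : 'X_{1..n} :=
  [multinom nat_of_ord (f i) | i < n].
pose A (x : I) (z : J) := (\sum_(m <- msupp (Ga x.1) | mrem j0 m == z.1) term x
  m)@_(mon z.2).
have cardJI : (#|J| < #|I|)%N by rewrite !card_prod !card_ffun !card_ord;
  exact: hN.
have [e [x0 ex0] eqA] := linear_system A cardJI.
pose ell := [seq (x, m) | x <- index_enum I, m <- msupp (Ga x.1)].
pose cf (p : I * 'X_{1..s}) := e p.1 * (Ga p.1.1)@_p.2.
pose u (p : I * 'X_{1..s}) := ym (cn p.2) * Z p.1.2.1 p.1.2.2.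
have big_ell (V : nmodType) (P : pred (I * 'X_{1..s})) (F : I * 'X_{1..s} ->
  V) :
    \sum_(p <- ell | P p) F p = \sum_x \sum_(m <- msupp (Ga x.1) | P (x,
      m)) F (x, m).
  by rewrite big_mkcond /ell big_allpairs_dep; apply: eq_bigr => x _;
    rewrite [RHS]big_mkcond.
have ell_B p : p \in ell -> (mdeg p.2 <= B)%N.
  by case/allpairsPdep => x [m [_ mx ->]]; apply: Gam_deg mx.
(* The linear system kills the coefficients with all exponents at most [Kd]; the remaining ones
   vanish by degree. *)
have Psi r : \sum_(p <- ell | mrem j0 p.2 == r) cf p *: u p = 0.
  apply/mpolyP => mu; rewrite mcoeff0 raddf_sum /=.
  have [/forallP box|nbox] := boolP [forall i, mu i < Kd.+1]%N; last first.
    rewrite big_seq_cond big1 // => p /andP[pl _]; rewrite mcoeffZ.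
    rewrite [X in _ * X]memN_msupp_eq0 ?mulr0 //;
      apply: contra nbox => /mdeg_msupp h.
    apply/forallP => i; rewrite ltnS; apply: (@leq_trans (mdeg mu)).
      by rewrite mdegE (bigD1 i) //= leq_addr.
    apply: leq_trans h _; apply: leq_trans (mdgM _ _) _.
    rewrite /Kd /C2 mulnDr mulnA; apply: leq_add; last exact: Z_deg.
    apply: leq_trans (ym_deg _) _; rewrite leq_mul2r; apply/orP; right.
    by apply: mdeg_can; apply: leq_trans (mdeg_mquo _ _) (ell_B _ pl).
  have := eqA (r, [ffun i => inord (mu i)]); rewrite /A /=.
  have -> : mon [ffun i => inord (mu i)] = mu.
    by apply/mnmP => i; rewrite mnmE ffunE inordK.
  move=> e0; rewrite -[RHS]e0 big_ell; apply: eq_bigr => x _.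
  rewrite raddf_sum /= mulr_sumr; apply: eq_bigr => m _.
  by rewrite /term /cf /u /= !mcoeffZ -mulrA.
pose W (p : I * 'X_{1..s}) := wt (cn p.2) + v *+ N.+1.
have homZ2 (i l : 'I_N.+1) : hom j (v *+ N.+1) (Z i l).
  have -> : v *+ N.+1 = 0 *+ l + v *+ i + v *+ (N.+1 - i).
    by rewrite mul0rn add0r -mulrnDr subnKC // ltnW.
  by apply: (homM chD); [apply: (homM chD)|]; apply: (homX ch0 chD).
have homu p : hom j (W p) (u p).
  by apply: (homM chD) => //; apply: (hom_ym G1 GM ch0 chD chM yhom).
have can_can q : (mdeg q <= B)%N -> can j B (can j B q) = can j B q.
  by move=> qB; apply/esym/can_eq => //; apply: canP.
have ell_q p : p \in ell -> (mdeg (mquo j p.2) <= B)%N.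
  by move=> pl; apply: leq_trans (mdeg_mquo _ _) (ell_B _ pl).
(* All the [Z i l] have the same weight, so independence of characters separates the terms according
   to [cn]. *)
have H1 r q0 : \sum_(p <- ell | (mrem j0 p.2 == r) && (cn p.2 == q0)) cf p *: u
  p = 0.
  have [ex|nex] := pselect (exists2 p, p \in ell & cn p.2 = q0); last first.
    rewrite big_seq_cond big1 // => p /andP[pl /andP[_ /eqP pq]].
    by case: nex; exists p.
  case: ex => p0 p0l q0E; have q0can :
    can j B q0 = q0 by rewrite -q0E can_can ?ell_q.
  have := @dedekind_class k n G L ch G1 GM ch0 chD chM _ _
    [seq p <- ell | mrem j0 p.2 == r] (fun p => W p *+ j) (fun p =>
      cf p *: u p) _
    ((wt q0 + v *+ N.+1) *+ j).
  rewrite big_filter_cond => H.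
  rewrite -[RHS]H => [|g Gg]; last first.
    have e0 := congr1 (act (g ^+ j)%g) (Psi r); rewrite rmorph0 in e0.
    rewrite big_filter -[RHS]e0 raddf_sum.
    apply: eq_bigr => p _; rewrite /= actZ homu // (chMn ch0 chD) //.
    by rewrite !scalerA mulrC.
  rewrite [LHS]big_seq_cond [RHS]big_seq_cond; apply: eq_bigl => p.
  case pl : (p \in ell) => //=; congr (_ && _);
    apply/eqP/asboolP => [pq g Gg|h].
    by rewrite /W pq.
  rewrite -q0can -[LHS](can_can _ (ell_q _ pl)); apply: can_eq;
    first exact/mdeg_can/ell_q.
  apply/eqjP => g Gg; have := h g Gg;
    rewrite !(chMn ch0 chD) // /W !chD // !exprMn.
  exact: (mulIf (expf_neq0 j (ch_neq0 ch0 chD _ Gg))).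
have H2 r q0 : \sum_(p <- ell | (mrem j0 p.2 == r) && (cn p.2 == q0)) cf p *: Z
  p.1.2.1 p.1.2.2 = 0.
  apply: (mulfI (ym_neq0 y0 q0)); rewrite mulr0 -[RHS](H1 r q0) mulr_sumr.
  by apply: eq_bigr => p /andP[_ /eqP <-]; rewrite /u -scalerAr.
(* After cancelling [ym q0], the assumed independence of the [Z i l] isolates each pair [(i, l)]. *)
have H3 r q0 i l : \sum_(x : al) \sum_(m <- msupp (Ga x) | (mrem j0 m == r) &&
  (cn m == q0))
    e (x, (i, l)) * (Ga x)@_m = 0.
  apply: (Zindep (fun i l => \sum_(x : al) \sum_(m <- msupp (Ga x) |
    (mrem j0 m == r) && (cn m == q0)) e (x, (i, l)) * (Ga x)@_m)).
  rewrite -[RHS](H2 r q0) big_ell.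
  rewrite (_ : \sum_(x : I) _ = \sum_i \sum_l \sum_(x :
    al) \sum_(m <- msupp (Ga x) |
      (mrem j0 m == r) && (cn m == q0)) cf ((x, (i, l)), m) *: Z i l);
        last first.
    rewrite [RHS]pair_bigA exchange_big [RHS]pair_bigA /=.
    by apply: eq_bigr => -[x [? ?]] _.
  apply: eq_bigr => i' _; apply: eq_bigr => l' _; rewrite scaler_suml;
    apply: eq_bigr => x _.
  by rewrite scaler_suml.
case: x0 ex0 => x0 [i0 l0] ex0.
pose mn (x : al) : 'X_{1..d} := [multinom nat_of_ord (x i) | i < d].
have mn_inj : injective mn.
  move=> x x' /mnmP e'; apply/ffunP => i; apply/val_inj.
  by have := e' i; rewrite !mnmE.
pose F := \sum_x e (x, (i0, l0)) *: 'X_[mn x] : {mpoly k[d]}.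
have F0 : F != 0.
  apply: contraNneq ex0 => /(congr1 (mcoeff (mn x0))).
  rewrite mcoeff0 raddf_sum (bigD1 x0) //= mcoeffZ mcoeffX eqxx mulr1 big1
    ?addr0 => [->//|x xx0].
  by rewrite mcoeffZ mcoeffX (inj_eq mn_inj) (negPf xx0) mulr0.
have [g Gg /eqP] := hphi _ F0; apply.
have X00 : \prod_l ch (M l) g != 0 by apply/prodf_neq0 => l _;
  apply: (ch_neq0 ch0 chD).
apply: (mulfI (expf_neq0 (E * (d * N.+1)) X00)); rewrite mulr0.
pose ell' := [seq (x, m) | x <- index_enum (al : finType), m <- msupp (Ga x)].
(* The key determines the value at [g] of the character of [p.2], by [ch_split]. Hence the relations
   [H3] add up to [F] vanishing at the [phi i g], against their independence. *)
pose key (p : al * 'X_{1..s}) := (mrem j0 p.2, cn p.2).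
pose h (c : {ffun 'I_s -> 'I_j} * 'X_{1..s}) :=
  ch (wt (mremv c.1)) g * ch (wt c.2) g ^+ j.
have := @sum_key_eq0 k^o _ _ ell' key (fun p =>
  e (p.1, (i0, l0)) * (Ga p.1)@_p.2) h.
move=> H; rewrite -[RHS]H => [|[r q0]]; last first.
  rewrite -[RHS](H3 r q0 i0 l0) big_mkcond /ell' big_allpairs_dep;
    apply: eq_bigr => x _.
  by rewrite [RHS]big_mkcond; apply: eq_bigr => m _; rewrite /key -pair_eqE.
rewrite /ell' big_allpairs_dep rmorph_sum mulr_sumr; apply: eq_bigr => x _ /=.
rewrite mevalZ mevalX (eq_bigr (fun i => phi i g ^+ x i)); last by move=> i _;
  rewrite mnmE.
rewrite mulrCA -ch_Ga // mevalE mulr_sumr; apply: eq_bigr => m _.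
rewrite -[RHS]/(h (key (x, m)) * (e (x, (i0, l0)) * (Ga x)@_m)) mulrA mulrC;
  congr (_ * _).
rewrite /h /= -(ch_split j0 B) // /wt (ch_sum ch0 chD) //;
  apply: eq_bigr => i _.
by rewrite (chMn ch0 chD).
Qed.

End Counting.

(** * Actions of closed subgroups of tori *)

Section Decomposition.
Import Order.TTheory GRing.Theory.
Local Open Scope ring_scope.
Variables (k : closedFieldType) (n : nat) (G : set (polyAut k n)).
Variables (L : zmodType) (ch : L -> polyAut k n -> k).
Hypothesis G1 : G 1%g.
Hypothesis GM : forall g h, G g -> G h -> G (g * h)%g.
Hypothesis ch0 : forall g, G g -> ch 0 g = 1.
Hypothesis chD : forall v w g, G g -> ch (v + w) g = ch v g * ch w g.
Hypothesis chM : forall v g h, G g -> G h -> ch v (g * h)%g = ch v g * ch v h.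

(** A canonical weight with the same restriction to [G], so that equality of characters becomes a
    decidable key. *)
Definition char_class (v : L) : L := choose (fun w => `[< forall g, G g ->
  ch w g = ch v g >]) v.

Lemma char_classP v g : G g -> ch (char_class v) g = ch v g.
Proof.
have : (fun w => `[< forall g, G g -> ch w g = ch v g >]) (char_class v).
  by apply: (@chooseP _ (fun w => `[< forall g, G g -> ch w g = ch v g >]) v);
    apply/asboolP.
by move=> /asboolP; apply.
Qed.

Lemma char_class_eq v w : (char_class v == char_class w) = `[< forall g, G g ->
  ch v g = ch w g >].
Proof.
apply/eqP/asboolP => [e g Gg|e]; first by rewrite -char_classP // e char_classP.
rewrite /char_class (@eq_choose _ _ (fun x => `[< forall g, G g ->
  ch x g = ch w g >])).
  by apply: choose_id; apply/asboolP.
by move=> x; apply/asboolP/asboolP => h g Gg; rewrite h // e.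
Qed.

(** In a relation on [G] the coefficients of each character add up to 0; hence it survives any [h]
    that depends on the character only, such as evaluation at a point not yet known to lie in
    [G]. *)
Lemma char_sum_eval (I : eqType) (r : seq I) (v : I -> L) (b : I ->
  k) (h : L -> k) :
  (forall g, G g -> \sum_(i <- r) ch (v i) g * b i = 0) ->
  (forall v w, (forall g, G g -> ch v g = ch w g) -> h v = h w) ->
  \sum_(i <- r) h (v i) * b i = 0.
Proof.
move=> e hh; have := @sum_key_eq0 k k^o _ _ r (char_class \o v) b h.
move=> H; rewrite -[RHS]H => [|w] /=.
  by apply: eq_bigr => i _ /=; congr (_ * _); apply: hh => g /char_classP ->.
have [ex|nex] := pselect (exists w', w = char_class w'); last first.
  by rewrite big1 // => i /eqP ei; case: nex; exists (v i).
case: ex => w' ->; rewrite -[RHS](@dedekind_class k n G L ch G1 GM ch0 chD chM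
  k^o _ _ _ _ e w').
by apply: eq_bigl => i; rewrite char_class_eq.
Qed.

(** Terms with the same character on [G] are collected, and independence of characters shows that
    each collection is homogeneous. *)
Lemma homogeneous_decomposition (a : {mpoly k[n]}) (s :
  seq (L * {mpoly k[n]})) :
  (forall g, G g -> act g a = \sum_(x <- s) ch x.1 g *: x.2) ->
  exists ws : seq (L * {mpoly k[n]}),
    (forall x, x \in ws -> forall g, G g -> act g x.2 = ch x.1 g *: x.2) /\
    a = \sum_(x <- ws) x.2.
Proof.
move=> ea; pose b c := \sum_(x <- s | char_class x.1 == c) x.2.
exists [seq (c, b c) | c <- undup [seq char_class x.1 | x <- s]]; split;
  last first.
  rewrite big_map /= -sum_by_key -[LHS]act1 ea //; apply: eq_bigr => x _.
  by rewrite (ch1 G1 GM ch0 chD chM) scale1r.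
move=> _ /mapP[c + ->] h Gh /=; rewrite mem_undup => /mapP[x0 _ ->].
(* Expands [act (g * h) a] in two ways: by [ea] at [g * h], and by applying [h] to [ea] at [g]. *)
have E g : G g -> \sum_(x <- s) ch x.1 g *: (act h x.2 - ch x.1 h *: x.2) = 0.
  move=> Gg; have e1 := ea _ (GM Gg Gh).
  rewrite actM ea // raddf_sum /= in e1.
  under eq_bigr => x _ do rewrite scalerBr scalerA -chM // -actZ.
  by rewrite sumrB e1 subrr.
have := @dedekind_class k n G L ch G1 GM ch0 chD chM _ _ _ _ _ E x0.1.
rewrite /b raddf_sum scaler_sumr /= => /eqP; rewrite sumrB subr_eq0 => /eqP e.
have cl (x : L * {mpoly k[n]}) : (char_class x.1 == char_class x0.1) =
  `[< forall g, G g -> ch x.1 g = ch x0.1 g >] by apply: char_class_eq.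
rewrite (eq_bigl _ _ cl) e; apply: eq_big => x; first by rewrite cl.
by move=> /asboolP hx; rewrite char_classP // hx.
Qed.

Section Representable.
Variable V : comAlgType k.
Implicit Types phi psi : polyAut k n -> V.

(** Plays the role of the regular functions on [G] with values in [V]; used for scalars and for
    polynomials. *)
Definition char_rep phi := exists s : seq (L * V),
  forall g, G g -> phi g = \sum_(x <- s) ch x.1 g *: x.2.

Lemma char_rep_const c : char_rep (fun=> c).
Proof. by exists [:: (0, c)] => g Gg; rewrite big_seq1 ch0 // scale1r. Qed.

Lemma char_rep_char v c : char_rep (fun g => ch v g *: c).
Proof. by exists [:: (v, c)] => g Gg; rewrite big_seq1. Qed.

Lemma char_repD phi psi : char_rep phi -> char_rep psi ->
  char_rep (fun g => phi g + psi g).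
Proof. by move=> [s hs] [r hr]; exists (s ++ r) => g Gg;
  rewrite big_cat hs // hr. Qed.

Lemma char_repM phi psi : char_rep phi -> char_rep psi ->
  char_rep (fun g => phi g * psi g).
Proof.
move=> [s hs] [r hr]; exists [seq (x.1 + z.1, x.2 * z.2) | x <- s, z <- r] =>
  g Gg.
rewrite big_allpairs_dep hs // hr // mulr_suml; apply: eq_bigr => x _.
rewrite mulr_sumr; apply: eq_bigr => z _ /=.
by rewrite chD // -scalerAl -scalerAr scalerA.
Qed.

Lemma char_repZ c phi : char_rep phi -> char_rep (fun g => c *: phi g).
Proof.
move=> [s hs]; exists [seq (x.1, c *: x.2) | x <- s] => g Gg.
rewrite big_map hs // scaler_sumr; apply: eq_bigr => x _.
by rewrite !scalerA mulrC.
Qed.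

Lemma char_repX phi m : char_rep phi -> char_rep (fun g => phi g ^+ m).
Proof.
move=> h; elim: m => [|m IH]; first exact: char_rep_const.
have [s hs] := char_repM h IH; exists s => g Gg.
by rewrite exprS hs.
Qed.

Lemma char_rep_sum (I : Type) (r : seq I) (F : I -> polyAut k n -> V) :
  (forall i, char_rep (F i)) -> char_rep (fun g => \sum_(i <- r) F i g).
Proof.
move=> h; elim: r => [|i r IH]; first by exists [::] => g Gg; rewrite !big_nil.
have [s hs] := char_repD (h i) IH; exists s => g Gg.
by rewrite big_cons hs.
Qed.

Lemma char_rep_prod (I : Type) (r : seq I) (F : I -> polyAut k n -> V) :
  (forall i, char_rep (F i)) -> char_rep (fun g => \prod_(i <- r) F i g).
Proof.
move=> h; elim: r => [|i r IH].
  by have [s hs] := char_rep_const 1; exists s => g Gg;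
    rewrite big_nil (hs g Gg).
have [s hs] := char_repM (h i) IH; exists s => g Gg.
by rewrite big_cons hs.
Qed.

Lemma char_rep_mpoly N (F : {mpoly k[N]}) (h : 'I_N -> polyAut k n -> V) :
  (forall j, char_rep (h j)) ->
  char_rep (fun g => \sum_(m <- msupp F) F@_m *: \prod_j h j g ^+ m j).
Proof.
move=> hh; apply: char_rep_sum => m; apply: char_repZ.
by apply: char_rep_prod => j; apply: char_repX.
Qed.

Lemma eq_char_rep phi psi : (forall g, G g -> phi g = psi g) -> char_rep phi ->
  char_rep psi.
Proof. by move=> e [s hs]; exists s => g Gg; rewrite -e // hs. Qed.

End Representable.

End Decomposition.

(** * Characters and points of the torus *)

Section TorusCharacters.
Import Order.TTheory GRing.Theory.
Local Open Scope ring_scope.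
Local Open Scope classical_set_scope.
Variables (k : closedFieldType) (r : nat).
Implicit Types (u w : 'rV[k]_(r + r)) (v : 'rV[int]_r).

Definition tchar v u : k := \prod_i u 0 (lshift r i) ^ v 0 i.

Lemma diag_mulVr u i : diag_set u -> u 0 (lshift r i) * u 0 (rshift r i) = 1.
Proof. by move=> /(_ i); rewrite !mxE. Qed.

Lemma diag_neq0 u i : diag_set u -> u 0 (lshift r i) != 0.
Proof.
move=> /(diag_mulVr i) e; apply: contra_eq_neq e => ->.
by rewrite mul0r eq_sym oner_neq0.
Qed.

Lemma diag_inv_entry u i : diag_set u ->
  u 0 (rshift r i) = (u 0 (lshift r i))^-1.
Proof.
move=> du; apply: (mulfI (diag_neq0 i du)).
by rewrite diag_mulVr // mulfV // diag_neq0.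
Qed.

Lemma tchar0 u : tchar 0 u = 1.
Proof. by rewrite /tchar big1 // => i _; rewrite mxE expr0z. Qed.

Lemma tcharD v v' u : diag_set u -> tchar (v + v') u = tchar v u * tchar v' u.
Proof.
move=> du; rewrite /tchar -big_split; apply: eq_bigr => i _.
by rewrite mxE expfzDr // diag_neq0.
Qed.

Lemma tchar_neq0 v u : diag_set u -> tchar v u != 0.
Proof. by move=> du; apply/prodf_neq0 => i _;
  rewrite expfz_neq0 // diag_neq0. Qed.

Lemma tcharN v u : diag_set u -> tchar (- v) u = (tchar v u)^-1.
Proof.
move=> du; apply: (mulfI (tchar_neq0 v du)).
by rewrite -tcharD // subrr tchar0 mulfV // tchar_neq0.
Qed.

Lemma tcharM v u w : tchar v (diag_mul u w) = tchar v u * tchar v w.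
Proof.
rewrite /tchar -big_split; apply: eq_bigr => i _.
by rewrite mxE expfzMl.
Qed.

Lemma tchar_delta i u : tchar (delta_mx 0 i) u = u 0 (lshift r i).
Proof.
rewrite /tchar (bigD1 i) //= mxE !eqxx expr1z big1 ?mulr1 // => l li.
by rewrite mxE (negPf li) andbF expr0z.
Qed.

(** On the torus the last [r] coordinates are the inverses of the first, so a monomial restricts to
    the character of the differences of exponents. *)
Definition mnm_char (m : 'X_{1..(r + r)}) : 'rV[int]_r :=
  \row_i ((m (lshift r i))%:Z - (m (rshift r i))%:Z).

Lemma mnm_charE (m : 'X_{1..(r + r)}) u : diag_set u ->
  \prod_i u 0 i ^+ m i = tchar (mnm_char m) u.
Proof.
move=> du; rewrite big_split_ord /= /tchar -big_split; apply: eq_bigr => i _.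
rewrite mxE expfzDr ?diag_neq0 //= diag_inv_entry // exprVn.
by rewrite -invr_expz.
Qed.

Lemma meval_tchar (p : {mpoly k[r + r]}) u : diag_set u ->
  p.@[fun i => u 0 i] = \sum_(m <- msupp p) tchar (mnm_char m) u * p@_m.
Proof.
move=> du; rewrite mevalE; apply: eq_bigr => m _.
by rewrite mnm_charE // mulrC.
Qed.

(** Extended to the basis vectors, the partial character has values there that are the coordinates
    of the point. *)
Lemma char_graph_point (R : 'rV[int]_r -> k -> Prop) : char_graph R ->
  exists2 u, diag_set u & forall v c, R v c -> tchar v u = c.
Proof.
move=> gR; have [R' [gR' sub dom]] :=
  char_graph_extend [seq delta_mx 0 i | i : 'I_r] gR.
have ex (i : 'I_r) : exists c, R' (delta_mx 0 i) c.
  by apply: dom; apply: map_f; rewrite mem_enum.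
have [c hc] := choice ex.
have [R0 RD RN Rn Rf] := gR'; have c0 i : c i != 0 := Rn _ _ (hc i).
pose u : 'rV[k]_(r + r) := row_mx (\row_i c i) (\row_i (c i)^-1).
have ul i : u 0 (lshift r i) = c i by rewrite row_mxEl mxE.
exists u => [i|v a /sub Ra]; first by rewrite row_mxKl row_mxKr !mxE mulfV.
apply: (char_graph_fun gR') Ra; rewrite {1}(row_sum_delta v) /tchar.
apply: (big_ind2 R') => // [x a' x' b' h h'|i _]; first exact: RD.
rewrite ul -[X in X *: _]intz scaler_int; exact: char_graphMz (gR') (hc i).
Qed.

End TorusCharacters.

(** * A closed subgroup of the torus acting on affine space *)

Section TorusAction.
Import Order.TTheory GRing.Theory Num.Theory.
Local Open Scope ring_scope.
Local Open Scope classical_set_scope.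
Variables (k : closedFieldType) (n r : nat).
Hypothesis char0 : [pchar k] =i pred0.
Variables (T : set 'rV[k]_(r + r)) (tau : 'rV[k]_(r + r) -> polyAut k n).
Variable sigma : polyAut k n -> 'rV[k]_(r + r).
Hypothesis Tclosed : zclosed T.
Hypothesis Tdiag : T `<=` @diag_set k r.
Hypothesis T1 : T (const_mx 1).
Hypothesis TM : forall u v, T u -> T v -> T (diag_mul u v).
Hypothesis tauM : forall u v, T u -> T v ->
  tau (diag_mul u v) = (tau u * tau v)%g.
Hypothesis tau_reg : regular2 T setT (fun u v => aut_map (tau u) v).
Hypothesis sigmaK : forall u, T u -> sigma (tau u) = u.

Definition Tgrp : set (polyAut k n) := tau @` T.
Local Notation G := Tgrp.
Definition tch (v : 'rV[int]_r) (g : polyAut k n) : k := tchar v (sigma g).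
Local Notation ch := tch.
Local Notation L := 'rV[int]_r.

Lemma diag_mul1 (u : 'rV[k]_(r + r)) : diag_mul (const_mx 1) u = u.
Proof. by apply/rowP => i; rewrite !mxE mul1r. Qed.

Lemma diag_mulC (u v : 'rV[k]_(r + r)) : diag_mul u v = diag_mul v u.
Proof. by apply/rowP => i; rewrite !mxE mulrC. Qed.

Lemma tau1 : tau (const_mx 1) = 1%g.
Proof.
have := tauM T1 T1; rewrite diag_mul1 => /(congr1 (fun g =>
  (tau (const_mx 1%R))^-1 * g)%g).
by rewrite mulVg mulKg.
Qed.

Lemma Tgrp1 : G 1%g.
Proof. by exists (const_mx 1) => //; apply: tau1. Qed.

Lemma TgrpM g h : G g -> G h -> G (g * h)%g.
Proof.
move=> [u Tu <-] [v Tv <-]; exists (diag_mul u v); first exact: TM.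
exact: tauM.
Qed.

Lemma TgrpC g h : G g -> G h -> (g * h)%g = (h * g)%g.
Proof. by move=> [u Tu <-] [v Tv <-]; rewrite -!tauM // diag_mulC. Qed.

Lemma sigma_T g : G g -> T (sigma g).
Proof. by move=> [u Tu <-]; rewrite sigmaK. Qed.

Lemma sigma_diag g : G g -> diag_set (sigma g).
Proof. by move=> /sigma_T/Tdiag. Qed.

Lemma tch0 g : G g -> ch 0 g = 1.
Proof. by move=> _; apply: tchar0. Qed.

Lemma tchD v w g : G g -> ch (v + w) g = ch v g * ch w g.
Proof. by move=> /sigma_diag; apply: tcharD. Qed.

Lemma tchM v g h : G g -> G h -> ch v (g * h)%g = ch v g * ch v h.
Proof.
move=> [u Tu <-] [w Tw <-]; rewrite -tauM // /ch !sigmaK ?tcharM //.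
exact: TM.
Qed.

Lemma char_rep_coord (V : comAlgType k) i : char_rep G ch (fun g =>
  sigma g 0 i *: (1 : V)).
Proof.
case: (split_ordP i) => j ->.
  have := char_rep_char G ch (delta_mx 0 j) (1 : V).
  by apply: eq_char_rep => g Gg; rewrite /ch tchar_delta.
have := char_rep_char G ch (- delta_mx 0 j) (1 : V).
apply: eq_char_rep => g Gg; have du := sigma_diag Gg.
rewrite /tch /= tcharN // tchar_delta.
by rewrite diag_inv_entry.
Qed.

Lemma act_char_rep a : char_rep G ch (fun g => act g a).
Proof.
have [P hP] := tau_reg.
(* The group coordinates become scalars, the space coordinates stay variables. Regularity equates
   values only; [mpoly_eq_eval] lifts this to polynomials. *)
pose Q (g : polyAut k n) : (r + r + n).-tuple {mpoly k[n]} :=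
  [tuple match split i with inl j => sigma g 0 j *: 1 | inr j =>
    'X_j end | i < r + r + n].
have E g i : G g -> tnth (val g).1 i = tnth P i \mPo Q g.
  move=> [u Tu <-]; apply: (mpoly_eq_eval char0) => v.
  have /rowP/(_ i) := hP u v Tu I; rewrite /aut_map !mxE => ->.
  rewrite comp_mpoly_meval; apply: meval_eq => l.
  rewrite tnth_mktuple !mxE; case: (split l) => j; last by rewrite mevalXU.
  by rewrite mevalZ meval1 mulr1 sigmaK.
have repQ i : char_rep G ch (fun g => tnth (Q g) i).
  have : char_rep G ch (fun g => match split i with inl j =>
    sigma g 0 j *: 1 | inr j => 'X_j end : {mpoly k[n]}).
    case: (split i) => j; first exact: char_rep_coord.
    exact: (char_rep_const tch0).
  by apply: eq_char_rep => g _; rewrite tnth_mktuple.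
have repg i : char_rep G ch (fun g => tnth (val g).1 i).
  apply: eq_char_rep (char_rep_mpoly tch0 tchD (tnth P i) repQ) => g Gg.
  by rewrite E // comp_mpolyE.
apply: eq_char_rep (char_rep_mpoly tch0 tchD a repg) => g Gg.
by rewrite actE comp_mpolyE.
Qed.

Lemma homogeneous_generators : exists s (y : polymap k n s) (M : 'I_s -> L),
  [/\ forall j, mlead (tnth y j) != 0%MM,
      forall j g, G g -> act g (tnth y j) = ch (M j) g *: tnth y j &
      forall a, exists P : {mpoly k[s]}, a = P \mPo y].
Proof.
have ex (i : 'I_n) : exists ws : seq (L * {mpoly k[n]}),
    (forall x, x \in ws -> forall g, G g -> act g x.2 = ch x.1 g *: x.2) /\
    'X_i = \sum_(x <- ws) x.2.
  have [s hs] := act_char_rep 'X_i.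
  exact: (homogeneous_decomposition Tgrp1 TgrpM tch0 tchD tchM hs).
have [ws hws] := choice ex.
(* Constant components are dropped, since the generators must be nonconstant; they are recovered
   below as scalars. *)
pose l := [seq x <- flatten [seq ws i | i : 'I_n] | mlead x.2 != 0%MM].
have ly x : x \in l -> mlead x.2 != 0%MM /\ forall g, G g ->
  act g x.2 = ch x.1 g *: x.2.
  rewrite mem_filter => /andP[x0 /flatten_mapP[i _ xi]]; split=> //.
  by have [h _] := hws i; apply: h.
pose nl (j : 'I_(size l)) := tnth (in_tuple l) j.
have nll j : nl j \in l by apply: mem_tnth.
pose y : polymap k n (size l) := [tuple (nl j).2 | j < size l].
exists (size l), y, (fun j => (nl j).1); split=> [j|j g Gg|a].
- by rewrite tnth_mktuple; have [] := ly _ (nll j).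
- by rewrite tnth_mktuple; have [_ h] := ly _ (nll j); apply: h.
have exX (i : 'I_n) : exists P : {mpoly k[size l]}, 'X_i = P \mPo y.
  have [_ ->] := hws i; have : {subset ws i <= flatten [seq ws i | i : 'I_n]}.
    by move=> x xi; apply/flatten_mapP; exists i; rewrite ?mem_enum.
  elim: (ws i) => [|x t IH] sub; first by exists 0; rewrite big_nil rmorph0.
  have [|P eP] := IH; first by move=> z zt; apply: sub; rewrite inE zt orbT.
  suff [P' eP'] : exists P' : {mpoly k[size l]}, x.2 = P' \mPo y.
    by exists (P' + P); rewrite big_cons rmorphD /= -eP -eP'.
  have [x0|x0] := eqVneq (mlead x.2) 0%MM.
    by exists (x.2@_0)%:MP; rewrite comp_mpolyC; apply: lead_const.
  have xl : x \in l by rewrite mem_filter x0 sub // inE eqxx.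
  have /tnthP[j ej] : x \in in_tuple l by [].
  by exists 'X_j; rewrite comp_mpolyXU -tnth_nth tnth_mktuple /nl -ej.
have [P hP] := choice exX.
exists (a \mPo [tuple P i | i < n]).
rewrite comp_mpolyA -[LHS]comp_mpoly_id; congr (_ \mPo _).
by apply: eq_from_tnth => i; rewrite !tnth_mktuple.
Qed.

(** [T] is cut out by the characters trivial on it: an equation of [T] is a relation between
    characters of [G], and weights agreeing on [G] agree at [u]. *)
Lemma torus_dual u : diag_set u ->
  (forall v, (forall g, G g -> ch v g = 1) -> tchar v u = 1) -> T u.
Proof.
move=> du hu; have [S eS] := Tclosed; rewrite eS => p Sp.
have H := @char_sum_eval k n G L ch Tgrp1 TgrpM tch0 tchD tchM
  _ (msupp p) (@mnm_char r) (fun m => p@_m) (fun v => tchar v u).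
rewrite meval_tchar //; apply: H => [g Gg|v w e].
  have := sigma_T Gg; rewrite eS => /(_ p Sp); rewrite meval_tchar //.
  exact: sigma_diag.
have := hu (v - w); rewrite tcharD // tcharN // => h.
apply: (mulIf (invr_neq0 (tchar_neq0 w du))); rewrite divff ?tchar_neq0 //.
apply: h => g Gg; rewrite tchD // e // /tch tcharN ?mulfV //;
  last exact: sigma_diag.
by rewrite tchar_neq0 //; apply: sigma_diag.
Qed.

Section Generators.
Variables (s : nat) (y : polymap k n s) (M : 'I_s -> L).
Hypothesis ylead : forall j, mlead (tnth y j) != 0%MM.
Hypothesis yhom : forall j g, G g -> act g (tnth y j) = ch (M j) g *: tnth y j.
Hypothesis ygen : forall a, exists P : {mpoly k[s]}, a = P \mPo y.

Lemma y_neq0 j : tnth y j != 0.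
Proof. by apply: contraNneq (ylead j) => ->; rewrite mlead0. Qed.

Lemma polyAut_eq_gen (g h : polyAut k n) : (forall j,
  act g (tnth y j) = act h (tnth y j)) -> g = h.
Proof.
move=> e; have e1 a : act g a = act h a.
  have [P ->] := ygen a; rewrite !compyE !raddf_sum /=; apply: eq_bigr => m _.
  rewrite !actZ !ymE !rmorph_prod /=; congr (_ *: _); apply: eq_bigr => j _.
  by rewrite !rmorphXn /= e.
have eq1 (f f' : polyAut k n) : (forall a, act f a = act f' a) ->
  (val f).1 = (val f').1.
  move=> ef; apply: eq_from_tnth => i; have := ef 'X_i.
  by rewrite !actE !comp_mpolyXU -!tnth_nth.
have e2 a : act g^-1%g a = act h^-1%g a.
  by rewrite -[a in RHS](actKV g) e1 actK.
apply/val_inj; move: (eq1 _ _ e1) (eq1 _ _ e2); rewrite /=.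
by case: (polyAut_val g) => ? ?; case: (polyAut_val h) => ? ? /= -> ->.
Qed.

(** The eigenvalues [d] define a character on the weights generated by the [M j] modulo those
    trivial on [G]. It extends to a point [u] of the torus, [torus_dual] puts [u] in [T], and
    [tau u] agrees with [h] on the generators. *)
Lemma Tgrp_membership (h : polyAut k n) (d : 'I_s -> k) :
  (forall j, act h (tnth y j) = d j *: tnth y j) ->
  (forall a b : 'X_{1..s}, (forall g, G g -> ch (wt M a) g = ch (wt M b) g) ->
     \prod_j d j ^+ a j = \prod_j d j ^+ b j) -> G h.
Proof.
move=> hd rel; have d0 j : d j != 0.
  have := y_neq0 j; rewrite -(act_eq0 h) hd; apply: contraNneq => ->.
  by rewrite scale0r.
pose R v c := exists a : 'I_s -> int, (forall g, G g ->
  ch v g = \prod_j ch (M j) g ^ a j) /\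
  c = \prod_j d j ^ a j.
have chM0 j g : G g -> ch (M j) g != 0 by move=> Gg; apply: (ch_neq0 tch0 tchD).
have gR : char_graph R.
  split.
  - exists (fun=> 0); split=> [g Gg|]; rewrite big1 ?tch0 // => j _;
    exact: expr0z.
  - move=> v w _ _ [a [ha ->]] [b [hb ->]]; exists (fun j => a j + b j);
    split=> [g Gg|].
      rewrite tchD // ha // hb // -big_split; apply: eq_bigr => j _.
      by rewrite expfzDr // chM0.
    by rewrite -big_split; apply: eq_bigr => j _; rewrite expfzDr.
  - move=> v _ [a [ha ->]]; exists (fun j => - a j); split=> [g Gg|].
      by rewrite (chN tch0 tchD) // ha // -prodfV; apply: eq_bigr => j _;
        rewrite invr_expz.
    by rewrite -prodfV; apply: eq_bigr => j _; rewrite invr_expz.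
  - by move=> v _ [a [_ ->]]; apply/prodf_neq0 => j _; rewrite expfz_neq0.
  move=> _ [a [ha ->]].
  (* [rel] concerns nonnegative exponents, so [a] is split into its positive part [p] and negative
     part [q]. *)
  pose p : 'X_{1..s} := [multinom if a j is Posz m then m else 0%N | j < s].
  pose q : 'X_{1..s} := [multinom if a j is Negz m then m.+1 else 0%N | j < s].
  have xpq (x : 'I_s -> k) : (forall j, x j != 0) ->
      (\prod_j x j ^ a j) * \prod_j x j ^+ q j = \prod_j x j ^+ p j.
    move=> x0; rewrite -big_split /=; apply: eq_bigr => j _; rewrite !mnmE.
    case: (a j) => m; first by rewrite expr0 mulr1.
    by rewrite NegzE -invr_expz expr0 mulVf // expf_neq0.
  have dq0 : \prod_j d j ^+ q j != 0 by apply/prodf_neq0 => j _;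
    rewrite expf_neq0.
  apply: (mulIf dq0); rewrite xpq // mul1r; apply: rel => g Gg.
  have wtE m : ch (wt M m) g = \prod_j ch (M j) g ^+ m j.
    by rewrite (ch_sum tch0 tchD) //; apply: eq_bigr => j _;
      rewrite (chMn tch0 tchD).
  rewrite !wtE -xpq => [|j]; last exact: chM0.
  by rewrite -ha // tch0 // mul1r.
have [u du hu] := char_graph_point gR.
have Tu : T u.
  apply: torus_dual du _ => v hv; apply: hu; exists (fun=> 0); split=> [g Gg|].
    by rewrite hv // big1 // => j _; apply: expr0z.
  by rewrite big1 // => j _; apply: expr0z.
exists u => //; apply: polyAut_eq_gen => j; rewrite yhom; last by exists u.
rewrite hd /tch sigmaK //; congr (_ *: _); apply: hu.
exists (fun l => if l == j then 1 else 0); split=> [g Gg|].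
  by rewrite (bigD1 j) //= eqxx expr1z big1 ?mulr1 // => l /negPf ->;
    apply: expr0z.
by rewrite (bigD1 j) //= eqxx expr1z big1 ?mulr1 // => l /negPf ->;
  apply: expr0z.
Qed.

(* Otherwise some element of [T] is killed by the weights of the [y_j] but not
   by [v]; it acts trivially, against the injectivity of [tau]. *)
Lemma weights_generate (tau_inj : forall u v, T u -> T v -> tau u = tau v ->
  u = v) v :
  exists a : 'I_s -> int, forall g, G g -> ch v g = \prod_j ch (M j) g ^ a j.
Proof.
apply: contrapT => nv.
pose W w := exists a : 'I_s -> int, forall g, G g ->
  ch w g = \prod_j ch (M j) g ^ a j.
pose R w (c : k) := W w /\ c = 1.
have chM0 j g : G g -> ch (M j) g != 0 by move=> Gg; apply: (ch_neq0 tch0 tchD).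
have WD w w' : W w -> W w' -> W (w + w').
  move=> [a ha] [b hb]; exists (fun j => a j + b j) => g Gg.
  rewrite tchD // ha // hb // -big_split; apply: eq_bigr => j _.
  by rewrite expfzDr // chM0.
have WN w : W w -> W (- w).
  move=> [a ha]; exists (fun j => - a j) => g Gg.
  by rewrite (chN tch0 tchD) // ha // -prodfV; apply: eq_bigr => j _;
    rewrite invr_expz.
have W0 w : (forall g, G g -> ch w g = 1) -> W w.
  by move=> h; exists (fun=> 0) => g Gg; rewrite h // big1 // => j _;
    apply: expr0z.
have WM j : W (M j).
  exists (fun l => if l == j then 1 else 0) => g Gg.
  by rewrite (bigD1 j) //= eqxx expr1z big1 ?mulr1 // => l /negPf ->;
    apply: expr0z.
have gR : char_graph R.
  split=> [|w w' _ _ [h ->] [h' ->]|w _ [h ->]|w _ [_ ->]|_ [_ ->]] //.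
  - by split=> //; apply: W0 => g Gg; apply: tch0.
  - by split; [exact: WD|rewrite mulr1].
  - by split; [exact: WN|rewrite invr1].
  - exact: oner_neq0.
suff [z [z0 z1 hz]] : exists z : k, [/\ z != 0, z != 1 &
  forall m : int, W (v *~ m) -> z ^ m = 1].
  have gz : char_graph (fun w a => exists x b (m : int), [/\ R x b,
    w = x + v *~ m & a = b * z ^ m]).
    by apply: char_graph_adjoin gR z0 _ => m a [/hz -> ->].
  have [u du hu] := char_graph_point gz.
  have hW w : W w -> tchar w u = 1.
    by move=> Ww; apply: hu; exists w, 1, 0; rewrite mulr0z addr0 expr0z mulr1.
  have Tu : T u by apply: torus_dual du _ => w /W0/hW.
  have e1 : tau u = 1%g.
    apply: polyAut_eq_gen => j; rewrite yhom; last by exists u.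
    by rewrite act1 /tch sigmaK // hW // scale1r.
  have eu : u = const_mx 1 by apply: tau_inj => //; rewrite e1 tau1.
  have : tchar v u = z.
    apply: hu; exists 0, 1, 1; rewrite mulr1z add0r mul1r expr1z; split=> //.
    by split=> //; apply: W0 => g Gg; apply: tch0.
  rewrite eu /tchar big1 => [/esym/eqP|i _]; first by rewrite (negPf z1).
  by rewrite mxE exp1rz.
have [[m0 m00 Wm0]|none] := pselect (exists2 m : nat, (0 < m)%N & W (v *+ m));
  last first.
  (* When no nonzero multiple of [v] lies in [W], any value other than 0 and 1 will do. *)
  exists 2; split; first by rewrite pchar0_natf_eq0.
    by rewrite -subr_eq0 -[2]/(1 + 1) addrK oner_neq0.
  move=> m Wm; have [->|m0] := eqVneq m 0; first exact: expr0z.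
  case: none; exists `|m|%N; first by rewrite absz_gt0.
  case: (intP m) Wm m0 => // p Wp _; rewrite ?abszN pmulrn.
  move: (WN _ Wp); by rewrite mulrNz opprK.
pose Pm m := (0 < m)%N && `[< W (v *+ m) >].
have exP : exists m, Pm m by exists m0; rewrite /Pm m00; apply/asboolP.
case: (ex_minnP exP) => c /andP[c0 /asboolP Wc] cmin.
have c1 : (1 < c)%N.
  rewrite ltn_neqAle c0 andbT; apply: contra_not_neq nv => e.
  by move: Wc; rewrite -e mulr1n.
(* A root of 1 + X + ... + X^(c-1) is a [c]-th root of unity, and differs from 1 because [c] is
   nonzero in [k]. *)
pose q : {poly k} := \poly_(i < c) 1.
have [z /rootP qz] : exists z, root q z.
  apply/closed_rootP; rewrite size_poly_eq ?oner_neq0 //.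
  by rewrite neq_ltn c1 orbT.
have qE (x : k) : q.[x] = \sum_(i < c) x ^+ i.
  by rewrite horner_poly; apply: eq_bigr => i _; rewrite mul1r.
have zc : z ^+ c = 1.
  by apply/eqP; rewrite -subr_eq0 subrX1 -qE qz mulr0.
have z0 : z != 0.
  apply/eqP => z0; move/eqP: zc; rewrite z0 expr0n eqn0Ngt c0 /=.
  by rewrite eq_sym oner_eq0.
exists z; split=> // [|m Wm].
  apply/eqP => z1; move/eqP: qz; rewrite qE z1.
  rewrite (eq_bigr (fun=> 1)) => [|i _]; last by rewrite expr1n.
  by rewrite sumr_const card_ord pchar0_natf_eq0 // eqn0Ngt c0.
have WMz w (p : int) : W w -> W (w *~ p).
  move=> [a ha]; exists (fun j => a j * p) => g Gg.
  have du := sigma_diag Gg.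
  have -> : ch (w *~ p) g = ch w g ^ p.
    case: p => p; first exact: (chMn tch0 tchD).
    by rewrite NegzE mulrNz (chN tch0 tchD) // (chMn tch0 tchD) // -invr_expz.
  rewrite ha //; apply: (big_ind2 (fun x x' => x ^ p = x')) =>
    [|x x' b b' <- <-|j _].
  - exact: exp1rz.
  - by rewrite expfzMl.
  - by rewrite exprz_exp.
have em := divz_eq m c.
have mc : (0 <= (m %% c)%Z)%R by rewrite modz_ge0 // -lt0n.
have mc' : ((m %% c)%Z < c)%R by rewrite ltz_pmod.
case er : (m %% c)%Z mc mc' em => [p|p] // _ pc em.
have p0 : p = 0%N.
  apply/eqP; rewrite -leqn0 leqNgt; apply/negP => p0.
  have : (c <= p)%N.
    apply: cmin; rewrite /Pm p0; apply/asboolP.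
    have -> : v *+ p = v *~ m + - ((v *+ c) *~ (m %/ c)%Z).
      rewrite {1}em mulrzDr [v *+ c]pmulrn -mulrzA [_ * (m %/ c)%Z]mulrC.
      by rewrite addrAC subrr add0r.
    by apply: WD Wm (WN _ (WMz _ _ Wc)).
  by rewrite leqNgt -ltz_nat pc.
by rewrite em p0 addr0 mulrC -exprz_exp -exprnP zc exp1rz.
Qed.

Hypothesis tau_inj : forall u v, T u -> T v -> tau u = tau v -> u = v.

Local Notation X0 := (\prod_l 'X_l : {mpoly k[s]}).
Local Notation chi g := (fun j => ch (M j) g).

(** By [weights_generate], [v] restricts to a Laurent monomial in the characters of the generators;
    the sum of the absolute values of its exponents is enough to make them all nonnegative. *)
Lemma clear_denominator v : exists E (a : 'X_{1..s}), forall g, G g ->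
  (X0 ^+ E).@[chi g] * ch v g = ('X_[a]).@[chi g].
Proof.
have [a ha] := weights_generate tau_inj v.
pose E := (\sum_j absz (a j))%N; exists E,
  [multinom absz (a j + E%:Z)%R | j < s] => g Gg.
rewrite rmorphXn rmorph_prod /= mevalX ha // -prodrXl -big_split /=.
apply: eq_bigr => j _; rewrite mevalXU mnmE.
have aE : 0 <= a j + E%:Z.
  rewrite -[a j]opprK addrC subr_ge0; apply: le_trans (lez_abs _) _.
  by rewrite lez_nat abszN /E (bigD1 j) //= leq_addr.
rewrite (exprnP _ (absz _)) gez0_abs // addrC expfzDr //.
exact: (ch_neq0 tch0 tchD).
Qed.

Lemma clear_denominators (phi : polyAut k n -> k^o) : char_rep G ch phi ->
  exists E (P : {mpoly k[s]}), forall g, G g ->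
    (X0 ^+ E).@[chi g] * phi g = P.@[chi g].
Proof.
move=> [t ht]; suff [E [P hP]] : exists E (P : {mpoly k[s]}), forall g, G g ->
    (X0 ^+ E).@[chi g] * (\sum_(x <- t) ch x.1 g * x.2) = P.@[chi g].
  by exists E, P => g Gg; rewrite ht // -hP.
elim: t {ht} => [|x t [E [P hP]]]; first by exists 0%N, 0 => g Gg;
  rewrite big_nil mulr0 meval0.
have [E' [a ha]] := clear_denominator x.1.
exists (E' + E)%N, (x.2 *: (X0 ^+ E * 'X_[a]) + X0 ^+ E' * P) => g Gg.
rewrite big_cons exprD mevalD mevalZ !mevalM -hP // -ha //.
by ring.
Qed.

Lemma torus_normalizer_bounded d (q : 'I_d -> {mpoly k[r + r]}) :
  alg_indep_on T q -> (n <= d.+1)%N ->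
  forall a, bounded_degree G a.
Proof.
move=> hq nd.
pose phi i g : k^o := (q i).@[fun l => sigma g 0 l].
have rep i : char_rep G ch (phi i).
  have := char_rep_mpoly tch0 tchD (q i) (@char_rep_coord k^o).
  by apply: eq_char_rep => g Gg; rewrite /phi mevalE; apply: eq_bigr => m _;
     congr (_ * _); apply: eq_bigr => l _; rewrite [X in X ^+ _]mulr1.
have [E hE] := choice (fun i => clear_denominators (rep i)).
have [P hP] := choice hE.
(* One exponent for all the [phi i], as [homogeneous_dependence] requires. *)
pose E0 := (\sum_i E i)%N.
have cE i : (E i <= E0)%N by rewrite /E0 (bigD1 i) //= leq_addr.
apply: (normalizer_bounded char0 Tgrp1 TgrpM TgrpC tch0 tchD tchM y_neq0 yhom
  ygen _ ylead).
apply: (@homogeneous_dependence k n G L ch s y M Tgrp1 TgrpM tch0 tchD tchM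
  y_neq0 yhom d E0
  (fun i => X0 ^+ (E0 - E i) * P i) phi nd) => [i g Gg|F /hq[u Tu hu]].
  rewrite mevalM -hP // mulrA -mevalM -exprD subnK // rmorphXn rmorph_prod /=;
    congr (_ ^+ _ * _).
  by apply: eq_bigr => l _; rewrite mevalXU.
exists (tau u); first by exists u.
by rewrite /phi sigmaK.
Qed.

End Generators.

End TorusAction.

(** * Algebraicity of bounded closed subgroups *)

Section PolynomialFunctions.
Import Order.TTheory GRing.Theory.
Local Open Scope ring_scope.
Local Open Scope classical_set_scope.
Variables (k : fieldType) (N : nat).
Implicit Types (phi psi : 'rV[k]_N -> k).

(** Closure properties of this class stand in for explicit polynomials in the proofs of closedness
    and regularity below. *)
Definition polyfun phi := exists p : {mpoly k[N]}, forall x,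
  phi x = p.@[fun i => x 0 i].

Lemma polyfun_const c : polyfun (fun=> c).
Proof. by exists c%:MP => x; rewrite mevalC. Qed.

Lemma polyfun_coord i : polyfun (fun x => x 0 i).
Proof. by exists 'X_i => x; rewrite mevalXU. Qed.

Lemma polyfunM phi psi : polyfun phi -> polyfun psi ->
  polyfun (fun x => phi x * psi x).
Proof. by move=> [p hp] [q hq]; exists (p * q) => x; rewrite mevalM hp hq. Qed.

Lemma polyfunB phi psi : polyfun phi -> polyfun psi ->
  polyfun (fun x => phi x - psi x).
Proof. by move=> [p hp] [q hq]; exists (p - q) => x; rewrite mevalB hp hq. Qed.

Lemma polyfunX phi m : polyfun phi -> polyfun (fun x => phi x ^+ m).
Proof. by move=> [p hp]; exists (p ^+ m) => x; rewrite rmorphXn /= hp. Qed.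

Lemma polyfun_sum (I : Type) (r : seq I) (P : pred I) (F : I -> 'rV[k]_N -> k) :
  (forall i, polyfun (F i)) -> polyfun (fun x => \sum_(i <- r | P i) F i x).
Proof.
move=> /choice[p hp]; exists (\sum_(i <- r | P i) p i) => x.
by rewrite rmorph_sum /=; apply: eq_bigr.
Qed.

Lemma polyfun_prod (I : Type) (r : seq I) (P : pred I) (F : I -> 'rV[k]_N ->
  k) :
  (forall i, polyfun (F i)) -> polyfun (fun x => \prod_(i <- r | P i) F i x).
Proof.
move=> /choice[p hp]; exists (\prod_(i <- r | P i) p i) => x.
by rewrite rmorph_prod /=; apply: eq_bigr.
Qed.

Lemma polyfun_meval n (p : {mpoly k[n]}) (F : 'I_n -> 'rV[k]_N -> k) :
  (forall i, polyfun (F i)) -> polyfun (fun x => p.@[fun i => F i x]).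
Proof.
move=> hF; have [q hq] : polyfun (fun x =>
  \sum_(m <- msupp p) p@_m * \prod_i F i x ^+ m i).
  apply: polyfun_sum => m; apply: polyfunM; first exact: polyfun_const.
  by apply: polyfun_prod => i; apply: polyfunX.
by exists q => x; rewrite mevalE.
Qed.

Lemma zclosed_family (I : Type) (phi : I -> 'rV[k]_N -> k) :
  (forall i, polyfun (phi i)) -> zclosed [set x | forall i, phi i x = 0].
Proof.
move=> /choice[p hp]; exists (range p); apply/seteqP; split => x /= h.
  by move=> _ [i _ <-]; rewrite -hp.
by move=> i; rewrite hp; apply: h; exists i.
Qed.

Lemma zclosedI (A B : set 'rV[k]_N) : zclosed A -> zclosed B ->
  zclosed (A `&` B).
Proof.
move=> [S ->] [S' ->]; exists (S `|` S'); apply/seteqP; split => x /=.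
  by move=> [h h'] p [/h|/h'].
by move=> h; split=> p Sp; apply: h; [left|right].
Qed.

Definition polyfam n (F : 'rV[k]_N ->
  {mpoly k[n]}) := forall m, polyfun (fun x => (F x)@_m).

Lemma polyfam_const n (p : {mpoly k[n]}) : polyfam (fun=> p).
Proof. by move=> m; apply: polyfun_const. Qed.

Lemma polyfamM n (F F' : 'rV[k]_N -> {mpoly k[n]}) :
  polyfam F -> polyfam F' -> polyfam (fun x => F x * F' x).
Proof.
move=> hF hF' m; have [p hp] : polyfun (fun x =>
  \sum_(k : 'X_{1..n < (mdeg m).+1, (mdeg m).+1} |
    m == (k.1 + k.2)%MM) (F x)@_k.1 * (F' x)@_k.2).
  by apply: polyfun_sum => i; apply: polyfunM.
by exists p => x; rewrite mcoeffM.
Qed.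

Lemma polyfamZ n (c : 'rV[k]_N -> k) (F : 'rV[k]_N -> {mpoly k[n]}) :
  polyfun c -> polyfam F -> polyfam (fun x => c x *: F x).
Proof.
move=> hc hF m; have [p hp] := polyfunM hc (hF m).
by exists p => x; rewrite mcoeffZ.
Qed.

Lemma polyfam_sum n (I : Type) (r : seq I) (F : I -> 'rV[k]_N -> {mpoly k[n]}) :
  (forall i, polyfam (F i)) -> polyfam (fun x => \sum_(i <- r) F i x).
Proof.
move=> hF m; have [p hp] := polyfun_sum r xpredT (fun i => hF i m).
by exists p => x; rewrite raddf_sum /= hp.
Qed.

Lemma polyfamX n e (F : 'rV[k]_N -> {mpoly k[n]}) :
  polyfam F -> polyfam (fun x => F x ^+ e).
Proof.
move=> hF; elim: e => [|e IH]; first exact: polyfam_const.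
move=> m; have [p hp] := polyfamM hF IH m.
by exists p => x; rewrite exprS hp.
Qed.

Lemma polyfam_prod n (I : Type) (r : seq I) (F : I -> 'rV[k]_N ->
  {mpoly k[n]}) :
  (forall i, polyfam (F i)) -> polyfam (fun x => \prod_(i <- r) F i x).
Proof.
move=> hF; elim: r => [|i r IH] m.
  by have [p hp] := @polyfam_const n 1 m; exists p => x; rewrite big_nil (hp x).
have [p hp] := polyfamM (hF i) IH m.
by exists p => x; rewrite big_cons hp.
Qed.

End PolynomialFunctions.

Section BoundedDegree.
Import Order.TTheory GRing.Theory.
Local Open Scope ring_scope.
Local Open Scope classical_set_scope.
Variables (k : fieldType) (n D : nat).

(** Side ([f] or its inverse), component and monomial. Recording the inverse too makes being an
    automorphism a closed condition and inversion a permutation of coordinates. *)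
Definition pidx := (bool * 'I_n * 'X_{1..n < D})%type.
Definition pdim := #|{: pidx}|.
Implicit Types f : polyAut k n.

Definition par (x : 'rV[k]_pdim) (b : bool) : polymap k n n :=
  [tuple \sum_(m : 'X_{1..n < D}) x 0 (enum_rank ((b, i,
    m) : pidx)) *: 'X_[m] | i < n].

Definition side f (b : bool) : polymap k n n :=
  if b then (val f).1 else (val f).2.

(* The coefficients of [f] ([true]) and of its inverse ([false]). *)
Definition coef f : 'rV[k]_pdim :=
  \row_j let w : pidx := enum_val j in (tnth (side f w.1.1) w.1.2)@_(w.2).

Lemma sideV f b : side f^-1%g b = side f (~~ b).
Proof. by case: b. Qed.

Lemma coefE f b i (m : 'X_{1..n < D}) :
  coef f 0 (enum_rank ((b, i, m) : pidx)) = (tnth (side f b) i)@_m.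
Proof. by rewrite mxE enum_rankK. Qed.

Lemma par_coef f : (forall b i, (msize (tnth (side f b) i) <= D)%N) ->
  forall b, par (coef f) b = side f b.
Proof.
move=> h b; apply: eq_from_tnth => i; rewrite tnth_mktuple.
rewrite [RHS](mpolywE (h b i)); apply: eq_bigr => m _.
by rewrite coefE.
Qed.

Lemma mcoeff_par x b i (m : 'X_{1..n < D}) :
  (tnth (par x b) i)@_m = x 0 (enum_rank ((b, i, m) : pidx)).
Proof.
rewrite tnth_mktuple raddf_sum (bigD1 m) //= mcoeffZ mcoeffX eqxx mulr1.
rewrite big1 ?addr0 // => m' ne; rewrite mcoeffZ mcoeffX.
by rewrite -bmeqP (negPf ne) mulr0.
Qed.

Lemma coef_par x f : (forall b, par x b = side f b) -> coef f = x.
Proof.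
move=> e; apply/rowP => j; rewrite mxE /= -e.
case ew : (enum_val j) => [[b i] m] /=; rewrite mcoeff_par -ew enum_valK.
by [].
Qed.

Lemma polyfam_par N (F : 'rV[k]_N -> 'rV[k]_pdim) b i :
  (forall j, polyfun (fun x => F x 0 j)) ->
    polyfam (fun x => tnth (par (F x) b) i).
Proof.
move=> hF m.
have H : polyfam (fun x => \sum_(m : 'X_{1..n < D}) F x 0 (enum_rank ((b, i,
  m) : pidx)) *: 'X_[m]).
  by apply: polyfam_sum => m'; apply: polyfamZ => //; apply: polyfam_const.
by have [p hp] := H m; exists p => x; rewrite tnth_mktuple hp.
Qed.

Lemma polyfam_pcomp N (F F' : 'rV[k]_N -> 'rV[k]_pdim) b b' i :
  (forall j, polyfun (fun x => F x 0 j)) ->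
    (forall j, polyfun (fun x => F' x 0 j)) ->
  polyfam (fun x => tnth (pcomp (par (F x) b) (par (F' x) b')) i).
Proof.
move=> hF hF' m.
have H : polyfam (fun x => \sum_(m : 'X_{1..n < D}) F x 0 (enum_rank ((b, i,
  m) : pidx)) *:
    \prod_j tnth (par (F' x) b') j ^+ m j).
  apply: polyfam_sum => m'; apply: polyfamZ => //.
  by apply: polyfam_prod => j; apply: polyfamX; apply: polyfam_par.
have [p hp] := H m; exists p => x; rewrite -hp; congr (_@_m).
rewrite !tnth_mktuple raddf_sum; apply: eq_bigr => m' _ /=.
by rewrite comp_mpolyZ comp_mpolyX.
Qed.

Lemma polyfun_peval N (F : 'rV[k]_N -> 'rV[k]_pdim) (w : 'rV[k]_N ->
  'rV[k]_n) b i :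
  (forall j, polyfun (fun x => F x 0 j)) ->
    (forall j, polyfun (fun x => w x 0 j)) ->
  polyfun (fun x => peval (par (F x) b) (w x) 0 i).
Proof.
move=> hF hw.
have [p hp] : polyfun (fun x => \sum_(m : 'X_{1..n < D}) F x 0 (enum_rank ((b,
  i, m) : pidx)) *
    \prod_j w x 0 j ^+ m j).
  apply: polyfun_sum => m; apply: polyfunM => //.
  by apply: polyfun_prod => j; apply: polyfunX.
exists p => x; rewrite -hp mxE tnth_mktuple rmorph_sum;
  apply: eq_bigr => m _ /=.
by rewrite mevalZ mevalX.
Qed.

Section AlgebraicGroup.
Variable Nm : set (polyAut k n).
Hypothesis N1 : Nm 1%g.
Hypothesis NM : forall f g, Nm f -> Nm g -> Nm (f * g)%g.
Hypothesis NV : forall f, Nm f -> Nm f^-1%g.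
Hypothesis Nbound : forall f, Nm f ->
  forall i, (msize (tnth (val f).1 i) <= D)%N.
Hypothesis Nclosed : zclosed (coef @` Nm).

Lemma Nside f : Nm f -> forall b i, (msize (tnth (side f b) i) <= D)%N.
Proof. by move=> Nf [] i; [exact: Nbound|apply: (Nbound (NV Nf))]. Qed.

Lemma coef_inj f g : Nm f -> Nm g -> coef f = coef g -> f = g.
Proof.
move=> Nf Ng e; have es b : side f b = side g b.
  by rewrite -par_coef ?e ?par_coef //; apply: Nside.
apply/val_inj; move: (es true) (es false); rewrite /side /=.
by case: (polyAut_val f) => ? ?; case: (polyAut_val g) => ? ? /= -> ->.
Qed.

(** The group structure is carried over to the closed set of coefficient vectors, on which [coef] is
    injective because degrees are bounded on both sides. *)
Lemma bounded_closed_algebraic : algebraic_subgroup Nm.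
Proof.
have ex x : exists f, (coef @` Nm) x -> Nm f /\ coef f = x.
  have [[f Nf fx]|nx] := pselect ((coef @` Nm) x); last by exists 1%g.
  by exists f.
have [rho hrho] := choice ex.
have rhoK f : Nm f -> rho (coef f) = f.
  move=> Nf; have [Nr er] : Nm (rho (coef f)) /\ coef (rho (coef f)) = coef f.
    by apply: hrho; exists f.
  exact: coef_inj.
pose mulx x z := coef (rho x * rho z)%g; pose invx x := coef (rho x)^-1%g.
have mulE f g : Nm f -> Nm g -> mulx (coef f) (coef g) = coef (f * g)%g.
  by move=> Nf Ng; rewrite /mulx (rhoK f Nf) (rhoK g Ng).
have reg_mul : regular2 (coef @` Nm) (coef @` Nm) mulx.
  (* On the side of the inverses, the composition is in the opposite order. *)
  have ex2 (j : 'I_pdim) : polyfun (fun x : 'rV[k]_(pdim + pdim) =>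
      let w : pidx := enum_val j in
      (tnth (if w.1.1 then pcomp (par (lsubmx x) true) (par (rsubmx x) true)
             else pcomp (par (rsubmx x) false) (par (lsubmx x) false))
               w.1.2)@_(w.2)).
    case: (enum_val j) => [[b i] m] /=.
    have hl l : polyfun (fun x : 'rV[k]_(pdim + pdim) => lsubmx x 0 l).
      by have [p hp] := polyfun_coord k (lshift pdim l); exists p => x;
        rewrite -hp mxE.
    have hr l : polyfun (fun x : 'rV[k]_(pdim + pdim) => rsubmx x 0 l).
      by have [p hp] := polyfun_coord k (rshift pdim l); exists p => x;
        rewrite -hp mxE.
    by case: b; apply: polyfam_pcomp.
  have [P hP] := choice ex2; exists [tuple P j | j < pdim] =>
    _ _ [f Nf <-] [g Ng <-].
  apply/rowP => j; rewrite (mulE f g Nf Ng) !mxE tnth_mktuple -hP /= row_mxKl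
    row_mxKr.
  rewrite !par_coef; [|exact: Nside..].
  by case: (enum_val j) => [[[] i] m].
have reg_inv : regular (coef @` Nm) invx.
  exists [tuple let w : pidx := enum_val j in 'X_(enum_rank ((~~ w.1.1, w.1.2,
    w.2) : pidx)) | j < pdim].
  move=> _ [f Nf <-]; apply/rowP => j;
    rewrite !mxE tnth_mktuple mevalXU coefE rhoK //.
  by rewrite /= sideV.
have m1 : (coef @` Nm) (coef 1%g) by exists 1%g.
have mM x z : (coef @` Nm) x -> (coef @` Nm) z -> (coef @` Nm) (mulx x z).
  by move=> [f Nf <-] [g Ng <-]; exists (f * g)%g;
    [exact: NM|rewrite (mulE f g Nf Ng)].
have mV x : (coef @` Nm) x -> (coef @` Nm) (invx x).
  by move=> [f Nf <-]; exists (f^-1)%g; [exact: NV|rewrite /invx !rhoK].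
have mA x z w : (coef @` Nm) x -> (coef @` Nm) z -> (coef @` Nm) w ->
    mulx x (mulx z w) = mulx (mulx x z) w.
  move=> [f Nf <-] [g Ng <-] [h Nh <-].
  rewrite (mulE g h Ng Nh) (mulE f _ Nf (NM Ng Nh)) (mulE f g Nf Ng).
  by rewrite (mulE _ h (NM Nf Ng) Nh) mulgA.
have m1x x : (coef @` Nm) x -> mulx (coef 1%g) x = x.
  by move=> [f Nf <-]; rewrite (mulE _ f N1 Nf) mul1g.
have mVx x : (coef @` Nm) x -> mulx (invx x) x = coef 1%g.
  by move=> [f Nf <-]; rewrite /invx (rhoK f Nf) (mulE _ f (NV Nf) Nf) mulVg.
exists (AlgGroup Nclosed reg_mul reg_inv m1 mM mV mA m1x mVx), rho; split;
  last first.
  apply/seteqP; split=> [f Nf|_ [x Hx <-]] /=; last by have [] := hrho x Hx.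
  by exists (coef f); [exists f|exact: rhoK].
split=> [x z Hx Hz|] /=; first by rewrite rhoK //; apply: NM;
  [have [] := hrho x Hx|have [] := hrho z Hz].
have ex3 (i : 'I_n) : polyfun (fun x : 'rV[k]_(pdim + n) =>
  peval (par (lsubmx x) true) (rsubmx x) 0 i).
  apply: polyfun_peval => j.
    by have [p hp] := polyfun_coord k (lshift n j); exists p => x;
      rewrite -hp mxE.
  by have [p hp] := polyfun_coord k (rshift pdim j); exists p => x;
    rewrite -hp mxE.
have [P hP] := choice ex3; exists [tuple P i | i < n] => _ v [f Nf <-] _.
apply/rowP => i; rewrite [RHS]mxE tnth_mktuple -hP row_mxKl row_mxKr rhoK //.
by rewrite par_coef //; apply: Nside.
Qed.

End AlgebraicGroup.
End BoundedDegree.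

(** * Closedness of the normalizer *)

Section Normalizer.
Import Order.TTheory GRing.Theory.
Local Open Scope ring_scope.
Local Open Scope classical_set_scope.

Lemma normalizerP (k : closedFieldType) n (G : set (polyAut k n)) f :
  normalizer G f <-> normalizes G f.
Proof.
split=> [e g Gg|nf].
  have {}e : [set (f * g * f^-1)%g | g in G] = G := e.
  split; first by rewrite -[X in X (_ * _)%g]e; exists g.
  have : [set (f * g * f^-1)%g | g in G] g by rewrite e.
  by move=> [h Gh <-]; rewrite !mulgA mulVg mul1g mulgVK.
apply/seteqP; split=> [_ [g /nf[h _] <-]//|g Gg].
have [_ h] := nf g Gg; exists (f^-1 * g * f)%g => //.
by rewrite !mulgA mulgV mul1g mulgK.
Qed.

Lemma normalizes1 (k : closedFieldType) n (G : set (polyAut k n)) :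
  normalizes G 1%g.
Proof. by move=> g Gg; rewrite invg1 !mulg1 !mul1g. Qed.

Lemma normalizesM (k : closedFieldType) n (G : set (polyAut k n)) f h :
  normalizes G f -> normalizes G h -> normalizes G (f * h)%g.
Proof.
move=> nf nh g Gg; rewrite invgM; split.
  have [/nf[e _] _] := nh g Gg.
  by rewrite !mulgA in e *.
have [_ /nh[_ e]] := nf g Gg.
by rewrite !mulgA in e *.
Qed.

Lemma meval_act (k : closedFieldType) n (f : polyAut k n) (a :
  {mpoly k[n]}) (v : 'rV[k]_n) :
  (act f a).@[fun i => v 0 i] = a.@[fun i => aut_map f v 0 i].
Proof. by rewrite actE comp_mpoly_meval; apply: meval_eq => i; rewrite mxE. Qed.

Section NormalizerClosed.
Variables (k : closedFieldType) (n : nat).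
Hypothesis char0 : [pchar k] =i pred0.
Variables (G : set (polyAut k n)) (s : nat) (y : polymap k n s).
Variables (L : zmodType) (ch : L -> polyAut k n -> k) (M : 'I_s -> L).
Hypothesis y0 : forall j, tnth y j != 0.
Hypothesis yhom : forall j g, G g -> act g (tnth y j) = ch (M j) g *: tnth y j.
Hypothesis Gmem : forall (h : polyAut k n) (d : 'I_s -> k),
  (forall j, act h (tnth y j) = d j *: tnth y j) ->
  (forall a b : 'X_{1..s}, (forall g, G g -> ch (wt M a) g = ch (wt M b) g) ->
     \prod_j d j ^+ a j = \prod_j d j ^+ b j) -> G h.
Hypothesis wtE : forall m g, G g -> ch (wt M m) g = \prod_j ch (M j) g ^+ m j.
Variable D : nat.
Hypothesis Dbound : forall f, normalizes G f ->
  forall i, (msize (tnth (val f).1 i) <= D)%N.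

(** [C1] says that the two sides are mutually inverse, [C2] that the conjugates of the elements of
    [G] act on each [y_j] by a scalar, [C3] that these scalars obey the relations required by
    [Gmem]. The element of [G] is a mere index of equations, so nothing has to be polynomial in
    it. *)
Lemma coef_normalizer_closed : zclosed (@coef k n D @` normalizes G).
Proof.
have ex j : exists v : 'rV[k]_n, (tnth y j).@[fun i => v 0 i] != 0.
  have [w hw] := mpoly_nonroot char0 (y0 j); exists (\row_i w i).
  by rewrite (meval_eq (v2 := w)) // => i; rewrite mxE.
have [v hv] := choice ex.
pose Par := @par k n D.
pose conj (b : bool) (g : polyAut k n) x w : 'rV[k]_n :=
  peval (Par x b) (aut_map g (peval (Par x (~~ b)) w)).
pose ev (j : 'I_s) (w : 'rV[k]_n) := (tnth y j).@[fun i => w 0 i].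
(* The scalar is read off at a point where [y_j] does not vanish; its denominator does not involve
   [x]. *)
pose quo b g x j := ev j (conj b g x (v j)) / ev j (v j).
have coordP (l : 'I_(@pdim n D)) : polyfun (fun x : 'rV[k]_(@pdim n D) =>
  x 0 l) by apply: polyfun_coord.
have conj_poly b g w i : polyfun (fun x => conj b g x w 0 i).
  apply: polyfun_peval => // j; have [p hp] :=
    @polyfun_meval k _ n (tnth (val g).1 j)
    (fun i x => peval (Par x (~~ b)) w 0 i) (fun i =>
      polyfun_peval (~~ b) i coordP (fun j => polyfun_const _ (w 0 j))).
  by exists p => x; rewrite -hp mxE.
have ev_poly b g w j : polyfun (fun x => ev j (conj b g x w)).
  by apply: polyfun_meval => i; apply: conj_poly.
have quo_poly b g j : polyfun (fun x => quo b g x j).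
  by apply: polyfunM; [exact: ev_poly|exact: polyfun_const].
pose C1 := [set x | forall z : bool * 'I_n * 'X_{1..n},
  (tnth (pcomp (Par x z.1.1) (Par x (~~ z.1.1))) z.1.2)@_z.2 - (tnth (pid k n)
    z.1.2)@_z.2 = 0].
pose C2 := [set x | forall z : bool * {g | G g} * 'I_s * 'rV[k]_n,
  ev z.1.2 (conj z.1.1.1 (sval z.1.1.2) x z.2) - quo z.1.1.1 (sval z.1.1.2) x
    z.1.2 * ev z.1.2 z.2 = 0].
pose rel (ab : 'X_{1..s} * 'X_{1..s}) := forall g, G g ->
  ch (wt M ab.1) g = ch (wt M ab.2) g.
pose C3 := [set x | forall z : bool * {g | G g} * {ab | rel ab},
  \prod_j quo z.1.1 (sval z.1.2) x j ^+ (sval z.2).1 j -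
  \prod_j quo z.1.1 (sval z.1.2) x j ^+ (sval z.2).2 j = 0].
suff -> : @coef k n D @` normalizes G = C1 `&` (C2 `&` C3).
  apply: zclosedI; last apply: zclosedI; apply: zclosed_family => z.
  - by apply: polyfunB (polyfun_const _ _); apply: polyfam_pcomp.
  - by apply: polyfunB => //; apply: polyfunM => //; apply: polyfun_const.
  by apply: polyfunB; apply: polyfun_prod => j; apply: polyfunX.
apply/seteqP; split=> [_ [f nf <-]|x [h1 [h2 h3]]].
  have nV := normalizesV nf.
  have Pf b : Par (coef D f) b = side f b.
    by apply: par_coef => -[] i; [exact: Dbound|apply: (Dbound nV)].
  have conjE b g w : conj b g (coef D f) w =
      aut_map (if b then (f * g * f^-1)%g else (f^-1 * g * f)%g) w.
    by rewrite /conj !Pf; case: b; rewrite !aut_mapM.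
  have Gc b g : G g -> G (if b then (f * g * f^-1)%g else (f^-1 * g * f)%g).
    by move=> Gg; have [? ?] := nf g Gg; case: b.
  have evE b g j w : G g -> ev j (conj b g (coef D f) w) =
      ch (M j) (if b then (f * g * f^-1)%g else (f^-1 * g * f)%g) * ev j w.
    by move=> Gg; rewrite conjE /ev -meval_act yhom ?mevalZ //; apply: Gc.
  have quoE b g j : G g -> quo b g (coef D f) j =
      ch (M j) (if b then (f * g * f^-1)%g else (f^-1 * g * f)%g).
    by move=> Gg; rewrite /quo evE // mulfK //; apply: hv.
  split; [|split] => -[].
  - case=> b i m /=; apply/eqP; rewrite subr_eq0; apply/eqP; rewrite !Pf;
    congr (tnth _ _)@_m.
    by have /andP[/eqP e1 /eqP e2] := valP f; case: b.
  - by case=> -[b [g Gg]] j w /=; rewrite evE // quoE // subrr.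
  case=> b [g Gg] [[a a'] raa] /=.
  rewrite (eq_bigr _ (fun j _ => congr1 (fun c => c ^+ a j) (quoE b g j Gg))).
  rewrite (eq_bigr _ (fun j _ => congr1 (fun c => c ^+ a' j) (quoE b g j Gg))).
  by rewrite -!wtE ?raa ?subrr //; apply: Gc.
have E b : pcomp (Par x b) (Par x (~~ b)) = pid k n.
  apply: eq_from_tnth => i; apply/mpolyP => m.
  by have /eqP := h1 (b, i, m); rewrite subr_eq0 => /eqP.
have fax : polyAut_axiom (Par x true, Par x false).
  by rewrite /polyAut_axiom /= (E true) (E false) !eqxx.
pose f := PolyAut fax.
have sf b : Par x b = side f b by case: b.
exists f; last by apply: coef_par.
have conjE b g w : conj b g x w = aut_map (if b then (f * g * f^-1)%g else
  (f^-1 * g * f)%g) w.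
  by rewrite /conj !sf; case: b; rewrite !aut_mapM.
have Gc b g : G g -> G (if b then (f * g * f^-1)%g else (f^-1 * g * f)%g).
  move=> Gg; apply: (Gmem (d := quo b g x)) => [j|a a' raa].
    apply: (mpoly_eq_eval char0) => w; rewrite mevalZ meval_act.
    have /eqP := h2 (b, exist _ g Gg, j, w); rewrite subr_eq0 /= => /eqP.
    by rewrite conjE.
  by have /eqP := h3 (b, exist _ g Gg, exist _ (a, a') raa);
    rewrite subr_eq0 /= => /eqP.
by move=> g Gg; split; [exact: (Gc true)|exact: (Gc false)].
Qed.

End NormalizerClosed.
End Normalizer.

(** * Reduction to closed subgroups of tori *)

Section Main.
Import Order.TTheory GRing.Theory.
Local Open Scope ring_scope.
Local Open Scope classical_set_scope.

Lemma torus_normalizer_algebraic (k : closedFieldType) (char0 :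
  [pchar k] =i pred0) (n r d : nat)
    (T : set 'rV[k]_(r + r)) (tau : 'rV[k]_(r + r) -> polyAut k n)
    (q : 'I_d -> {mpoly k[r + r]}) :
  closed_subgroup (K := diagGroup k r) T ->
  (forall u v, T u -> T v -> tau (diag_mul u v) = (tau u * tau v)%g) ->
  (forall u v, T u -> T v -> tau u = tau v -> u = v) ->
  regular2 T setT (fun u v => aut_map (tau u) v) ->
  alg_indep_on T q -> (n <= d.+1)%N ->
  algebraic_subgroup (normalizer (tau @` T)).
Proof.
move=> [[Tcl Tsub] T1 TM _] tauM tau_inj tau_reg hq nd.
have ex g : exists u, (tau @` T) g -> T u /\ tau u = g.
  have [[u Tu ug]|ng] := pselect ((tau @` T) g); last by exists 0.
  by exists u.
have [sigma hsigma] := choice ex.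
have sigmaK u : T u -> sigma (tau u) = u.
  move=> Tu; have [|Ts es] := hsigma (tau u); first by exists u.
  exact: tau_inj.
have [s [y [M [ylead yhom ygen]]]] :=
  homogeneous_generators char0 Tsub T1 TM tauM tau_reg sigmaK.
have bound := torus_normalizer_bounded char0 Tcl Tsub T1 TM tauM sigmaK ylead
  yhom ygen tau_inj hq nd.
have [K hK] := choice (fun i : 'I_n => bound 'X_i).
(* A common degree bound for the coordinates; it also covers the inverses, which normalize as
   well. *)
pose D := (\sum_i K i)%N.
have Dbound f : normalizes (tau @` T) f ->
  forall i, (msize (tnth (val f).1 i) <= D)%N.
  move=> nf i; have := hK i f nf; rewrite actE comp_mpolyXU -tnth_nth => h.
  by apply: leq_trans h _; rewrite /D (bigD1 i) //= leq_addr.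
have -> : normalizer (tau @` T) = normalizes (tau @` T).
  by apply/seteqP; split=> f /normalizerP.
apply: (@bounded_closed_algebraic k n D) => //.
- exact: normalizes1.
- by move=> f g; apply: normalizesM.
- by move=> f; apply: normalizesV.
apply: (coef_normalizer_closed char0 (y_neq0 ylead) yhom) Dbound =>
  [h e hd rel|m g Gg].
  exact: (Tgrp_membership Tcl Tsub T1 TM tauM sigmaK ylead yhom ygen hd rel).
rewrite /wt (ch_sum (@tch0 k n r T tau sigma) (tchD Tsub sigmaK)) //.
apply: eq_bigr => j _.
by rewrite (chMn (@tch0 k n r T tau sigma) (tchD Tsub sigmaK)).
Qed.

End Main.

Theorem theorem16 (k : closedFieldType) (char0 : ([pchar k] =i pred0)%R)
    (n : nat) (G : set (polyAut k n)) (d : nat)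
    (diagG : diagonalizable_subgroup_of_dim G d) (dimG : n.-1 <= d) :
  algebraic_subgroup (normalizer G).
Proof.
have [H [rho [[[rhoM [P hP]] -> rho_inj] [r [T [hT [f [g [[_ [Q hQ]] fg gf
  fM]]]]]] dimH]]] := diagG.
have [[c hc] _] := dimH.
have [q hq] := chain_alg_indep hc.
(* [G] is reparametrized by the closed subgroup [T] of a torus isomorphic to [H]. *)
have -> : (rho @` ag_set H)%classic = ((rho \o g) @` T)%classic.
  apply/seteqP; split=> [_ [x Hx <-]|_ [u Tu <-]].
    by have [Tfx <-] := fg x Hx; exists (f x).
  by have [Hgu _] := gf u Tu; exists (g u).
have gM u v : T u -> T v -> g (diag_mul u v) = ag_mul H (g u) (g v).
  move=> Tu Tv; have [Hu fu] := gf u Tu; have [Hv fv] := gf v Tv.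
  have [_ <-] := fg _ (ag_memM Hu Hv).
  by rewrite fM // fu fv.
apply: (@torus_normalizer_algebraic k char0 n r d T (rho \o g) (fun i =>
  (q i \mPo Q)%R) hT).
- move=> u v Tu Tv /=; have [Hu _] := gf u Tu; have [Hv _] := gf v Tv.
  by rewrite gM // rhoM.
- move=> u v Tu Tv /= e; have [Hu fu] := gf u Tu; have [Hv fv] := gf v Tv.
  by rewrite -fu -fv (rho_inj _ _ Hu Hv e).
- exists (pcomp P [tuple match split i with
      | inl j => (tnth Q j \mPo [tuple 'X_(lshift n l) | l < r + r])%R
      | inr j => ('X_(rshift (r + r) j))%R end | i < ag_dim H + n]) => u v Tu _.
  have [Hu _] := gf u Tu; rewrite peval_comp /= hP //; congr (peval P _).
  apply/rowP => i; rewrite !mxE tnth_mktuple.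
  case: (split i) => j; last by rewrite mevalXU row_mxEr.
  rewrite hQ // mxE comp_mpoly_meval; apply: meval_eq => l.
  by rewrite tnth_mktuple mevalXU row_mxEl.
(* The independent functions on [H] are pulled back to [T] along the polynomials [Q] of the
   isomorphism. *)
- move=> F /hq[x Hx hx]; have [Tfx gfx] := fg x Hx; exists (f x) => //.
  rewrite (meval_eq (v2 := fun j => ((q j).@[fun l => x ord0 l])%R)) // => j.
  rewrite comp_mpoly_meval; apply: meval_eq => l.
  by rewrite -[in RHS]gfx hQ // mxE.
(* The truncated predecessor makes [n = 0] a separate, trivial case. *)
by case: n dimG {G diagG rho rhoM P hP rho_inj} => [|m] //; rewrite ltnS.
Qed.
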